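(* For $B > 0$ let $\phi_B(x) = \sin(2\pi B x)/(\pi x)$, so that $\widehat{\phi}_B = \chi_{[-B,B]}$. Let $\alpha > 0$ and $\beta > 0$. For any $\epsilon > 0$ and any $y \in L^2(\mathbb{R}) \setminus \{0\}$, there exist a constant $B > 0$ and a Hilbert-Schmidt operator $H$ in $OPW([-\alpha,\alpha] \times [-\beta,\beta])$ such that $\| H \phi_B - y \|_{L^2} < \epsilon$. Moreover, one can choose any $B > 0$ satisfying $\int_{\mathbb{R} \setminus [-B,B]} |\widehat{y}(\xi)|^2 \, d\xi < c \, \epsilon$ for some $0 < c < 1$; in particular, if $y$ is bandlimited to $[-M,M]$ (i.e. $\operatorname{supp} \widehat{y} \subset [-M,M]$), then $B$ can be chosen to be $M$.
   Context: $\chi_{[-B,B]}$ is the characteristic function of $[-B,B]$, and the Fourier transform is $\widehat{f}(\xi) = \int f(x)\, e^{-2\pi i x \xi}\, dx$ (extended to $L^2(\mathbb{R})$). Every bounded linear operator $H : L^2(\mathbb{R}) \to L^2(\mathbb{R})$ corresponds uniquely to its spreading function (in general a tempered distribution) $\eta_H$ on $\mathbb{R}^2$, characterized by $$Hf(x) = \iint_{\mathbb{R}^2} \eta_H(t,\nu) \, e^{2\pi i x \nu} f(x-t) \, dt \, d\nu$$ (in the weak sense). If $H$ is Hilbert-Schmidt, then $\eta_H \in L^2(\mathbb{R}^2)$ and $\|H\|_{HS} = \|\eta_H\|_{L^2(\mathbb{R}^2)}$. For $S \subset \mathbb{R}^2$ the operator Paley-Wiener space is $OPW(S) = \{ H \in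 \mathcal{L}(L^2(\mathbb{R})) : \operatorname{supp} \eta_H \subset S \}$, where $\mathcal{L}(L^2(\mathbb{R}))$ denotes the bounded linear operators on $L^2(\mathbb{R})$. *)

(* Defs.v *)
From HB Require Import structures.
From mathcomp Require Import all_boot all_order all_algebra.
From mathcomp Require Import complex.
From mathcomp Require Import all_classical all_reals all_analysis.

Set Implicit Arguments.
Unset Strict Implicit.
Unset Printing Implicit Defensive.

Import Order.TTheory GRing.Theory Num.Theory.
Import numFieldNormedType.Exports.

Local Open Scope classical_set_scope.
Local Open Scope complex_scope.
Local Open Scope ring_scope.

(* R is an arbitrary [realType] of MathComp-Analysis, R[i] its complex numbers;
   [complex.Re], [complex.Im] and [Normc.normc] are R-valued. *)

Section L2.
Variable R : realType.
Local Notation mu := (@lebesgue_measure R).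
Implicit Types (f g : R -> R[i]) (D : set R).

Definition cmeasurable f : Prop :=
  measurable_fun setT (fun x => complex.Re (f x)) /\
  measurable_fun setT (fun x => complex.Im (f x)).

(* Meaningful for integrable f; in particular for products of two
   square-integrable functions. *)
Definition cintegral D f : R[i] :=
  Rintegral mu D (fun x => complex.Re (f x)) +i*
  Rintegral mu D (fun x => complex.Im (f x)).

(* Elements of L^2(R) are represented by functions; equality in L^2(R) is
   equality almost everywhere, [aeeq]. *)
Definition aeeq f g : Prop := {ae mu, forall x, f x = g x}.

Definition L2norm f : \bar R :=
  Lnorm mu 2%:E (fun x => (Normc.normc (f x))%:E).

Definition inL2 f : Prop := cmeasurable f /\ (L2norm f < +oo)%E.

Definition inner f g : R[i] := cintegral setT (fun x => f x * (g x)^*).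

Definition cis (theta : R) : R[i] := cos theta +i* sin theta.

(* The Fourier transform on L^2(R), as a relation: [g] is the limit in L^2 of
   the transforms of the truncations of [f] to [-n, n].  Those are integrable,
   and [g] is unique up to [aeeq]. *)
Definition truncated_fourier (n : nat) f (xi : R) : R[i] :=
  cintegral `[- n%:R, n%:R]%classic
    (fun x => f x * cis (- (2 * pi * x * xi))).

Definition is_fourier f g : Prop :=
  inL2 g /\
  (fun n : nat => L2norm (fun xi => truncated_fourier n f xi - g xi)) @ \oo
    --> 0%E.

(* Support of a class of functions modulo [aeeq]. *)
Definition ess_supp f : set R :=
  [set x | ~ exists U : set R,
      [/\ open U, U x & {ae mu, forall y, U y -> f y = 0}]].

(* The value at 0 is the continuous extension. *)
Definition phi (B : R) (x : R) : R[i] :=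
  (if x == 0 then 2 * B else sin (2 * pi * B * x) / (pi * x))%:C.

(* Bounded linear operators on L^2(R), acting on representatives. *)
Record bounded_operator (H : (R -> R[i]) -> (R -> R[i])) : Prop := {
  bop_L2 : forall f, inL2 f -> inL2 (H f) ;
  bop_ae : forall f g, inL2 f -> inL2 g -> aeeq f g -> aeeq (H f) (H g) ;
  bop_linear : forall (a : R[i]) f g, inL2 f -> inL2 g ->
    aeeq (H (fun x => a * f x + g x)) (fun x => a * H f x + H g x) ;
  bop_bounded : exists K : R, forall f, inL2 f ->
    (L2norm (H f) <= K%:E * L2norm f)%E }.

Definition orthonormal_basis (e : nat -> R -> R[i]) : Prop :=
  [/\ forall n, inL2 (e n),
      forall m n, inner (e m) (e n) = (m == n)%:R
    & forall f, inL2 f -> (forall n, inner f (e n) = 0) -> aeeq f (cst 0)].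

(* L^2(R) is separable and infinite-dimensional, so its orthonormal bases are
   exactly those indexed by nat; the sum does not depend on the basis. *)
Definition hilbert_schmidt (H : (R -> R[i]) -> (R -> R[i])) : Prop :=
  bounded_operator H /\
  forall e, orthonormal_basis e ->
    (\sum_(0 <= n <oo) (L2norm (H (e n)) * L2norm (H (e n))) < +oo)%E.

End L2.

Section distributions.
Variables (R : realType) (V : normedModType R).
Implicit Types (f : V -> R[i]) (w : seq V).

(* Iterated directional derivative along the directions listed in [w]. *)
Definition iter_derive w (h : V -> R^o) : V -> R^o :=
  foldr (fun v k => 'D_v k) h w.

Definition rsmooth (h : V -> R^o) : Prop :=
  forall w, continuous (iter_derive w h) /\
    forall (z v : V), derivable (iter_derive w h) z v.

Definition smooth f : Prop :=
  rsmooth (fun z => complex.Re (f z)) /\ rsmooth (fun z => complex.Im (f z)).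

Definition citer_derive w f (z : V) : R[i] :=
  iter_derive w (fun z => complex.Re (f z)) z +i*
  iter_derive w (fun z => complex.Im (f z)) z.

Definition schwartz f : Prop :=
  smooth f /\
  forall w (k : nat), exists C : R, forall z : V,
    (1 + `|z|) ^+ k * Normc.normc (citer_derive w f z) <= C.

(* A functional only matters through its values on Schwartz functions.
   Continuity is the bound by finitely many Schwartz seminorms, the
   derivatives being taken along directions in the unit ball. *)
Definition tempered_distribution (u : (V -> R[i]) -> R[i]) : Prop :=
  (forall (a : R[i]) f g, schwartz f -> schwartz g ->
     u (fun z => a * f z + g z) = a * u f + u g) /\
  exists (N : nat) (K : R), forall f (A : R), schwartz f ->
    (forall w, (size w <= N)%N -> (forall v, v \in w -> `|v| <= 1) ->
       forall z, (1 + `|z|) ^+ N * Normc.normc (citer_derive w f z) <= A) ->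
    Normc.normc (u f) <= K * A.

Definition test_function (U : set V) f : Prop :=
  [/\ smooth f, compact (closure [set z | f z != 0])
    & closure [set z | f z != 0] `<=` U].

Definition distr_supp (u : (V -> R[i]) -> R[i]) : set V :=
  [set z | ~ exists U : set V,
      [/\ open U, U z & forall f, test_function U f -> u f = 0]].

End distributions.

Section OPW.
Variable R : realType.

(* <M_nu T_t f, g> as a function of (t, nu), where T_t is translation by t and
   M_nu is modulation by nu. *)
Definition tf_shift_coef (f g : R -> R[i]) (z : (R^o * R^o)%type) : R[i] :=
  inner (fun x => cis (2 * pi * x * z.2) * f (x - z.1)) g.

(* Weak form of H = \iint eta(t, nu) M_nu T_t dt dnu, tested against Schwartz
   functions f, g; [eta] acts bilinearly. *)
Definition spreading_function (H : (R -> R[i]) -> (R -> R[i]))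
    (eta : ((R^o * R^o)%type -> R[i]) -> R[i]) : Prop :=
  tempered_distribution eta /\
  forall f g : R^o -> R[i], schwartz f -> schwartz g ->
    inner (H f) g = eta (tf_shift_coef f g).

Definition OPW (S : set (R^o * R^o)%type) (H : (R -> R[i]) -> (R -> R[i])) :
    Prop :=
  bounded_operator H /\
  exists eta, spreading_function H eta /\ distr_supp eta `<=` S.

End OPW.

(* Main.v *)
(** Take [H f = m . (k * f)], a convolution with a bounded kernel [k] supported in
    [[-alpha, alpha]] followed by multiplication by [m = phi_d / (2 d)], [d <= beta];
    its spreading function is [k t . (2 d)^-1 1_{]-d, d[} nu].  As [d] tends to 0, [m]
    tends boundedly to 1, so [H phi_B] is close to [k * phi_B], whose transform is
    [1_{]-B, B[} . FT k]; by Plancherel it remains to approximate [yhat] in L^2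
    by the transforms [FT k] on [[-B, B]].  These are dense there: a uniform limit of such
    transforms multiplied by [xi] is again one (difference quotients of the kernel), so
    they reach the polynomials.  [H] is Hilbert-Schmidt by Bessel's inequality applied to
    the reflected basis, which bounds [\sum |H e_n x|^2] by [|m x|^2 ||k||^2].
    Plancherel is obtained by inserting the weight [e^{-eps |xi|}], whose transform is
    the Poisson kernel, and letting [eps] tend to 0. *)

Require Import Defs.
From HB Require Import structures.
From mathcomp Require Import all_boot all_order all_algebra.
From mathcomp Require Import complex ring lra.
From mathcomp Require Import all_classical all_reals all_analysis measurable_realfun.
Set Implicit Arguments.
Unset Strict Implicit.
Unset Printing Implicit Defensive.
Import Order.TTheory GRing.Theory Num.Theory.
Import numFieldNormedType.Exports.
Local Open Scope classical_set_scope.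
Local Open Scope ring_scope.

(** For [k] nonzero, convolution by [k] alone has the spreading function k(t) delta(nu), which
    already lies in the rectangle, but it is not Hilbert-Schmidt; the L^2 factor [m] repairs this at
    the price of a spread of size [d] in nu. That [k] must be short costs nothing: a nonzero
    band-limited function cannot vanish on an interval. The proof reaches the resulting density
    directly, through polynomials.

    The transform [yhat] is known only as an L^2 limit of truncated transforms, and the two halves
    of Plancherel are of unequal difficulty. The upper bound needs only polarisation and the unit
    mass of the Poisson kernel. The lower bound must control f(s) - f(t) near the diagonal, so it is
    first proved for functions that are Lipschitz on an interval and then extended by density of
    polynomials, which thus serve twice.

    Fourier inversion is replaced by a one-sided estimate: [IFT] is the adjoint of [FT], and
    expanding squares gives ||IFT h - y|| <= ||h - yhat||, the direction that the approximation
    uses. *)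

Local Notation nc := Normc.normc.

(** * Complex-valued integrals *)

Section complex_modulus.
Local Open Scope complex_scope.
Local Open Scope ring_scope.
Variable R : realType.
Implicit Types (z w : R[i]) (x : R).

Lemma ReD z w : complex.Re (z + w) = complex.Re z + complex.Re w.
Proof. by case: z w => [? ?] [? ?]. Qed.

Lemma ImD z w : complex.Im (z + w) = complex.Im z + complex.Im w.
Proof. by case: z w => [? ?] [? ?]. Qed.

Lemma ReN z : complex.Re (- z) = - complex.Re z.
Proof. by case: z. Qed.

Lemma ImN z : complex.Im (- z) = - complex.Im z.
Proof. by case: z. Qed.

Lemma ReM z w :
  complex.Re (z * w) = complex.Re z * complex.Re w - complex.Im z * complex.Im w.
Proof. by case: z w => [? ?] [? ?]. Qed.

Lemma ImM z w :
  complex.Im (z * w) = complex.Re z * complex.Im w + complex.Im z * complex.Re w.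
Proof. by case: z w => [? ?] [? ?]. Qed.

Lemma ReJ z : complex.Re z^* = complex.Re z.
Proof. by case: z. Qed.

Lemma ImJ z : complex.Im z^* = - complex.Im z.
Proof. by case: z. Qed.

Definition ReImE := (ReD, ImD, ReN, ImN, ReM, ImM, ReJ, ImJ).

Lemma ReIm_inj z w :
  complex.Re z = complex.Re w -> complex.Im z = complex.Im w -> z = w.
Proof. by case: z w => [? ?] [? ?] /= -> ->. Qed.

Lemma sqr_nc z : nc z ^+ 2 = complex.Re z ^+ 2 + complex.Im z ^+ 2.
Proof. by case: z => a b /=; rewrite sqr_sqrtr// addr_ge0 ?sqr_ge0. Qed.

Lemma nc_ge0 z : 0 <= nc z.
Proof. by case: z => a b /=; rewrite sqrtr_ge0. Qed.

Lemma ncD z w : nc (z + w) <= nc z + nc w.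
Proof. exact: le_normcD. Qed.

Lemma ncN z : nc (- z) = nc z.
Proof. exact: normcN. Qed.

Lemma ncB z w : nc (z - w) <= nc z + nc w.
Proof. by rewrite -(ncN w); exact: ncD. Qed.

Lemma ncJ z : nc z^* = nc z.
Proof. by case: z => a b /=; rewrite sqrrN. Qed.

Lemma ncR x : nc x%:C = `|x|.
Proof. by rewrite /= expr0n addr0 sqrtr_sqr. Qed.

Lemma Re_le_nc z : `|complex.Re z| <= nc z.
Proof.
case: z => a b /=; rewrite -(sqrtr_sqr a) ler_sqrt ?lerDl ?sqr_ge0//.
by rewrite addr_ge0 ?sqr_ge0.
Qed.

Lemma Im_le_nc z : `|complex.Im z| <= nc z.
Proof.
case: z => a b /=; rewrite -(sqrtr_sqr b) ler_sqrt ?lerDr ?sqr_ge0//.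
by rewrite addr_ge0 ?sqr_ge0.
Qed.

Lemma nc_le_ReIm z : nc z <= `|complex.Re z| + `|complex.Im z|.
Proof.
rewrite -(@ler_pXn2r _ 2)// ?nnegrE ?nc_ge0 ?addr_ge0//.
rewrite sqr_nc -(real_normK (num_real (complex.Re z))).
rewrite -(real_normK (num_real (complex.Im z))).
have := mulr_ge0 (normr_ge0 (complex.Re z)) (normr_ge0 (complex.Im z)); lra.
Qed.

Lemma cisD x y : cis (x + y) = cis x * cis y :> R[i].
Proof.
by apply: ReIm_inj; rewrite !ReImE /= ?cosD ?sinD; ring.
Qed.

Lemma cisN x : cis (- x) = (cis x)^* :> R[i].
Proof. by rewrite /cis cosN sinN. Qed.

Lemma nc_cis x : nc (cis x) = 1.
Proof. by rewrite /= cos2Dsin2 sqrtr1. Qed.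

Lemma Re_cis x : complex.Re (cis x) = cos x. Proof. by []. Qed.

Lemma Im_cis x : complex.Im (cis x) = sin x. Proof. by []. Qed.

Lemma ReZ x z : complex.Re (x%:C * z) = x * complex.Re z.
Proof. by case: z => ? ? /=; rewrite mul0r subr0. Qed.

Lemma ImZ x z : complex.Im (x%:C * z) = x * complex.Im z.
Proof. by case: z => ? ? /=; rewrite mul0r addr0. Qed.

Lemma mulJc z : z * z^* = (nc z ^+ 2)%:C.
Proof. by apply: ReIm_inj; rewrite !ReImE /= ?sqr_nc; ring. Qed.

Lemma conjcM z w : (z * w)^* = z^* * w^*.
Proof. by apply: ReIm_inj; rewrite !ReImE//; ring. Qed.

End complex_modulus.

Section complex_integral.
Local Open Scope complex_scope.
Local Open Scope ring_scope.
Context d (T : measurableType d) (R : realType).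
Implicit Types (f g : T -> R[i]) (m : {measure set T -> \bar R}).

Definition cmeas f : Prop :=
  measurable_fun setT (fun x => complex.Re (f x)) /\
  measurable_fun setT (fun x => complex.Im (f x)).

Lemma cmeasD f g : cmeas f -> cmeas g -> cmeas (fun x => f x + g x).
Proof.
move=> [f1 f2] [g1 g2]; split.
  by under eq_fun do rewrite ReD; exact: measurable_funD.
by under eq_fun do rewrite ImD; exact: measurable_funD.
Qed.

Lemma cmeasM f g : cmeas f -> cmeas g -> cmeas (fun x => f x * g x).
Proof.
move=> [f1 f2] [g1 g2]; split.
  under eq_fun do rewrite ReM.
  by apply: measurable_funB; apply: measurable_funM.
under eq_fun do rewrite ImM.
by apply: measurable_funD; apply: measurable_funM.
Qed.

Lemma cmeasJ f : cmeas f -> cmeas (fun x => (f x)^*).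
Proof.
move=> [f1 f2]; split.
  by under eq_fun do rewrite ReJ.
by under eq_fun do rewrite ImJ; exact: measurable_funN.
Qed.

Lemma cmeas_cst (c : R[i]) : cmeas (cst c).
Proof. by split; exact: measurable_cst. Qed.

Lemma cmeas_real (h : T -> R) : measurable_fun setT h -> cmeas (fun x => (h x)%:C).
Proof. by move=> mh; split => //=. Qed.

Lemma cmeasN f : cmeas f -> cmeas (fun x => - f x).
Proof.
move=> [f1 f2]; split.
  by under eq_fun do rewrite ReN; exact: measurable_funN.
by under eq_fun do rewrite ImN; exact: measurable_funN.
Qed.

Lemma cmeasB f g : cmeas f -> cmeas g -> cmeas (fun x => f x - g x).
Proof. by move=> mf mg; exact: cmeasD (cmeasN mg). Qed.

Lemma cmeas_cis (h : T -> R) : measurable_fun setT h -> cmeas (fun x => cis (h x)).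
Proof.
move=> mh; split => /=; apply: measurableT_comp => //.
- by apply: continuous_measurable_fun; exact: continuous_cos.
- by apply: continuous_measurable_fun; exact: continuous_sin.
Qed.

Lemma measurable_nc2 f : cmeas f -> measurable_fun setT (fun x => nc (f x) ^+ 2).
Proof.
move=> [f1 f2]; under eq_fun do rewrite sqr_nc.
by apply: measurable_funD; apply: measurable_funX.
Qed.

Lemma measurable_nc f : cmeas f -> measurable_fun setT (fun x => nc (f x)).
Proof.
move=> mf; have -> : (fun x => nc (f x)) = (fun x => Num.sqrt (nc (f x) ^+ 2)).
  by apply/funext => x; rewrite sqrtr_sqr ger0_norm// nc_ge0.
by apply: measurableT_comp; [apply: continuous_measurable_fun; exact: sqrt_continuous|exact: measurable_nc2].
Qed.

Definition cintg m f : Prop :=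
  m.-integrable setT (fun x => (complex.Re (f x))%:E) /\
  m.-integrable setT (fun x => (complex.Im (f x))%:E).

(** A version of [cintegral setT] for any measure, product measures included. For Lebesgue measure,
    [inner f g] is convertible to a [Cint], and many proofs below rely on this conversion. *)
Definition Cint m f : R[i] :=
  Rintegral m setT (fun x => complex.Re (f x)) +i*
  Rintegral m setT (fun x => complex.Im (f x)).

Lemma cintg_meas m f : cintg m f -> cmeas f.
Proof.
by move=> [/integrableP[/measurable_EFinP ? _] /integrableP[/measurable_EFinP ? _]].
Qed.

Lemma le_cintg m f (g : T -> R) : cmeas f -> (forall x, nc (f x) <= g x) ->
  m.-integrable setT (fun x => (g x)%:E) -> cintg m f.
Proof.
move=> [f1 f2] fg ig.
split; apply: le_integrable ig => //; try exact/measurable_EFinP.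
- move=> x _; rewrite lee_fin; apply: le_trans (Re_le_nc _) _.
  by apply: le_trans (fg x) _; rewrite ler_norm.
- move=> x _; rewrite lee_fin; apply: le_trans (Im_le_nc _) _.
  by apply: le_trans (fg x) _; rewrite ler_norm.
Qed.

Lemma cintg_nc m f : cintg m f -> m.-integrable setT (fun x => (nc (f x))%:E).
Proof.
move=> cf; have mf := cintg_meas cf; case: cf => i1 i2.
apply: (le_integrable measurableT _ _
  (integrableD measurableT (integrable_abse i1) (integrable_abse i2))).
  by apply/measurable_EFinP; exact: measurable_nc.
move=> x _ /=; rewrite lee_fin (ger0_norm (nc_ge0 _)).
by rewrite ger0_norm ?addr_ge0// nc_le_ReIm.
Qed.

Lemma cintgD m f g : cintg m f -> cintg m g -> cintg m (fun x => f x + g x).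
Proof.
move=> [f1 f2] [g1 g2]; split.
  by under eq_fun do rewrite ReD EFinD; exact: integrableD.
by under eq_fun do rewrite ImD EFinD; exact: integrableD.
Qed.

Lemma rintgZ m (c : R) (h : T -> R) : m.-integrable setT (fun x => (h x)%:E) ->
  m.-integrable setT (fun x => (c * h x)%:E).
Proof. by move=> ih; under eq_fun do rewrite EFinM; exact: integrableZl. Qed.

Lemma rintgD m (g h : T -> R) : m.-integrable setT (fun x => (g x)%:E) ->
  m.-integrable setT (fun x => (h x)%:E) ->
  m.-integrable setT (fun x => (g x + h x)%:E).
Proof. by move=> ig ih; under eq_fun do rewrite EFinD; exact: integrableD. Qed.

Lemma rintgB m (g h : T -> R) : m.-integrable setT (fun x => (g x)%:E) ->
  m.-integrable setT (fun x => (h x)%:E) ->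
  m.-integrable setT (fun x => (g x - h x)%:E).
Proof. by move=> ig ih; under eq_fun do rewrite EFinB; exact: integrableB. Qed.

Lemma cintgZ m (c : R[i]) f : cintg m f -> cintg m (fun x => c * f x).
Proof.
move=> cf; apply: (@le_cintg _ _ (fun x => nc c * nc (f x))).
- exact: cmeasM (cmeas_cst c) (cintg_meas cf).
- by move=> x; rewrite Normc.normcM.
- by apply: rintgZ; exact: cintg_nc.
Qed.

Lemma cintgJ m f : cintg m f -> cintg m (fun x => (f x)^*).
Proof.
move=> cf; apply: (@le_cintg _ _ (fun x => nc (f x))).
- exact: cmeasJ (cintg_meas cf).
- by move=> x; rewrite ncJ.
- exact: cintg_nc.
Qed.

Lemma CintD m f g : cintg m f -> cintg m g ->
  Cint m (fun x => f x + g x) = Cint m f + Cint m g.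
Proof.
move=> [f1 f2] [g1 g2]; apply: ReIm_inj; rewrite !ReImE /= -RintegralD//.
- by apply: eq_Rintegral => x _; rewrite ReD.
- by apply: eq_Rintegral => x _; rewrite ImD.
Qed.

Lemma CintZ m (c : R[i]) f : cintg m f ->
  Cint m (fun x => c * f x) = c * Cint m f.
Proof.
move=> [f1 f2]; apply: ReIm_inj; rewrite !ReImE /= -!RintegralZl//.
- rewrite -RintegralB//; first by apply: eq_Rintegral => x _; rewrite ReM.
  + exact: rintgZ.
  + exact: rintgZ.
- rewrite -RintegralD//; first by apply: eq_Rintegral => x _; rewrite ImM.
  + exact: rintgZ.
  + exact: rintgZ.
Qed.

Lemma cintgN m f : cintg m f -> cintg m (fun x => - f x).
Proof. by move=> /(cintgZ (-1)); under eq_fun do rewrite mulN1r. Qed.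

Lemma CintN m f : cintg m f -> Cint m (fun x => - f x) = - Cint m f.
Proof. by move=> /(CintZ (-1)); under eq_fun do rewrite mulN1r; rewrite mulN1r. Qed.

Lemma cintgB m f g : cintg m f -> cintg m g -> cintg m (fun x => f x - g x).
Proof. by move=> cf cg; exact: cintgD (cintgN cg). Qed.

Lemma CintB m f g : cintg m f -> cintg m g ->
  Cint m (fun x => f x - g x) = Cint m f - Cint m g.
Proof. by move=> cf cg; rewrite CintD ?CintN//; exact: cintgN. Qed.

Lemma CintJ m f : cintg m f -> Cint m (fun x => (f x)^*) = (Cint m f)^*.
Proof.
move=> [f1 f2]; apply: ReIm_inj; rewrite !ReImE /=.
- by apply: eq_Rintegral => x _; rewrite ReJ.
- rewrite -mulN1r -RintegralZl//.
  by apply: eq_Rintegral => x _; rewrite ImJ mulN1r.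
Qed.

(* The phase of the integral is rotated away. *)
Lemma le_nc_Cint m f : cintg m f ->
  nc (Cint m f) <= Rintegral m setT (fun x => nc (f x)).
Proof.
move=> cf; set I := Cint m f.
have [->|I0] := eqVneq (nc I) 0; first by apply: Rintegral_ge0 => x _; exact: nc_ge0.
have I_gt0 : 0 < nc I by rewrite lt_neqAle eq_sym I0 nc_ge0.
rewrite -(ler_pM2l I_gt0) -expr2.
have -> : nc I ^+ 2 = complex.Re (Cint m (fun x => I^* * f x)).
  by rewrite CintZ// mulrC mulJc.
have cg := cintgZ I^* cf.
rewrite -RintegralZl//; last exact: cintg_nc.
apply: le_Rintegral => //; first by case: cg.
- by apply: rintgZ; exact: cintg_nc.
- move=> x _; apply: le_trans (ler_norm _) (le_trans (Re_le_nc _) _).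
  by rewrite Normc.normcM ncJ.
Qed.

Lemma eq_Cint m f g : f =1 g -> Cint m f = Cint m g.
Proof. by move=> fg; congr (Cint m _); exact/funext. Qed.

End complex_integral.

(** * Fubini for functions dominated by a product *)

Section dominated_fubini.
Local Open Scope complex_scope.
Local Open Scope ring_scope.
Context d1 d2 (T1 : measurableType d1) (T2 : measurableType d2) (R : realType).
Variables (m1 : {sigma_finite_measure set T1 -> \bar R})
          (m2 : {sigma_finite_measure set T2 -> \bar R}).
Variables (a : T1 -> R) (b : T2 -> R).
Hypothesis ia : m1.-integrable setT (fun x => (a x)%:E).
Hypothesis ib : m2.-integrable setT (fun x => (b x)%:E).

Section real.
Variable f : T1 * T2 -> R.
Hypothesis mf : measurable_fun setT f.
Hypothesis fab : forall x y, `|f (x, y)| <= a x * b y.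

Let ab_norm x y : `|f (x, y)| <= `|a x| * `|b y|.
Proof. by apply: le_trans (fab x y) _; rewrite -normrM ler_norm. Qed.

(** A product bound, rather than mere integrability on the product space, makes every section
    integrable instead of almost every one. The [Rintegral] of a section is then a genuine integral
    at each point, and iterated integrals can be rewritten pointwise. *)
Lemma dom_prod_integrable : (m1 \x m2)%E.-integrable setT (fun z => (f z)%:E).
Proof.
have mE : measurable_fun setT (fun z => (f z)%:E) by exact/measurable_EFinP.
apply/(integrable12ltyP _ _ mE).
have -> : (\int[m1]_x \int[m2]_y `|(f (x, y))%:E| =
    \int[m1]_x \int[m2]_y (`|f (x, y)|)%:E)%E by [].
apply: (@le_lt_trans _ _ (\int[m1]_x (`|a x|%:E * \int[m2]_y `|b y|%:E))%E).
  apply: ge0_le_integral => //.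
  - by move=> x _; apply: integral_ge0.
  - apply: (measurable_fun_fubini_tonelli_F (fun z => (`|f z|)%:E)) => //.
    by apply/measurable_EFinP; exact: measurableT_comp.
  - apply: emeasurable_funM => //.
    case/integrableP: ia => /measurable_EFinP ma _.
    by apply/measurable_EFinP; exact: measurableT_comp.
  - move=> x _; rewrite -ge0_integralZl//.
    + apply: ge0_le_integral => //.
      * apply/measurable_EFinP; apply: measurableT_comp => //.
        exact: (measurableT_comp mf (pair1_measurable x)).
      * apply: emeasurable_funM => //.
        case/integrableP: ib => /measurable_EFinP mb _.
        by apply/measurable_EFinP; exact: measurableT_comp.
      * by move=> y _; rewrite -EFinM lee_fin.
    + case/integrableP: ib => /measurable_EFinP mb _.
      by apply/measurable_EFinP; exact: measurableT_comp.
case/integrableP: ia => /measurable_EFinP ma ia'.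
case/integrableP: ib => /measurable_EFinP mb ib'.
have fb : (\int[m2]_y `|b y|%:E)%E \is a fin_num.
  by rewrite ge0_fin_numE ?integral_ge0.
rewrite -(fineK fb) ge0_integralZr//.
- by rewrite lte_mul_pinfty ?ltry ?integral_ge0// ge0_fin_numE ?integral_ge0.
- by apply/measurable_EFinP; exact: measurableT_comp.
- by rewrite lee_fin fine_ge0// integral_ge0.
Qed.

Lemma dom_section1 x : m2.-integrable setT (fun y => (f (x, y))%:E).
Proof.
apply: (le_integrable measurableT _ _ (rintgZ (`|a x|) (integrable_abse ib))) => //.
- apply/measurable_EFinP.
  exact: (measurableT_comp mf (pair1_measurable x)).
- by move=> y _; rewrite /= lee_fin (ger0_norm (mulr_ge0 _ _)).
Qed.

Lemma dom_section2 y : m1.-integrable setT (fun x => (f (x, y))%:E).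
Proof.
apply: (le_integrable measurableT _ _ (rintgZ (`|b y|) (integrable_abse ia))) => //.
- apply/measurable_EFinP.
  exact: (measurableT_comp mf (pair2_measurable y)).
- by move=> x _; rewrite /= lee_fin (ger0_norm (mulr_ge0 _ _))// mulrC.
Qed.

Let F x := Rintegral m2 setT (fun y => f (x, y)).
Let G y := Rintegral m1 setT (fun x => f (x, y)).

Let FE x : (F x)%:E = fubini_F m2 (fun z => (f z)%:E) x.
Proof. by rewrite fineK// integrable_fin_num//; exact: dom_section1. Qed.

Let GE y : (G y)%:E = fubini_G m1 (fun z => (f z)%:E) y.
Proof. by rewrite fineK// integrable_fin_num//; exact: dom_section2. Qed.

Lemma dom_integrable1 : m1.-integrable setT (fun x => (F x)%:E).
Proof.
by under eq_fun do rewrite FE; exact: integrable_fubini_F dom_prod_integrable.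
Qed.

Lemma dom_integrable2 : m2.-integrable setT (fun y => (G y)%:E).
Proof.
apply: (le_integrable measurableT _ _
  (rintgZ (Rintegral m1 setT (fun x => `|a x|)) (integrable_abse ib))).
  by under eq_fun do rewrite GE; exact: measurable_fubini_G dom_prod_integrable.
move=> y _; rewrite lee_fin.
apply: le_trans (le_normr_Rintegral _ _) _ => //; first exact: dom_section2.
apply: le_trans (ler_norm _); rewrite -RintegralZr//; last exact: (integrable_abse ia).
apply: le_Rintegral => //; first exact: integrable_abse (dom_section2 y).
under eq_fun do rewrite /= mulrC.
by apply: rintgZ; exact: (integrable_abse ia).
Qed.

Lemma dom_prodE : Rintegral (m1 \x m2)%E setT f = Rintegral m1 setT F.
Proof.
congr fine; rewrite -integral12_prod_meas1; last exact: dom_prod_integrable.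
by apply: eq_integral => x _; rewrite FE.
Qed.

Lemma dom_fubini : Rintegral m1 setT F = Rintegral m2 setT G.
Proof.
congr fine; transitivity (\int[m1]_x \int[m2]_y (f (x, y))%:E)%E.
  by apply: eq_integral => x _; rewrite FE.
rewrite (@Fubini _ _ _ _ _ m1 m2 (EFin \o f) dom_prod_integrable).
by apply: eq_integral => y _; rewrite GE.
Qed.

End real.

Section complex.
Variable f : T1 * T2 -> R[i].
Hypothesis mf : cmeas f.
Hypothesis fab : forall x y, nc (f (x, y)) <= a x * b y.

Let mRe : measurable_fun setT (fun z => complex.Re (f z)). Proof. by case: mf. Qed.
Let mIm : measurable_fun setT (fun z => complex.Im (f z)). Proof. by case: mf. Qed.

Let Re_ab x y : `|complex.Re (f (x, y))| <= a x * b y.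
Proof. exact: le_trans (Re_le_nc _) (fab x y). Qed.

Let Im_ab x y : `|complex.Im (f (x, y))| <= a x * b y.
Proof. exact: le_trans (Im_le_nc _) (fab x y). Qed.

Lemma cdom_prod_cintg : cintg (m1 \x m2)%E f.
Proof. by split; exact: dom_prod_integrable. Qed.

Lemma cdom_section2 y : cintg m1 (fun x => f (x, y)).
Proof.
split; [apply: (dom_section2 (f := fun z => complex.Re (f z)))
       |apply: (dom_section2 (f := fun z => complex.Im (f z)))] => //.
Qed.

Lemma cdom_cintg1 : cintg m1 (fun x => Cint m2 (fun y => f (x, y))).
Proof.
split; [apply: (dom_integrable1 (f := fun z => complex.Re (f z)))
       |apply: (dom_integrable1 (f := fun z => complex.Im (f z)))] => //.
Qed.

Lemma cdom_cintg2 : cintg m2 (fun y => Cint m1 (fun x => f (x, y))).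
Proof.
split; [apply: (dom_integrable2 (f := fun z => complex.Re (f z)))
       |apply: (dom_integrable2 (f := fun z => complex.Im (f z)))] => //.
Qed.

Lemma cdom_prodE : Cint (m1 \x m2)%E f = Cint m1 (fun x => Cint m2 (fun y => f (x, y))).
Proof.
by apply: ReIm_inj => /=;
  [apply: (dom_prodE mRe Re_ab)|apply: (dom_prodE mIm Im_ab)].
Qed.

Lemma cdom_fubini : Cint m1 (fun x => Cint m2 (fun y => f (x, y))) =
  Cint m2 (fun y => Cint m1 (fun x => f (x, y))).
Proof.
by apply: ReIm_inj => /=;
  [apply: (dom_fubini mRe Re_ab)|apply: (dom_fubini mIm Im_ab)].
Qed.

End complex.

End dominated_fubini.

Section product_integral.
Local Open Scope complex_scope.
Local Open Scope ring_scope.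
Context d1 d2 (T1 : measurableType d1) (T2 : measurableType d2) (R : realType).
Variables (m1 : {sigma_finite_measure set T1 -> \bar R})
          (m2 : {sigma_finite_measure set T2 -> \bar R}).

Lemma cmeas_comp d3 (T3 : measurableType d3) (h : T1 -> T3) (f : T3 -> R[i]) :
  measurable_fun setT h -> cmeas f -> cmeas (fun x => f (h x)).
Proof.
by move=> mh [f1 f2]; split; [exact: (measurableT_comp f1 mh)|exact: (measurableT_comp f2 mh)].
Qed.

Variables (F : T1 -> R[i]) (G : T2 -> R[i]).
Hypothesis (cF : cintg m1 F) (cG : cintg m2 G).

Lemma cmeas_prod : cmeas (fun z : T1 * T2 => F z.1 * G z.2).
Proof.
apply: cmeasM.
- have [F1 F2] := cintg_meas cF; split.
    exact: (measurableT_comp F1 measurable_fst).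
  exact: (measurableT_comp F2 measurable_fst).
- have [G1 G2] := cintg_meas cG; split.
    exact: (measurableT_comp G1 measurable_snd).
  exact: (measurableT_comp G2 measurable_snd).
Qed.

End product_integral.

Local Notation mu := lebesgue_measure.

(** * Square-integrable functions *)

Section L2_norm.
Local Open Scope complex_scope.
Local Open Scope ring_scope.
Variable R : realType.
Implicit Types (f g : R -> R[i]).
Local Notation mu := (@lebesgue_measure R).

(** The squared norm as a real number. It takes the default value 0 when the integral is infinite,
    so it is meaningful only together with [inL2]. *)
Definition nrm2 f : R := Rintegral mu setT (fun x => nc (f x) ^+ 2).

Lemma nrm2_ge0 f : 0 <= nrm2 f.
Proof. by apply: Rintegral_ge0 => x _; exact: sqr_ge0. Qed.

Lemma L2normE f : L2norm f = ((\int[mu]_x (nc (f x) ^+ 2)%:E) `^ 2^-1)%E.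
Proof.
rewrite /L2norm unlock; congr (_ `^ _)%E; apply: eq_integral => x _ /=.
by rewrite powR_mulrn// real_normK// num_real.
Qed.

Lemma sqr_L2norm f : (L2norm f * L2norm f = \int[mu]_x (nc (f x) ^+ 2)%:E)%E.
Proof.
have i0 : (0 <= \int[mu]_x (nc (f x) ^+ 2)%:E)%E.
  by apply: integral_ge0 => x _; rewrite lee_fin sqr_ge0.
rewrite L2normE poweR12_sqrt//.
case: (\int[mu]_x _)%E i0 => [r| |]//=.
by rewrite lee_fin => r0; rewrite -EFinM -expr2 sqr_sqrtr.
Qed.

Lemma inL2P f : inL2 f <->
  cmeas f /\ mu.-integrable setT (fun x => (nc (f x) ^+ 2)%:E).
Proof.
have absE : (\int[mu]_x `|(nc (f x) ^+ 2)%:E| = \int[mu]_x (nc (f x) ^+ 2)%:E)%E.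
  by apply: eq_integral => x _; rewrite /= ger0_norm// sqr_ge0.
split=> [[mf]|[mf /integrableP[_]]]; rewrite ?absE => fL.
- split=> //; apply/integrableP; split.
    by apply/measurable_EFinP; exact: measurable_nc2.
  rewrite absE; apply: (@lty_poweRy _ _ 2^-1); first by rewrite invr_neq0.
  by rewrite -L2normE.
- by split=> //; rewrite L2normE poweR_lty.
Qed.

Lemma inL2_meas f : inL2 f -> cmeas f. Proof. by case/inL2P. Qed.

Lemma nrm2E f : inL2 f -> (\int[mu]_x (nc (f x) ^+ 2)%:E = (nrm2 f)%:E)%E.
Proof. by case/inL2P => _ i; rewrite fineK// integrable_fin_num. Qed.

Lemma L2norm_nrm2 f : inL2 f -> L2norm f = (Num.sqrt (nrm2 f))%:E.
Proof.
by move=> f2; rewrite L2normE nrm2E// poweR12_sqrt ?lee_fin ?nrm2_ge0.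
Qed.

Lemma le_inL2 f g : cmeas f -> inL2 g -> (forall x, nc (f x) <= nc (g x)) ->
  inL2 f.
Proof.
move=> mf /inL2P[_ ig] fg; apply/inL2P; split => //.
apply: le_integrable ig => //.
  by apply/measurable_EFinP; exact: measurable_nc2.
move=> x _; rewrite lee_fin !ger0_norm ?sqr_ge0//.
by rewrite ler_pXn2r ?nnegrE ?nc_ge0.
Qed.

Lemma le_nrm2 f g : inL2 f -> inL2 g -> (forall x, nc (f x) <= nc (g x)) ->
  nrm2 f <= nrm2 g.
Proof.
move=> /inL2P[_ fi] /inL2P[_ gi] fg; apply: le_Rintegral => // x _.
by rewrite ler_pXn2r ?nnegrE ?nc_ge0.
Qed.

Lemma inL2J f : inL2 f -> inL2 (fun x => (f x)^*).
Proof.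
move=> f2; apply: (@le_inL2 _ f) => //; last by move=> x; rewrite ncJ.
by apply: cmeasJ; exact: inL2_meas.
Qed.

Lemma inL2Z (c : R[i]) f : inL2 f -> inL2 (fun x => c * f x).
Proof.
move=> /inL2P[mf fi]; apply/inL2P; split; first by apply: cmeasM mf; exact: cmeas_cst.
under eq_fun do rewrite Normc.normcM exprMn.
exact: rintgZ.
Qed.

Lemma inL2N f : inL2 f -> inL2 (fun x => - f x).
Proof. by move=> /(inL2Z (-1)); under eq_fun do rewrite mulN1r. Qed.

Lemma inL2D f g : inL2 f -> inL2 g -> inL2 (fun x => f x + g x).
Proof.
move=> /inL2P[mf fi] /inL2P[mg gi]; apply/inL2P; split; first exact: cmeasD.
apply: (le_integrable measurableT _ _
  (rintgD (rintgZ 2 fi) (rintgZ 2 gi))).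
  by apply/measurable_EFinP; apply: measurable_nc2; exact: cmeasD.
move=> x _; rewrite lee_fin ger0_norm ?sqr_ge0//.
apply: le_trans (ler_norm _).
have := ncD (f x) (g x); rewrite -(@ler_pXn2r _ 2)// ?nnegrE ?addr_ge0 ?nc_ge0//.
by move=> /le_trans; apply; have := sqr_ge0 (nc (f x) - nc (g x)); nra.
Qed.

Lemma inL2B f g : inL2 f -> inL2 g -> inL2 (fun x => f x - g x).
Proof. by move=> f2 g2; exact: inL2D (inL2N g2). Qed.

Lemma cintg_L2M f g : inL2 f -> inL2 g -> cintg mu (fun x => f x * g x).
Proof.
move=> /inL2P[mf fi] /inL2P[mg gi].
apply: (@le_cintg _ (measurableTypeR R) _ _ _ (fun x => nc (f x) ^+ 2 + nc (g x) ^+ 2)).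
- exact: cmeasM.
- move=> x; rewrite Normc.normcM.
  have := sqr_ge0 (nc (f x) - nc (g x)).
  have := sqr_ge0 (nc (f x)); have := sqr_ge0 (nc (g x)); nra.
- exact: rintgD.
Qed.

Lemma cintg_L2MJ f g : inL2 f -> inL2 g -> cintg mu (fun x => f x * (g x)^*).
Proof. by move=> f2 g2; apply: cintg_L2M => //; exact: inL2J. Qed.

Lemma nrm2Z (c : R[i]) f : inL2 f -> nrm2 (fun x => c * f x) = nc c ^+ 2 * nrm2 f.
Proof.
move=> /inL2P[_ fi]; rewrite -RintegralZl//.
by apply: eq_Rintegral => x _; rewrite Normc.normcM exprMn.
Qed.

Lemma nrm2N f : nrm2 (fun x => - f x) = nrm2 f.
Proof. by apply: eq_Rintegral => x _; rewrite ncN. Qed.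

Lemma nrm2J f : nrm2 (fun x => (f x)^*) = nrm2 f.
Proof. by apply: eq_Rintegral => x _; rewrite ncJ. Qed.

Lemma nrm2B f g : inL2 f -> inL2 g ->
  nrm2 (fun x => f x - g x) = nrm2 f + nrm2 g - 2 * complex.Re (inner f g).
Proof.
move=> f2 g2; have := cintg_L2MJ f2 g2.
case: (inL2P f).1 => // mf fi; case: (inL2P g).1 => // mg gi [ri _].
rewrite /inner /= -RintegralZl// -RintegralD// -RintegralB//.
- by apply: eq_Rintegral => x _; rewrite !sqr_nc !ReImE; ring.
- exact: rintgD.
- exact: rintgZ.
Qed.

Lemma l2D f g : inL2 f -> inL2 g ->
  Num.sqrt (nrm2 (fun x => f x + g x)) <= Num.sqrt (nrm2 f) + Num.sqrt (nrm2 g).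
Proof.
move=> f2 g2; rewrite -lee_fin EFinD -!L2norm_nrm2//; last exact: inL2D.
have mf := measurable_nc (inL2_meas f2); have mg := measurable_nc (inL2_meas g2).
apply: le_trans (minkowski_EFin mu mf mg _); last by rewrite ler1n.
rewrite L2normE unlock /=; apply: gt0_ler_poweR; rewrite ?invr_ge0//.
- by rewrite in_itv /= leey andbT; apply: integral_ge0 => x _; rewrite lee_fin sqr_ge0.
- rewrite in_itv /= leey andbT; apply: integral_ge0 => x _.
  by rewrite lee_fin powR_ge0.
- have ncfg x : 0 <= nc (f x) + nc (g x) by rewrite addr_ge0 ?nc_ge0.
  have E x : `|nc (f x) + nc (g x)| `^ 2 = (nc (f x) + nc (g x)) ^+ 2.
    by rewrite powR_mulrn// real_normK// num_real.
  apply: ge0_le_integral => //.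
  + by move=> x _; rewrite lee_fin sqr_ge0.
  + by apply/measurable_EFinP; apply: measurable_nc2; apply: inL2_meas; exact: inL2D.
  + apply/measurable_EFinP; under eq_fun do rewrite E.
    by apply: measurable_funX; exact: measurable_funD.
  + move=> x _; rewrite lee_fin E ler_pXn2r ?nnegrE ?nc_ge0//.
    exact: ncD.
Qed.

Lemma l2B f g h : inL2 f -> inL2 g -> inL2 h ->
  Num.sqrt (nrm2 (fun x => f x - h x)) <=
  Num.sqrt (nrm2 (fun x => f x - g x)) + Num.sqrt (nrm2 (fun x => g x - h x)).
Proof.
move=> f2 g2 h2; have := l2D (inL2B f2 g2) (inL2B g2 h2).
by under eq_fun do rewrite addrA subrK.
Qed.

Lemma L2_cauchy_schwarz f g : inL2 f -> inL2 g ->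
  nc (Cint mu (fun x => f x * g x)) ^+ 2 <= nrm2 f * nrm2 g.
Proof.
move=> f2 g2.
rewrite -[leRHS]sqr_sqrtr ?mulr_ge0 ?nrm2_ge0//.
rewrite ler_pXn2r ?nnegrE ?nc_ge0 ?sqrtr_ge0//.
apply: le_trans (le_nc_Cint (cintg_L2M f2 g2)) _.
rewrite sqrtrM ?nrm2_ge0// -lee_fin EFinM -!L2norm_nrm2//.
have mf := measurable_nc (inL2_meas f2); have mg := measurable_nc (inL2_meas g2).
have half2 : 2^-1 + 2^-1 = 1 :> R by lra.
apply: le_trans (hoelder mu mf mg (ltr0Sn _ 1) (ltr0Sn _ 1) half2).
rewrite Lnorm1 fineK; last first.
  by apply: integrable_fin_num => //; apply: cintg_nc; exact: cintg_L2M.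
rewrite le_eqVlt; apply/orP; left; apply/eqP; apply: eq_integral => x _ /=.
by rewrite Normc.normcM ger0_norm// mulr_ge0 ?nc_ge0.
Qed.

End L2_norm.

(** * Invariance of Lebesgue measure under reflections *)

Section reflection.
Local Open Scope complex_scope.
Local Open Scope ring_scope.
Variable R : realType.
Implicit Types (f g : R -> R[i]).
Local Notation mu := (@lebesgue_measure R).

Lemma measurable_reflect (a : R) : measurable_fun setT (fun t : R => a - t).
Proof. exact: measurable_funB. Qed.

Lemma measurable_fun_reflect (a : R) (h : R -> R) :
  measurable_fun setT h -> measurable_fun setT (fun t : R => h (a - t)).
Proof. by move=> mh; exact: measurableT_comp mh (measurable_reflect a). Qed.

(** Uniqueness of Lebesgue measure reduces this to half-open intervals. The single family of maps t
    -> a - t is the substitution inside a convolution, gives parity arguments at [a = 0], and yields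
    the translations of [Cint_shift] by composing two of them. *)
Lemma lebesgue_measure_reflect (a : R) (A : set R) : measurable A ->
  mu ((fun t : R => a - t) @^-1` A) = mu A.
Proof.
move=> mA; symmetry.
apply: (@lebesgue_measure_unique R
  (pushforward mu (fun t : measurableTypeR R => a - t : measurableTypeR R)) _ A mA).
  exact: measurable_reflect.
move=> mr X [[b c] /= _ <-]; rewrite /pushforward.
have -> : (fun t : R => a - t) @^-1` `]b, c] = `[a - c, a - b[%classic.
  by apply/seteqP; split => t /=; rewrite !in_itv /= => /andP[? ?];
    apply/andP; split; lra.
rewrite !lebesgue_measure_itv /= !lte_fin ltrD2l ltrN2; case: ifP => // _.
by rewrite -!EFinD; congr EFin; ring.
Qed.

Lemma ge0_integral_reflect (a : R) (h : R -> \bar R) : measurable_fun setT h ->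
  (forall x, 0 <= h x)%E -> (\int[mu]_t h (a - t)%R = \int[mu]_t h t)%E.
Proof.
move=> mh h0.
have := @ge0_integral_pushforward _ _ (measurableTypeR R) (measurableTypeR R) R
  _ (measurable_reflect a) mu setT h measurableT mh (fun y _ => h0 y).
rewrite preimage_setT => <-.
apply: eq_measure_integral => [|mr A mA _]; first exact: measurable_reflect.
exact: lebesgue_measure_reflect.
Qed.

Lemma integral_reflect (a : R) (h : R -> \bar R) : measurable_fun setT h ->
  (\int[mu]_t h (a - t)%R = \int[mu]_t h t)%E.
Proof.
move=> mh; rewrite integralE [RHS]integralE; congr (_ - _)%E.
- rewrite -(ge0_integral_reflect a (measurable_funepos mh) (funepos_ge0 h)).
  by apply: eq_integral => x _; rewrite !funeposE.
- rewrite -(ge0_integral_reflect a (measurable_funeneg mh) (funeneg_ge0 h)).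
  by apply: eq_integral => x _; rewrite !funenegE.
Qed.

Lemma Rintegral_reflect (a : R) (h : R -> R) : measurable_fun setT h ->
  Rintegral mu setT (fun t : R => h (a - t)) = Rintegral mu setT h.
Proof.
move=> mh; congr fine.
by apply: (integral_reflect a (h := fun t => (h t)%:E)); exact/measurable_EFinP.
Qed.

Lemma integrable_reflect (a : R) (h : R -> R) :
  mu.-integrable setT (fun t => (h t)%:E) ->
  mu.-integrable setT (fun t : R => (h (a - t))%:E).
Proof.
move=> /integrableP[/measurable_EFinP mh ih]; apply/integrableP; split.
  by apply/measurable_EFinP; exact: measurable_fun_reflect.
rewrite (integral_reflect a (h := fun t => `|(h t)%:E|%E))//.
by apply/measurable_EFinP; exact: measurableT_comp.
Qed.

Lemma cmeas_reflect (a : R) f : cmeas f -> cmeas (fun t : R => f (a - t)).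
Proof.
move=> [f1 f2]; split.
  exact: (measurable_fun_reflect a f1).
exact: (measurable_fun_reflect a f2).
Qed.

Lemma Cint_reflect (a : R) f : cmeas f -> Cint mu (fun t : R => f (a - t)) = Cint mu f.
Proof.
move=> [f1 f2]; apply: ReIm_inj => /=.
  exact: (Rintegral_reflect a f1).
exact: (Rintegral_reflect a f2).
Qed.

Lemma inL2_reflect (a : R) f : inL2 f -> inL2 (fun t : R => f (a - t)).
Proof.
move=> /inL2P[mf fi]; apply/inL2P; split; first exact: cmeas_reflect.
exact: (integrable_reflect a fi).
Qed.

Lemma nrm2_reflect (a : R) f : cmeas f -> nrm2 (fun t : R => f (a - t)) = nrm2 f.
Proof. by move=> mf; apply: (Rintegral_reflect a); exact: measurable_nc2. Qed.

Lemma aeeq_reflect (a : R) f g : aeeq f g ->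
  aeeq (fun t : R => f (a - t)) (fun t : R => g (a - t)).
Proof.
move=> [A [mA A0 fgA]]; exists ((fun t : R => a - t) @^-1` A); split.
- by rewrite -[X in measurable X]setTI; apply: measurable_reflect.
- by rewrite lebesgue_measure_reflect.
- by move=> t /= ft; exact: fgA.
Qed.

Lemma Cint_shift (a : R) f : cmeas f -> Cint mu (fun t : R => f (t + a)) = Cint mu f.
Proof.
move=> mf; rewrite -(Cint_reflect a mf) -(Cint_reflect 0 (cmeas_reflect a mf)).
by apply: eq_Cint => t; congr f; ring.
Qed.

Lemma eq_Cint_ae f g : cmeas f -> cmeas g -> aeeq f g -> Cint mu f = Cint mu g.
Proof.
move=> [f1 f2] [g1 g2] fg; apply: ReIm_inj => /=; congr fine.
- apply: ae_eq_integral => //; try exact/measurable_EFinP.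
  case: fg => A [mA A0 fgA]; exists A; split=> // x /= fgx; apply: fgA => /= E.
  by apply: fgx => _; rewrite E.
- apply: ae_eq_integral => //; try exact/measurable_EFinP.
  case: fg => A [mA A0 fgA]; exists A; split=> // x /= fgx; apply: fgA => /= E.
  by apply: fgx => _; rewrite E.
Qed.

End reflection.

(** * Poisson kernel *)

Section poisson_kernel.
Variable R : realType.
Local Notation mu := (@lebesgue_measure R).
Implicit Types (e a x : R).

(** Two integrands appear because [decay] contains an absolute value: [g] drops it, so that [F] is
    an antiderivative on the whole line, and evenness of [f] reduces the integral to the half-line
    where the two agree. *)
Lemma even_integral_FTC (f g F : R -> R) (l : R) : (forall x, 0 <= f x) ->
  continuous f -> (forall x, f (- x) = f x) -> (forall x, 0 <= x -> f x = g x) ->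
  (forall x, is_derive x 1 F (g x)) -> F x @[x --> +oo] --> l ->
  (\int[mu]_x (f x)%:E = (2 * (l - F 0))%:E)%E.
Proof.
move=> f0 cf fE fg dF Fl; rewrite ge0_symfun_integralT//; last first.
  by move=> x /=; rewrite fE.
have cF : continuous F.
  move=> x; apply: differentiable_continuous; apply/derivable1_diffP.
  exact: ex_derive.
have -> : [set x : R | 0 <= x] = `[0, +oo[%classic.
  by apply/seteqP; split=> x /=; rewrite in_itv /= andbT.
rewrite (ge0_continuous_FTC2y _ _ Fl)//.
- exact: continuous_subspaceT.
- by apply: cvg_at_right_filter; exact: cF.
- move=> x; rewrite in_itv /= andbT => x0.
  by rewrite derive1E fg ?ltW//; exact: derive_val.
Qed.

Lemma is_derive_mull a x : is_derive x 1 (fun x => a * x) a.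
Proof.
by have := is_deriveZ a (@is_derive_id _ _ x (1 : R)); rewrite /GRing.scale/= mulr1.
Qed.

Lemma is_derive_expN e x : is_derive x 1 (fun x => expR (- (e * x))) (- e * expR (- (e * x))).
Proof.
have h : is_derive x 1 (fun x => - (e * x)) (- e) by exact/is_deriveN/is_derive_mull.
by rewrite mulrC; exact: is_derive1_comp (is_derive_expR _) h.
Qed.

Definition decay e x := expR (- (e * `|x|)).

Lemma decay_gt0 e x : 0 < decay e x.
Proof. exact: expR_gt0. Qed.

Lemma decay_le1 e x : 0 <= e -> decay e x <= 1.
Proof. by move=> e0; rewrite -expR0 ler_expR oppr_le0 mulr_ge0. Qed.

Lemma continuous_decay e : continuous (decay e).
Proof.
move=> x; apply: continuous_comp; last exact: continuous_expR.
by apply: cvgN; apply: cvgMl_tmp; exact: cvg_norm.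
Qed.

Lemma measurable_decay e : measurable_fun setT (decay e).
Proof. by apply: continuous_measurable_fun; exact: continuous_decay. Qed.

Let cosint e a x := expR (- (e * x)) * (a * sin (a * x) - e * cos (a * x)).

Let is_derive_cosint e a x :
  is_derive x 1 (cosint e a) ((e ^+ 2 + a ^+ 2) * (expR (- (e * x)) * cos (a * x))).
Proof.
have h4 := is_derive1_comp (is_derive_sin _) (is_derive_mull a x).
have h5 := is_derive1_comp (is_derive_cos _) (is_derive_mull a x).
have h := is_deriveM (is_derive_expN e x) (is_deriveB (is_deriveZ a h4) (is_deriveZ e h5)).
by apply: (is_derive_eq h); rewrite !fctE /= /GRing.scale /=; ring.
Qed.

Let cvg_expN e : 0 < e -> expR (- (e * x)) @[x --> +oo] --> (0 : R).
Proof.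
move=> e0; have h : e * x @[x --> +oo] --> +oo.
  by apply: gt0_cvgMry.
exact: (cvg_comp _ _ h (@cvgr_expR R)).
Qed.

Let cvg_cosint e a : 0 < e -> cosint e a x @[x --> +oo] --> (0 : R).
Proof.
move=> e0; apply/norm_cvg0P.
apply: (@squeeze_cvgr _ _ _ _ (cst 0) (fun x => expR (- (e * x)) * (`|a| + `|e|))).
- near=> x; rewrite normr_ge0 /= normrM (ger0_norm (expR_ge0 _)).
  apply: ler_wpM2l; first exact: expR_ge0.
  apply: le_trans (ler_normB _ _) _; rewrite !normrM.
  apply: lerD; rewrite -[leRHS]mulr1; apply: ler_wpM2l => //.
  + by rewrite ler_norml sin_geN1 sin_le1.
  + by rewrite ler_norml cos_geN1 cos_le1.
- exact: cvg_cst.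
- rewrite -(mul0r (`|a| + `|e|)); apply: cvgMr_tmp; exact: cvg_expN.
Unshelve. all: by end_near. Qed.

(** The Poisson kernel of the upper half-plane at height e / (2 pi), which with this normalisation
    of the Fourier transform is the transform of [decay e]. *)
Definition poisson e x := 2 * e / (e ^+ 2 + (2 * pi * x) ^+ 2).

(** Adding 1 to the cosine keeps the integrand nonnegative, as [even_integral_FTC] requires. The
    case [a = 0] then gives the integrability of [decay] and the term to subtract in
    [poisson_decay]. *)
Let decay_cos_integral e a : 0 < e ->
  (\int[mu]_x (decay e x * (1 + cos (a * x)))%:E =
   (2 * (e^-1 + e / (e ^+ 2 + a ^+ 2)))%:E)%E.
Proof.
move=> e0; have d0 : e ^+ 2 + a ^+ 2 != 0 by rewrite gt_eqF// ltr_pwDl ?sqr_ge0 ?exprn_gt0.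
have e_neq0 : e != 0 by rewrite gt_eqF.
pose F x := - e^-1 * expR (- (e * x)) + (e ^+ 2 + a ^+ 2)^-1 * cosint e a x.
have -> : e^-1 + e / (e ^+ 2 + a ^+ 2) = 0 - F 0.
  by rewrite /F /cosint !mulr0 oppr0 expR0 sin0 cos0; field; rewrite d0 e_neq0.
apply: (@even_integral_FTC _ (fun x => expR (- (e * x)) * (1 + cos (a * x)))).
- by move=> x; rewrite mulr_ge0 ?expR_ge0// -lerBlDl sub0r cos_geN1.
- move=> x; apply: cvgM; first exact: continuous_decay.
  apply: cvgD; first exact: cvg_cst.
  apply: continuous_comp; last exact: continuous_cos.
  by apply: cvgMl_tmp; exact: cvg_id.
- by move=> x; rewrite /decay normrN mulrN cosN.
- by move=> x x0; rewrite /decay ger0_norm.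
- move=> x.
  have h := is_deriveD (is_deriveZ (- e^-1) (is_derive_expN e x))
    (is_deriveZ (e ^+ 2 + a ^+ 2)^-1 (is_derive_cosint e a x)).
  by apply: (is_derive_eq h); rewrite /GRing.scale /=; field; rewrite e_neq0 d0.
- rewrite -[0](_ : - e^-1 * 0 + (e ^+ 2 + a ^+ 2)^-1 * 0 = _); last by rewrite !mulr0 addr0.
  by apply: cvgD; apply: cvgMl_tmp; [exact: cvg_expN|exact: cvg_cosint].
Qed.

Lemma integrable_decay e : 0 < e -> mu.-integrable setT (fun x => (decay e x)%:E).
Proof.
move=> e0; apply/integrableP; split; first by apply/measurable_EFinP; exact: measurable_decay.
have := decay_cos_integral 0 e0.
under eq_integral do rewrite mul0r cos0.
move=> h; apply: (@le_lt_trans _ _ (\int[mu]_x (decay e x * (1 + 1))%:E)%E); last first.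
  by rewrite h ltry.
apply: ge0_le_integral => //.
- by apply/measurable_EFinP; apply: measurableT_comp => //; exact: measurable_decay.
- by apply/measurable_EFinP; apply: measurable_funM => //; exact: measurable_decay.
- move=> x _; have := decay_gt0 e x; rewrite lee_fin => d0.
  by rewrite ger0_norm ?ltW//; lra.
Qed.

Lemma poisson_decay e x : 0 < e ->
  Rintegral mu setT (fun xi => decay e xi * cos (2 * pi * x * xi)) = poisson e x.
Proof.
move=> e0; have d0 (a : R) : e ^+ 2 + a ^+ 2 != 0.
  by rewrite gt_eqF// ltr_pwDl ?sqr_ge0 ?exprn_gt0.
have e_neq0 : e != 0 by rewrite gt_eqF.
have h (a : R) : Rintegral mu setT (fun xi => decay e xi * (1 + cos (a * xi))) =
    2 * (e^-1 + e / (e ^+ 2 + a ^+ 2)).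
  by rewrite /Rintegral decay_cos_integral.
have i1 := integrable_decay e0.
have i2 : mu.-integrable setT (fun xi => (decay e xi * cos (2 * pi * x * xi))%:E).
  apply: le_integrable i1 => //.
    apply/measurable_EFinP; apply: measurable_funM; first exact: measurable_decay.
    apply: continuous_measurable_fun => y; apply: continuous_comp; last exact: continuous_cos.
    by apply: cvgMl_tmp; exact: cvg_id.
  move=> y _; rewrite lee_fin normrM -[leRHS]mulr1; apply: ler_wpM2l => //.
  by rewrite ler_norml cos_geN1 cos_le1.
have := h (2 * pi * x); under eq_Rintegral do rewrite mulrDr mulr1.
rewrite RintegralD//; have := h 0.
under eq_Rintegral do rewrite mul0r cos0.
rewrite RintegralZr//.
have -> : 2 * (e^-1 + e / (e ^+ 2 + 0 ^+ 2)) = (2 / e) * (1 + 1) :> R.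
  by field; rewrite ?e_neq0 ?mulf_neq0.
move=> /(mulIf _) ->; last by rewrite gt_eqF// addr_gt0.
move=> /(canRL (addKr _)) ->; rewrite /poisson.
by field; rewrite e_neq0 d0.
Qed.

Lemma poisson_gt0 e x : 0 < e -> 0 < poisson e x.
Proof.
by move=> e0; rewrite divr_gt0 ?mulr_gt0// ltr_pwDl ?sqr_ge0 ?exprn_gt0.
Qed.

Lemma poisson_le e x : 0 < e -> poisson e x <= 2 / e.
Proof.
move=> e0; rewrite /poisson ler_pdivrMr ?ltr_pwDl ?sqr_ge0 ?exprn_gt0//.
rewrite mulrDr; have -> : 2 / e * e ^+ 2 = 2 * e by field; rewrite gt_eqF.
by rewrite lerDl mulr_ge0 ?sqr_ge0 ?divr_ge0// ltW.
Qed.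

(** The kernel decays like e / x^2, so the square of a Lipschitz increment times the kernel is O(e).
    This makes the error in the Plancherel lower bound vanish. *)
Lemma sqr_poisson_le e x : 0 < e -> x ^+ 2 * poisson e x <= e.
Proof.
move=> e0; rewrite /poisson mulrA ler_pdivrMr ?ltr_pwDl ?sqr_ge0 ?exprn_gt0//.
have pi1 : 1 <= (pi : R) ^+ 2.
  by rewrite exprn_ege1// (le_trans _ (pi_ge2 R))// ler1n.
rewrite -subr_ge0.
have -> : e * (e ^+ 2 + (2 * pi * x) ^+ 2) - x ^+ 2 * (2 * e) =
  e * (e ^+ 2 + x ^+ 2 * (4 * pi ^+ 2 - 2)) by ring.
apply: mulr_ge0; first exact: ltW.
apply: addr_ge0; first exact: sqr_ge0.
by apply: mulr_ge0; [exact: sqr_ge0|lra].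
Qed.

Lemma continuous_poisson e : 0 < e -> continuous (poisson e).
Proof.
move=> e0 x; apply: cvgMl_tmp; apply: cvgV.
  by rewrite gt_eqF// ltr_pwDl ?sqr_ge0 ?exprn_gt0.
apply: cvgD; first exact: cvg_cst.
by rewrite expr2; apply: cvgM; apply: cvgMl_tmp; exact: cvg_id.
Qed.

Let is_derive_atanM e x : 0 < e ->
  is_derive x 1 (fun x => pi^-1 * atan (2 * pi / e * x)) (poisson e x).
Proof.
move=> e0; have p0 : (pi : R) != 0 by rewrite gt_eqF// pi_gt0.
have h := is_deriveZ (pi^-1 : R)
  (is_derive1_comp (is_derive1_atan (2 * pi / e * x)) (is_derive_mull (2 * pi / e) x)).
apply: (is_derive_eq h); rewrite /poisson.
move: (pi : R) p0 => p p0; rewrite /GRing.scale /=; field.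
rewrite p0 (gt_eqF e0) /= !gt_eqF//.
by rewrite ltr_pwDl ?exprn_gt0// sqr_ge0.
Qed.

Lemma poissonN e x : poisson e (- x) = poisson e x.
Proof. by rewrite /poisson mulrN sqrrN. Qed.

Lemma integral_poisson e : 0 < e -> (\int[mu]_x (poisson e x)%:E = 1)%E.
Proof.
move=> e0.
pose F x : R := pi^-1 * atan (2 * pi / e * x).
have -> : 1%E = (2 * (pi^-1 * (pi / 2) - F 0))%:E :> \bar R.
  rewrite /F mulr0 atan0 mulr0 subr0; congr EFin.
  by rewrite (mulrA pi^-1) mulVf ?mul1r ?divff// gt_eqF// pi_gt0.
apply: (@even_integral_FTC _ (poisson e)).
- by move=> x; apply: ltW; exact: poisson_gt0.
- exact: continuous_poisson.
- exact: poissonN.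
- by [].
- by move=> x; exact: is_derive_atanM.
- apply: cvgMl_tmp.
  have h : 2 * pi / e * x @[x --> +oo] --> +oo.
    by apply: gt0_cvgMry => //; rewrite divr_gt0 ?mulr_gt0 ?pi_gt0.
  exact: (cvg_comp _ _ h (@cvgy_atan R)).
Qed.

Lemma integral_poisson_itv e (n s : R) : 0 < e -> 0 < n ->
  Rintegral mu `[- n, n]%classic (fun t => poisson e (s - t)) =
  pi^-1 * (atan (2 * pi / e * (n - s)) + atan (2 * pi / e * (n + s))).
Proof.
move=> e0 n0.
have dF x : is_derive x 1 (fun t => - (pi^-1 * atan (2 * pi / e * (s - t)))) (poisson e (s - x)).
  have h1 : is_derive x 1 (fun t : R => s - t) (- 1).
    have h := is_deriveB (is_derive_cst s x 1) (@is_derive_id _ _ x (1 : R)).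
    by apply: (is_derive_eq h); rewrite sub0r.
  have h := is_deriveN (@is_derive1_comp _ _ (fun t : R => s - t) x _ _ (is_derive_atanM (s - x) e0) h1).
  by apply: (is_derive_eq h); rewrite mulrN1 opprK.
rewrite /Rintegral; pose F t := - (pi^-1 * atan (2 * pi / e * (s - t))).
rewrite (@continuous_FTC2 _ _ F).
- change (F n - F (- n) =
    pi^-1 * (atan (2 * pi / e * (n - s)) + atan (2 * pi / e * (n + s)))).
  have -> : 2 * pi / e * (n - s) = - (2 * pi / e * (s - n)) by rewrite -mulrN opprB.
  by rewrite /F atanN !opprK (addrC n s) (mulrDr pi^-1) mulrN.
- by lra.
- apply: continuous_subspaceT => x.
  apply: (@continuous_comp _ _ _ (fun t : R => s - t) (poisson e)).
    by apply: cvgB; [exact: cvg_cst|exact: cvg_id].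
  exact: continuous_poisson.
- have cF : continuous F.
    by move=> x; apply: differentiable_continuous; apply/derivable1_diffP; exact: ex_derive.
  split.
  + by move=> x _; exact: ex_derive.
  + by apply: cvg_at_right_filter; exact: cF.
  + by apply: cvg_at_left_filter; exact: cF.
- by move=> x _; rewrite derive1E; exact: derive_val.
Qed.

End poisson_kernel.

(** * Plancherel *)

Section plancherel.
Local Open Scope complex_scope.
Local Open Scope ring_scope.
Variable R : realType.
Local Notation mu := (@lebesgue_measure R).
Implicit Types (f g h : R -> R[i]).

Definition FT f (xi : R) : R[i] :=
  Cint mu (fun x => f x * cis (- (2 * pi * x * xi))).

Lemma measurable_phase (xi : R) : measurable_fun setT (fun x : R => - (2 * pi * x * xi)).
Proof.
by apply: measurable_funN; apply: measurable_funM => //; exact: measurable_funM.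
Qed.

Lemma cintg_phase f (h : R -> R) : measurable_fun setT h -> cintg mu f ->
  cintg mu (fun x : R => f x * cis (h x)).
Proof.
move=> mh cf; apply: (@le_cintg _ (measurableTypeR R) _ _ _ (fun x => nc (f x))).
- by apply: cmeasM; [exact: cintg_meas cf|exact: cmeas_cis].
- by move=> x; rewrite Normc.normcM nc_cis mulr1.
- exact: cintg_nc.
Qed.

Lemma cintg_FT f xi : cintg mu f ->
  cintg mu (fun x : R => f x * cis (- (2 * pi * x * xi))).
Proof. by apply: cintg_phase; exact: measurable_phase. Qed.

Lemma le_nc_FT f xi : cintg mu f ->
  nc (FT f xi) <= Rintegral mu setT (fun x => nc (f x)).
Proof.
move=> cf; apply: le_trans (le_nc_Cint (cintg_FT xi cf)) _.
rewrite le_eqVlt; apply/orP; left; apply/eqP.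
by apply: eq_Rintegral => x _; rewrite Normc.normcM nc_cis mulr1.
Qed.

(** Fubini makes a parametric integral measurable, but asks for integrability in the parameter as
    well. The factor [decay 1] supplies it and is divided out afterwards, being continuous and
    positive. *)
Lemma cmeas_FT f : cintg mu f -> cmeas (FT f).
Proof.
move=> cf; have e0 : (0 : R) < 1 by [].
pose K (z : R * R) : R[i] := (decay 1 z.1)%:C * (f z.2 * cis (- (2 * pi * z.2 * z.1))).
have mK : cmeas K.
  apply: cmeasM.
    by apply: cmeas_real; exact: (measurableT_comp (measurable_decay 1) measurable_fst).
  apply: cmeasM; first exact: (cmeas_comp measurable_snd (cintg_meas cf)).
  apply: cmeas_cis; apply: measurable_funN; apply: measurable_funM => //.
  exact: measurable_funM.
have Kab (x y : R) : nc (K (x, y)) <= decay 1 x * nc (f y).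
  by rewrite !Normc.normcM ncR nc_cis mulr1 ger0_norm// ltW// decay_gt0.
have := cintg_meas (cdom_cintg1 (integrable_decay e0) (cintg_nc cf) mK Kab).
have -> : FT f = fun xi => ((decay 1 xi)^-1)%:C *
    Cint mu (fun y => K (xi, y)).
  apply/funext => xi.
  have -> : Cint mu (fun y => K (xi, y)) = (decay 1 xi)%:C * FT f xi.
    by rewrite -CintZ//; exact: cintg_FT.
  rewrite mulrA -rmorphM mulVf ?mul1r//.
  by rewrite gt_eqF// decay_gt0.
apply: cmeasM; apply: cmeas_real; apply: continuous_measurable_fun => x.
by apply: cvgV; [rewrite gt_eqF// decay_gt0|exact: continuous_decay].
Qed.

Let decay_sin_integral e u : 0 < e ->
  Rintegral mu setT (fun xi => decay e xi * sin (u * xi)) = 0.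
Proof.
move=> e0; have m : measurable_fun setT (fun xi => decay e xi * sin (u * xi)).
  apply: measurable_funM; first exact: measurable_decay.
  apply: measurableT_comp; last exact: measurable_funM.
  by apply: continuous_measurable_fun; exact: continuous_sin.
set I := LHS; suff : I = - I by move=> II; lra.
rewrite {1}/I -(Rintegral_reflect 0 m) -mulN1r -RintegralZl//.
  by apply: eq_Rintegral => x _; rewrite sub0r /decay normrN mulrN sinN mulrN mulN1r.
apply: le_integrable (integrable_decay e0) => //; first exact/measurable_EFinP.
move=> y _; rewrite lee_fin normrM -[leRHS]mulr1; apply: ler_wpM2l => //.
by rewrite ler_norml sin_geN1 sin_le1.
Qed.

Let decay_cis_integral e u : 0 < e ->
  Cint mu (fun xi => (decay e xi)%:C * cis (- (2 * pi * u * xi))) = (poisson e u)%:C.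
Proof.
move=> e0; apply: ReIm_inj.
- transitivity (poisson e u) => //.
  rewrite -poisson_decay//; apply: eq_Rintegral => xi _.
  by rewrite ReZ Re_cis cosN.
- transitivity (0 : R) => //.
  rewrite -oppr0 -(decay_sin_integral (2 * pi * u) e0) -mulN1r -RintegralZl//.
    by apply: eq_Rintegral => xi _; rewrite ImZ Im_cis sinN mulN1r mulrN.
  apply: le_integrable (integrable_decay e0) => //.
    apply/measurable_EFinP; apply: measurable_funM; first exact: measurable_decay.
    apply: measurableT_comp; last exact: measurable_funM.
    by apply: continuous_measurable_fun; exact: continuous_sin.
  move=> y _; rewrite lee_fin normrM -[leRHS]mulr1; apply: ler_wpM2l => //.
  by rewrite ler_norml sin_geN1 sin_le1.
Qed.

Let cintg_decay_phase e (u : R) : 0 < e ->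
  cintg mu (fun xi => (decay e xi)%:C * cis (- (2 * pi * u * xi))).
Proof.
move=> e0; apply: (@le_cintg _ (measurableTypeR R) _ _ _ (decay e)).
- apply: cmeasM; first by apply: cmeas_real; exact: measurable_decay.
  by apply: cmeas_cis; apply: measurable_funN; exact: measurable_funM.
- by move=> xi; rewrite Normc.normcM nc_cis mulr1 ncR gtr0_norm ?decay_gt0.
- exact: integrable_decay.
Qed.

Lemma cmeas_poisson_pair f e : cintg mu f -> 0 < e ->
  cmeas (fun z : R * R => f z.1 * (f z.2)^* * (poisson e (z.1 - z.2))%:C).
Proof.
move=> cf e0; apply: cmeasM; first exact: cmeas_prod cf (cintgJ cf).
apply: cmeas_real; apply: measurableT_comp.
  by apply: continuous_measurable_fun; exact: continuous_poisson.
exact: measurable_funB.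
Qed.

Lemma le_poisson_pair f e : 0 < e -> forall x y : R,
  nc (f x * (f y)^* * (poisson e (x - y))%:C) <= nc (f x) * (2 / e * nc (f y)).
Proof.
move=> e0 x y; rewrite !Normc.normcM ncJ ncR (gtr0_norm (poisson_gt0 _ e0)).
rewrite -mulrA ler_wpM2l ?nc_ge0// mulrC ler_wpM2r ?nc_ge0//.
exact: poisson_le.
Qed.

(* Fubini in [xi], [s], [t] after expanding the square of [FT f xi]. *)
Lemma weighted_FT f e : cintg mu f -> 0 < e ->
  (Rintegral mu setT (fun xi => decay e xi * nc (FT f xi) ^+ 2))%:C =
  Cint (mu \x mu)%E (fun z => f z.1 * (f z.2)^* * (poisson e (z.1 - z.2))%:C).
Proof.
move=> cf e0; have cFT := cmeas_FT cf; have idecay := integrable_decay e0.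
pose N := Rintegral mu setT (fun x => nc (f x)).
(* The two factors of the squared modulus are opened one at a time: [K1] keeps one transform closed,
   bounded by the L^1 norm [N], and [K2 s] opens it once [s] is fixed. Each interchange then
   involves two variables only. *)
pose K1 (z : R * R) : R[i] :=
  (decay e z.1)%:C * (FT f z.1)^* * (f z.2 * cis (- (2 * pi * z.2 * z.1))).
pose K2 s (z : R * R) : R[i] :=
  f s * (f z.2)^* * ((decay e z.1)%:C * cis (- (2 * pi * (s - z.2) * z.1))).
have mphase : cmeas (fun z : R * R => cis (- (2 * pi * z.2 * z.1)) : R[i]).
  apply: cmeas_cis; apply: measurable_funN; apply: measurable_funM => //.
  exact: measurable_funM.
have mdecay : cmeas (fun z : R * R => (decay e z.1)%:C : R[i]).
  by apply: cmeas_real; exact: (measurableT_comp (measurable_decay e) measurable_fst).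
have mf2 : cmeas (fun z : R * R => f z.2).
  exact: (cmeas_comp measurable_snd (cintg_meas cf)).
have mK1 : cmeas K1.
  apply: cmeasM; last exact: cmeasM.
  by apply: cmeasM => //; apply: cmeasJ; exact: (cmeas_comp measurable_fst cFT).
have K1ab (x y : R) : nc (K1 (x, y)) <= decay e x * (N * nc (f y)).
  rewrite /K1 !Normc.normcM ncR nc_cis mulr1 ncJ (gtr0_norm (decay_gt0 _ _)) -mulrA.
  apply: ler_wpM2l; first exact/ltW/decay_gt0.
  by apply: ler_wpM2r; [exact: nc_ge0|exact: le_nc_FT].
have mK2 s : cmeas (K2 s).
  apply: cmeasM; first by apply: cmeasM; [exact: cmeas_cst|exact: cmeasJ].
  apply: cmeasM => //; apply: cmeas_cis; apply: measurable_funN.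
  apply: measurable_funM => //; apply: measurable_funM => //.
  exact: measurable_funB.
have K2ab s (x y : R) : nc (K2 s (x, y)) <= decay e x * (nc (f s) * nc (f y)).
  rewrite /K2 !Normc.normcM ncR nc_cis mulr1 ncJ (gtr0_norm (decay_gt0 _ _)).
  by rewrite mulrC.
have iN : mu.-integrable setT (fun y => (N * nc (f y))%:E).
  by apply: rintgZ; exact: cintg_nc.
have iS s : mu.-integrable setT (fun y => (nc (f s) * nc (f y))%:E).
  by apply: rintgZ; exact: cintg_nc.
have iP : mu.-integrable setT (fun y => (2 / e * nc (f y))%:E).
  by apply: rintgZ; exact: cintg_nc.
rewrite (cdom_prodE (cintg_nc cf) iP (cmeas_poisson_pair cf e0) (le_poisson_pair f e0)) /=.
transitivity (Cint mu (fun x => Cint mu (fun y => K1 (x, y)))).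
  have E xi : Cint mu (fun y => K1 (xi, y)) = (decay e xi * nc (FT f xi) ^+ 2)%:C.
    transitivity ((decay e xi)%:C * (FT f xi)^* * FT f xi).
      by rewrite -CintZ//; exact: cintg_FT.
    by rewrite -mulrA (mulrC (FT f xi)^*) mulJc -rmorphM.
  transitivity (Cint mu (fun xi => (decay e xi * nc (FT f xi) ^+ 2)%:C)); last first.
    by apply: eq_Cint => xi; rewrite E.
  apply: ReIm_inj => //=.
  by rewrite /Rintegral integral0.
rewrite (cdom_fubini idecay iN mK1 K1ab).
apply: eq_Cint => s.
transitivity (Cint mu (fun x => Cint mu (fun y => K2 s (x, y)))).
  apply: eq_Cint => xi.
  transitivity (f s * cis (- (2 * pi * s * xi)) * (decay e xi)%:C * (FT f xi)^*).
    by rewrite /K1 /=; ring.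
  have cg := cintgJ (cintg_FT xi cf).
  transitivity (f s * cis (- (2 * pi * s * xi)) * (decay e xi)%:C *
      Cint mu (fun t => (f t * cis (- (2 * pi * t * xi)))^*)).
    by rewrite CintJ//; exact: cintg_FT.
  rewrite -CintZ//; apply: eq_Cint => t.
  rewrite /K2 conjcM -cisN opprK.
  have -> : - (2 * pi * (s - t) * xi) = - (2 * pi * s * xi) + 2 * pi * t * xi by ring.
  by rewrite cisD; ring.
rewrite (cdom_fubini idecay (iS s) (mK2 s) (K2ab s)).
apply: eq_Cint => t.
rewrite -decay_cis_integral// -CintZ//.
exact: cintg_decay_phase.
Qed.

End plancherel.

Section plancherel_inequalities.
Local Open Scope complex_scope.
Local Open Scope ring_scope.
Variable R : realType.
Implicit Types (f g h : R -> R[i]).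

Let nrm2_Epoisson f e : inL2 f -> 0 < e ->
  (\int[mu]_x \int[mu]_y (nc (f x) ^+ 2 * poisson e (x - y))%:E = (nrm2 f)%:E)%E.
Proof.
move=> f2 e0; rewrite -nrm2E//; apply: eq_integral => x _.
have mp : measurable_fun setT (fun y : R => (poisson e y)%:E).
  apply/measurable_EFinP; apply: continuous_measurable_fun.
  exact: continuous_poisson.
transitivity ((nc (f x) ^+ 2)%:E * \int[mu]_y (poisson e (x - y))%:E)%E.
  rewrite -ge0_integralZl//; last 2 first.
  - by move=> y _; rewrite lee_fin ltW// poisson_gt0.
  - by rewrite lee_fin sqr_ge0.
  apply/measurable_EFinP.
  have /measurable_EFinP := mp; exact: measurable_fun_reflect.
by rewrite (integral_reflect x mp) integral_poisson// mule1.
Qed.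

Let integrable_poisson1 f e : inL2 f -> 0 < e ->
  (mu \x mu)%E.-integrable setT
    (fun z : R * R => (nc (f z.1) ^+ 2 * poisson e (z.1 - z.2))%:E) /\
  Rintegral (mu \x mu)%E setT
    (fun z : R * R => nc (f z.1) ^+ 2 * poisson e (z.1 - z.2)) = nrm2 f.
Proof.
move=> f2 e0; have mA : measurable_fun setT
    (fun z : R * R => (nc (f z.1) ^+ 2 * poisson e (z.1 - z.2))%:E).
  apply/measurable_EFinP; apply: measurable_funM.
    exact: (measurableT_comp (measurable_nc2 (inL2_meas f2)) measurable_fst).
  apply: measurableT_comp; last exact: measurable_funB.
  by apply: continuous_measurable_fun; exact: continuous_poisson.
have A0 (z : R * R) : (0 <= (nc (f z.1) ^+ 2 * poisson e (z.1 - z.2))%:E)%E.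
  by rewrite lee_fin mulr_ge0 ?sqr_ge0// ltW// poisson_gt0.
have E : (\int[(mu \x mu)%E]_z (nc (f z.1) ^+ 2 * poisson e (z.1 - z.2))%:E =
    (nrm2 f)%:E)%E.
  by rewrite (@fubini_tonelli1 _ _ (measurableTypeR R) (measurableTypeR R) R mu mu _ mA A0) -(nrm2_Epoisson f2 e0).
split; last by rewrite /Rintegral E.
apply/integrableP; split=> //.
by under eq_integral do rewrite gee0_abs//; rewrite E ltry.
Qed.

Let integrable_poisson2 f e : inL2 f -> 0 < e ->
  (mu \x mu)%E.-integrable setT
    (fun z : R * R => (nc (f z.2) ^+ 2 * poisson e (z.1 - z.2))%:E) /\
  Rintegral (mu \x mu)%E setT
    (fun z : R * R => nc (f z.2) ^+ 2 * poisson e (z.1 - z.2)) = nrm2 f.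
Proof.
move=> f2 e0; have mA : measurable_fun setT
    (fun z : R * R => (nc (f z.2) ^+ 2 * poisson e (z.1 - z.2))%:E).
  apply/measurable_EFinP; apply: measurable_funM.
    exact: (measurableT_comp (measurable_nc2 (inL2_meas f2)) measurable_snd).
  apply: measurableT_comp; last exact: measurable_funB.
  by apply: continuous_measurable_fun; exact: continuous_poisson.
have A0 (z : R * R) : (0 <= (nc (f z.2) ^+ 2 * poisson e (z.1 - z.2))%:E)%E.
  by rewrite lee_fin mulr_ge0 ?sqr_ge0// ltW// poisson_gt0.
have E : (\int[(mu \x mu)%E]_z (nc (f z.2) ^+ 2 * poisson e (z.1 - z.2))%:E =
    (nrm2 f)%:E)%E.
  rewrite (@fubini_tonelli2 _ _ (measurableTypeR R) (measurableTypeR R) R mu mu _ mA A0) -(nrm2_Epoisson f2 e0).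
  apply: eq_integral => y _; apply: eq_integral => x _ /=.
  by rewrite -poissonN opprB.
split; last by rewrite /Rintegral E.
apply/integrableP; split=> //.
by under eq_integral do rewrite gee0_abs//; rewrite E ltry.
Qed.

(** Polarisation. Dropping the last square gives the upper Plancherel bound; estimating it by the
    Lipschitz constant gives the lower one. *)
Lemma Re_mulJ_le (z w : R[i]) :
  complex.Re (z * w^*) = 2^-1 * (nc z ^+ 2 + nc w ^+ 2 - nc (z - w) ^+ 2).
Proof. by rewrite !sqr_nc !ReImE; field. Qed.

Lemma weighted_FT_Re f e : cintg mu f -> 0 < e ->
  Rintegral mu setT (fun xi => decay e xi * nc (FT f xi) ^+ 2) =
  Rintegral (mu \x mu)%E setT
    (fun z => complex.Re (f z.1 * (f z.2)^*) * poisson e (z.1 - z.2)) /\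
  (mu \x mu)%E.-integrable setT
    (fun z => (complex.Re (f z.1 * (f z.2)^*) * poisson e (z.1 - z.2))%:E).
Proof.
move=> cf e0; have iP : mu.-integrable setT (fun y => (2 / e * nc (f y))%:E).
  by apply: rintgZ; exact: cintg_nc.
have [cP _] := cdom_prod_cintg (cintg_nc cf) iP (cmeas_poisson_pair cf e0) (le_poisson_pair f e0).
have E z : complex.Re (f z.1 * (f z.2)^* * (poisson e (z.1 - z.2))%:C) =
  complex.Re (f z.1 * (f z.2)^*) * poisson e (z.1 - z.2).
  by rewrite mulrC ReZ mulrC.
split; last by under eq_fun do rewrite -E.
have := congr1 (@complex.Re R) (weighted_FT cf e0) => /= ->.
by apply: eq_Rintegral => z _; rewrite E.
Qed.

(** After polarisation each of the two squares integrates to [nrm2 f], because the Poisson kernel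
    has mass 1 in either variable. *)
Lemma weighted_FT_le f e : cintg mu f -> inL2 f -> 0 < e ->
  Rintegral mu setT (fun xi => decay e xi * nc (FT f xi) ^+ 2) <= nrm2 f.
Proof.
move=> cf f2 e0; have [-> iRe] := weighted_FT_Re cf e0.
have [i1 e1] := integrable_poisson1 f2 e0.
have [i2 e2] := integrable_poisson2 f2 e0.
have -> : nrm2 f = Rintegral (mu \x mu)%E setT (fun z : R * R =>
    2^-1 * (nc (f z.1) ^+ 2 * poisson e (z.1 - z.2) +
            nc (f z.2) ^+ 2 * poisson e (z.1 - z.2))).
  rewrite RintegralZl//; last exact: rintgD.
  by rewrite RintegralD// e1 e2; field.
apply: le_Rintegral; [exact: measurableT|exact: iRe|by apply: rintgZ; exact: rintgD|].
move=> z _; rewrite -mulrDl [leRHS]mulrA ler_wpM2r ?(ltW (poisson_gt0 _ _))//.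
rewrite Re_mulJ_le ler_wpM2l ?invr_ge0//.
by rewrite lerBlDr lerDl sqr_ge0.
Qed.

Lemma integrable_weighted_FT f e : cintg mu f -> 0 < e ->
  mu.-integrable setT (fun xi => (decay e xi * nc (FT f xi) ^+ 2)%:E).
Proof.
move=> cf e0; pose N := Rintegral mu setT (fun x => nc (f x)).
apply: (le_integrable measurableT _ _ (rintgZ (N ^+ 2) (integrable_decay e0))).
  apply/measurable_EFinP; apply: measurable_funM; first exact: measurable_decay.
  by apply: measurable_nc2; exact: cmeas_FT.
move=> xi _; have d0 := ltW (decay_gt0 e xi).
rewrite lee_fin ger0_norm ?(mulr_ge0 _ (sqr_ge0 _))//.
rewrite ger0_norm ?(mulr_ge0 (sqr_ge0 _))// mulrC ler_wpM2r//.
have N0 : 0 <= N by exact: le_trans (nc_ge0 _) (le_nc_FT 0 cf).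
by rewrite ler_pXn2r ?nnegrE ?nc_ge0// le_nc_FT.
Qed.

Let eps_ j : R := j.+1%:R^-1.

Let eps_gt0 j : 0 < eps_ j. Proof. by rewrite invr_gt0. Qed.

Let cvg_eps : eps_ @ \oo --> (0 : R).
Proof. exact: cvg_harmonic. Qed.

(** The weights increase to 1 along e = 1 / (j + 1), so monotone convergence removes them;
    square-integrability of the transform comes out together with the bound. *)
Lemma FT_inL2_le f : cintg mu f -> inL2 f -> inL2 (FT f) /\ nrm2 (FT f) <= nrm2 f.
Proof.
move=> cf f2; have mFT := cmeas_FT cf.
pose g j xi := (decay (eps_ j) xi * nc (FT f xi) ^+ 2)%:E.
have mg j : measurable_fun setT (g j).
  by have /integrableP[] := integrable_weighted_FT cf (eps_gt0 j).
have g0 j xi : (0 <= g j xi)%E.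
  by rewrite lee_fin mulr_ge0 ?sqr_ge0 ?(ltW (decay_gt0 _ _)).
have ndg xi : {homo g^~ xi : n m / (n <= m)%N >-> (n <= m)%E}.
  move=> n m nm; rewrite lee_fin ler_wpM2r ?sqr_ge0// ler_expR lerN2.
  by rewrite ler_wpM2r// lef_pV2 ?posrE// ler_nat.
have limg xi : limn (g^~ xi) = (nc (FT f xi) ^+ 2)%:E.
  have h1 : - (eps_ j * `|xi|) @[j --> \oo] --> - (0 * `|xi|).
    by apply: cvgN; apply: cvgMr_tmp; exact: cvg_eps.
  have := cvg_comp _ _ h1 (@continuous_expR R _).
  rewrite mul0r oppr0 expR0 => /(cvgMr_tmp (b := nc (FT f xi) ^+ 2)).
  rewrite mul1r => h2; apply/cvg_lim => //.
  by apply: cvg_EFin h2; exact: nearW.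
have le_nrm2 : (\int[mu]_xi (nc (FT f xi) ^+ 2)%:E <= (nrm2 f)%:E)%E.
  under eq_integral do rewrite -limg.
  rewrite (monotone_convergence mu measurableT mg (fun j x _ => g0 j x)
    (fun x _ => @ndg x)).
  apply: lime_le.
    apply: ereal_nondecreasing_is_cvgn => n m nm.
    apply: (ge0_le_integral mu measurableT (fun x _ => g0 n x) (mg n) (mg m)) => xi _.
    exact: ndg.
  apply: nearW => j.
  have /integrable_fin_num fi := integrable_weighted_FT cf (eps_gt0 j).
  rewrite -[leLHS]fineK ?fi// lee_fin.
  exact: weighted_FT_le.
have F2 : inL2 (FT f).
  apply/inL2P; split=> //; apply/integrableP; split.
    by apply/measurable_EFinP; exact: measurable_nc2.
  under eq_integral do rewrite gee0_abs ?lee_fin ?sqr_ge0//.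
  by rewrite (le_lt_trans le_nrm2)// ltry.
by split=> //; rewrite -lee_fin -nrm2E.
Qed.

End plancherel_inequalities.

(** * Compactly supported functions *)

Section window.
Local Open Scope complex_scope.
Local Open Scope ring_scope.
Variable R : realType.
Implicit Types (f g h : R -> R[i]) (n x : R).

(** The interval is open: off it the condition reads [n <= |x|], the form in which compact support
    is expressed throughout. *)
Definition win n x : R := if `|x| < n then 1 else 0.

Lemma winE n : win n = (\1_(`]- n, n[%classic) : R -> R).
Proof.
by apply/funext => x; rewrite indicE /win mem_setE in_itv /= -ltr_norml; case: ifP.
Qed.

Lemma win_ge0 n x : 0 <= win n x. Proof. by rewrite /win; case: ifP. Qed.

Lemma win_le1 n x : win n x <= 1. Proof. by rewrite /win; case: ifP. Qed.

Lemma win_in n x : `|x| < n -> win n x = 1. Proof. by rewrite /win => ->. Qed.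

Lemma win_out n x : n <= `|x| -> win n x = 0.
Proof. by rewrite leNgt /win => /negbTE ->. Qed.

Lemma measurable_win n : measurable_fun setT (win n).
Proof. by rewrite winE; exact: measurable_indic. Qed.

Lemma integrable_win n : mu.-integrable setT (fun x => (win n x)%:E).
Proof. by have := integrable_indic_itv (- n) n false true; rewrite winE. Qed.

Lemma win_mul n f : (forall x, n <= `|x| -> f x = 0) ->
  (fun x => (win n x)%:C * f x) = f.
Proof.
move=> f0; apply/funext => x; rewrite /win.
by case: ltP => [_|/f0 ->]; rewrite ?mul1r ?mulr0.
Qed.

Lemma Rintegral_win n (h : R -> R) :
  Rintegral mu setT (fun x => win n x * h x) =
  Rintegral mu `]- n, n[%classic h.
Proof.
rewrite [RHS]Rintegral_mkcond; apply: eq_Rintegral => x _.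
rewrite patchE mem_setE in_itv /= -ltr_norml /win.
by case: (_ < _); rewrite ?mul1r ?mul0r.
Qed.

Lemma bounded_supp_cintg f n M : cmeas f -> (forall x, n <= `|x| -> f x = 0) ->
  (forall x, nc (f x) <= M) -> cintg mu f.
Proof.
move=> mf f0 fM; apply: (@le_cintg _ (measurableTypeR R) _ _ _ (fun x => M * win n x)) => //.
  move=> x; have [xn|/f0 ->] := ltP `|x| n; first by rewrite win_in// mulr1.
  by rewrite Normc.normc0 mulr_ge0 ?win_ge0// (le_trans (nc_ge0 (f 0))).
by apply: rintgZ; exact: integrable_win.
Qed.

Lemma bounded_supp_inL2 f n M : cmeas f -> (forall x, n <= `|x| -> f x = 0) ->
  (forall x, nc (f x) <= M) -> inL2 f.
Proof.
move=> mf f0 fM; apply/inL2P; split => //.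
have M0 : 0 <= M by exact: le_trans (nc_ge0 (f 0)) (fM 0).
apply: (le_integrable measurableT _ _ (rintgZ (M ^+ 2) (integrable_win n))).
  by apply/measurable_EFinP; exact: measurable_nc2.
move=> x _; rewrite lee_fin !ger0_norm ?sqr_ge0 ?(mulr_ge0 (sqr_ge0 _)) ?win_ge0//.
have [xn|/f0 ->] := ltP `|x| n.
  by rewrite win_in// mulr1 ler_pXn2r ?nnegrE ?nc_ge0.
by rewrite Normc.normc0 expr0n mulr_ge0 ?win_ge0 ?sqr_ge0.
Qed.

Lemma inL2_supp_cintg f n : inL2 f -> (forall x, n <= `|x| -> f x = 0) ->
  cintg mu f.
Proof.
move=> f2 f0; rewrite -(win_mul f0); apply: cintg_L2M f2.
apply: (@bounded_supp_inL2 _ n 1).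
- by apply: cmeas_real; exact: measurable_win.
- by move=> x xn; rewrite win_out.
- by move=> x; rewrite ncR ger0_norm ?win_ge0 ?win_le1.
Qed.

End window.

(** * The Plancherel lower bound for functions Lipschitz on an interval *)

Section plancherel_lower_bound.
Local Open Scope complex_scope.
Local Open Scope ring_scope.
Variables (R : realType) (f : R -> R[i]) (n M L : R).
Hypotheses (n0 : 0 < n) (mf : cmeas f) (f0 : forall x, n <= `|x| -> f x = 0)
  (fM : forall x, nc (f x) <= M)
  (fL : forall s t, `|s| < n -> `|t| < n -> nc (f s - f t) <= L * `|s - t|).

Let cf : cintg mu f. Proof. exact: bounded_supp_cintg mf f0 fM. Qed.
Let f2 : inL2 f. Proof. exact: bounded_supp_inL2 mf f0 fM. Qed.

(** Since [f] may jump at the ends of the window, only pairs inside it can be compared. A point [s]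
    then sees this part of the unit Poisson mass, which tends to 1 as e -> 0 when [s] is
    interior. *)
Let mass e s := Rintegral mu setT (fun t => win n t * poisson e (s - t)).

Let massE e s : 0 < e ->
  mass e s = pi^-1 * (atan (2 * pi / e * (n - s)) + atan (2 * pi / e * (n + s))).
Proof.
move=> e0; rewrite -integral_poisson_itv//; rewrite /mass Rintegral_win.
have ic : mu.-integrable `[- n, n] (EFin \o (fun t => poisson e (s - t))).
  apply: continuous_compact_integrable; first exact: segment_compact.
  apply: continuous_subspaceT => x.
  apply: (@continuous_comp _ _ _ (fun t : R => s - t) (poisson e)).
    by apply: cvgB; [exact: cvg_cst|exact: cvg_id].
  exact: continuous_poisson.
rewrite Rintegral_itv_obnd_cbnd; last first.
  by apply: integrableS ic => // x /=; rewrite !in_itv /= => /andP[? ?]; rewrite !ltW.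
rewrite Rintegral_itv_bndo_bndc//.
by apply: integrableS ic => // x /=; rewrite !in_itv /= => /andP[-> /ltW].
Qed.

Let mass_ge0 e s : 0 < e -> 0 <= mass e s.
Proof.
move=> e0; apply: Rintegral_ge0 => x _.
by rewrite mulr_ge0 ?win_ge0// ltW// poisson_gt0.
Qed.

Let mass_le1 e s : 0 < e -> mass e s <= 1.
Proof.
move=> e0; rewrite massE// ler_pdivrMl ?pi_gt0// mulr1.
have := atan_ltpi2 (2 * pi / e * (n - s)).
have := atan_ltpi2 (2 * pi / e * (n + s)); lra.
Qed.

Let eps_ j : R := j.+1%:R^-1.

Let eps_gt0 j : 0 < eps_ j. Proof. by rewrite invr_gt0. Qed.

Let cvg_eps : eps_ @ \oo --> (0 : R).
Proof. exact: cvg_harmonic. Qed.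

Let cvg_atan_eps u : 0 < u -> atan (2 * pi / eps_ j * u) @[j --> \oo] --> (pi / 2 : R).
Proof.
move=> u0; have h : (j.+1%:R : R) @[j --> \oo] --> +oo.
  by have := cvgr_idn (R := R); rewrite -(cvg_shiftS (fun j => j%:R : R)).
have c0 : 0 < 2 * pi * u :> R by rewrite !mulr_gt0// pi_gt0.
have h2 : 2 * pi * u * x @[x --> +oo] --> (+oo : set_system R).
  by apply: gt0_cvgMry => //; exact: cvg_id.
have -> : (fun j => atan (2 * pi / eps_ j * u)) =
    (fun j => atan (2 * pi * u * (j.+1%:R : R))).
  by apply/funext => j; rewrite /eps_ invrK; congr atan; ring.
exact: (cvg_comp _ _ (cvg_comp _ _ h h2) (@cvgy_atan R)).
Qed.

Let cvg_mass s : `|s| < n -> mass (eps_ j) s @[j --> \oo] --> (1 : R).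
Proof.
rewrite ltr_norml => /andP[s1 s2].
have E : pi^-1 * (pi / 2 + pi / 2) = 1 :> R.
  by rewrite -splitr mulVf// gt_eqF// pi_gt0.
have s3 : 0 < n - s by lra. have s4 : 0 < n + s by lra.
rewrite (_ : (fun j => mass (eps_ j) s) = (fun j => pi^-1 *
    (atan (2 * pi / eps_ j * (n - s)) + atan (2 * pi / eps_ j * (n + s))))); last first.
  by apply/funext => j; rewrite massE.
have := cvgMl_tmp (a := pi^-1) (cvgD (cvg_atan_eps s3) (cvg_atan_eps s4)).
by rewrite E => h; exact: h.
Qed.

Let i2 : mu.-integrable setT (fun x => (nc (f x) ^+ 2)%:E).
Proof. by have [] := (inL2P f).1 f2. Qed.

Let iw e : mu.-integrable setT (fun x => (2 / e * win n x)%:E).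
Proof. by apply: rintgZ; exact: integrable_win. Qed.

(** [A] and [B] are the two squares of the polarisation identity, weighted by the Poisson kernel and
    restricted to pairs in the window. *)
Let A e (z : R * R) := nc (f z.1) ^+ 2 * (win n z.2 * poisson e (z.1 - z.2)).
Let B e (z : R * R) := (win n z.1 * poisson e (z.1 - z.2)) * nc (f z.2) ^+ 2.

Let mpoisson e : 0 < e -> measurable_fun setT (fun z : R * R => poisson e (z.1 - z.2)).
Proof.
move=> e0; apply: measurableT_comp; last exact: measurable_funB.
by apply: continuous_measurable_fun; exact: continuous_poisson.
Qed.

Let mA e : 0 < e -> measurable_fun setT (A e).
Proof.
move=> e0; apply: measurable_funM.
  exact: (measurableT_comp (measurable_nc2 mf) measurable_fst).
apply: measurable_funM; last exact: mpoisson.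
exact: (measurableT_comp (measurable_win n) measurable_snd).
Qed.

Let mB e : 0 < e -> measurable_fun setT (B e).
Proof.
move=> e0; apply: measurable_funM; last first.
  exact: (measurableT_comp (measurable_nc2 mf) measurable_snd).
apply: measurable_funM; last exact: mpoisson.
exact: (measurableT_comp (measurable_win n) measurable_fst).
Qed.

Let wP_ge0 e s t : 0 < e -> 0 <= win n s * poisson e t.
Proof. by move=> e0; rewrite mulr_ge0 ?win_ge0// ltW// poisson_gt0. Qed.

Let Adom e : 0 < e -> forall x y : R, `|A e (x, y)| <= nc (f x) ^+ 2 * (2 / e * win n y).
Proof.
move=> e0 x y; rewrite ger0_norm; last first.
  exact: mulr_ge0 (sqr_ge0 _) (wP_ge0 _ _ e0).
by rewrite ler_wpM2l ?sqr_ge0// mulrC ler_wpM2r ?win_ge0// poisson_le.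
Qed.

Let Bdom e : 0 < e -> forall x y : R, `|B e (x, y)| <= 2 / e * win n x * nc (f y) ^+ 2.
Proof.
move=> e0 x y; rewrite ger0_norm; last first.
  exact: mulr_ge0 (wP_ge0 _ _ e0) (sqr_ge0 _).
by rewrite ler_wpM2r ?sqr_ge0// mulrC ler_wpM2r ?win_ge0// poisson_le.
Qed.

Let intA e : 0 < e -> Rintegral (mu \x mu)%E setT (A e) =
  Rintegral mu setT (fun s => nc (f s) ^+ 2 * mass e s) /\
  mu.-integrable setT (fun s => (nc (f s) ^+ 2 * mass e s)%:E).
Proof.
move=> e0; have E s : nc (f s) ^+ 2 * mass e s = Rintegral mu setT (fun t => A e (s, t)).
  rewrite -RintegralZl//; apply: (le_integrable measurableT _ _ (iw e)).
    apply/measurable_EFinP; apply: measurable_funM; first exact: measurable_win.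
    by apply: measurable_fun_reflect; apply: continuous_measurable_fun; exact: continuous_poisson.
  move=> t _; rewrite lee_fin ger0_norm ?wP_ge0// ger0_norm ?mulr_ge0 ?win_ge0 ?invr_ge0 ?(ltW e0)//.
  by rewrite mulrC ler_wpM2r ?win_ge0// poisson_le.
split.
  rewrite (dom_prodE i2 (iw e) (mA e0) (Adom e0)).
  by apply: eq_Rintegral => s _; rewrite E.
under eq_fun do rewrite E.
exact: (dom_integrable1 i2 (iw e) (mA e0) (Adom e0)).
Qed.

Let intB e : 0 < e -> Rintegral (mu \x mu)%E setT (B e) =
  Rintegral mu setT (fun s => nc (f s) ^+ 2 * mass e s).
Proof.
move=> e0; rewrite (dom_prodE (iw e) i2 (mB e0) (Bdom e0)).
rewrite (dom_fubini (iw e) i2 (mB e0) (Bdom e0)).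
apply: eq_Rintegral => t _; rewrite -RintegralZl//; last first.
  apply: (le_integrable measurableT _ _ (iw e)).
    apply/measurable_EFinP; apply: measurable_funM; first exact: measurable_win.
    by apply: measurable_fun_reflect; apply: continuous_measurable_fun; exact: continuous_poisson.
  move=> s _; rewrite lee_fin ger0_norm ?wP_ge0// ger0_norm ?mulr_ge0 ?win_ge0 ?invr_ge0 ?(ltW e0)//.
  by rewrite mulrC ler_wpM2r ?win_ge0// poisson_le.
by apply: eq_Rintegral => s _; rewrite /B /= mulrC -poissonN opprB.
Qed.

Let C := Rintegral (mu \x mu)%E setT (fun z : R * R => win n z.1 * win n z.2).

(** By polarisation the weighted square of the transform is the mean of [A] and [B] minus half the
    squared increment times the kernel, which is at most L^2 e on the window square, of area [C].
    Off that square both integrands vanish. *)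
Let lower e : 0 < e ->
  Rintegral mu setT (fun s => nc (f s) ^+ 2 * mass e s) - 2^-1 * L ^+ 2 * e * C <=
  nrm2 (FT f).
Proof.
move=> e0; have [F2 _] := FT_inL2_le cf f2.
have [IE iRe] := weighted_FT_Re cf e0.
apply: (@le_trans _ _ (Rintegral mu setT (fun xi => decay e xi * nc (FT f xi) ^+ 2))); last first.
  apply: le_Rintegral => //; first exact: integrable_weighted_FT.
    by have [] := (inL2P (FT f)).1 F2.
  by move=> xi _; rewrite ler_piMl ?sqr_ge0// decay_le1// ltW.
have iA := dom_prod_integrable i2 (iw e) (mA e0) (Adom e0).
have iB := dom_prod_integrable (iw e) i2 (mB e0) (Bdom e0).
have iww : (mu \x mu)%E.-integrable setT (fun z : R * R => (win n z.1 * win n z.2)%:E).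
  apply: (dom_prod_integrable (integrable_win n) (integrable_win n)).
    apply: measurable_funM.
      exact: (measurableT_comp (measurable_win n) measurable_fst).
    exact: (measurableT_comp (measurable_win n) measurable_snd).
  by move=> x y /=; rewrite ger0_norm ?mulr_ge0 ?win_ge0.
have [AE _] := intA e0; have BE := intB e0.
have -> : Rintegral mu setT (fun s => nc (f s) ^+ 2 * mass e s) - 2^-1 * L ^+ 2 * e * C =
    Rintegral (mu \x mu)%E setT (fun z => 2^-1 * (A e z + B e z) -
      2^-1 * L ^+ 2 * e * (win n z.1 * win n z.2)).
  rewrite RintegralB//; [|by apply: rintgZ; exact: rintgD|exact: rintgZ].
  rewrite !RintegralZl//; last exact: rintgD.
  by rewrite RintegralD// AE BE /C; field.
rewrite IE; apply: le_Rintegral; [exact: measurableT| |exact: iRe|].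
  by apply: rintgB; apply: rintgZ => //; exact: rintgD.
move=> [s t] _; rewrite /A /B /=.
have P0 := poisson_gt0 (s - t) e0; have xP := sqr_poisson_le (s - t) e0.
rewrite Re_mulJ_le; have [sn|sn] := ltP `|s| n; last first.
  by rewrite (win_out sn) (f0 sn) Normc.normc0 sub0r ncN; nra.
have [tn|tn] := ltP `|t| n; last first.
  by rewrite (win_out tn) (f0 tn) Normc.normc0 subr0; nra.
rewrite !win_in// !mul1r mulr1.
suff : nc (f s - f t) ^+ 2 * poisson e (s - t) <= L ^+ 2 * e by nra.
apply: (@le_trans _ _ (L ^+ 2 * (s - t) ^+ 2 * poisson e (s - t))).
  rewrite ler_wpM2r ?(ltW P0)// -(real_normK (num_real (s - t))) -exprMn.
  rewrite ler_pXn2r ?nnegrE ?nc_ge0 ?fL//.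
  exact: le_trans (nc_ge0 _) (fL sn tn).
by rewrite -mulrA ler_wpM2l ?sqr_ge0.
Qed.

Lemma lipschitz_nrm2_le_FT : nrm2 f <= nrm2 (FT f).
Proof.
have cv : Rintegral mu setT (fun s => nc (f s) ^+ 2 * mass (eps_ j) s) @[j --> \oo]
    --> nrm2 f.
  (* At the ends of the window [mass] tends to 1/2 only, so the integrals are restricted to the open
     interval before dominated convergence is applied. *)
  have E (h : R -> R) : (forall x, n <= `|x| -> h x = 0) ->
      Rintegral mu setT h = Rintegral mu `]- n, n[%classic h.
    move=> h0; rewrite -Rintegral_win; apply: eq_Rintegral => x _.
    by rewrite /win; case: ltP => [_|/h0 ->]; rewrite ?mul1r ?mulr0.
  have -> : nrm2 f = Rintegral mu `]- n, n[%classic (fun s => nc (f s) ^+ 2).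
    by rewrite -E// => x /f0 ->; rewrite Normc.normc0 expr0n.
  have i2D : mu.-integrable `]- n, n[ (fun x => (nc (f x) ^+ 2)%:E).
    by apply: integrableS i2.
  under eq_fun => j.
    rewrite E; last by move=> x /f0 ->; rewrite Normc.normc0 expr0n mul0r.
    over.
  suff H : (fun j : nat => \int[mu]_(s in `](- n)%R, n[)
      (nc (f s) ^+ 2 * mass (eps_ j) s)%:E)%E @ \oo -->
      (\int[mu]_(s in `](- n)%R, n[) (nc (f s) ^+ 2)%:E)%E.
    apply: (fine_cvg (a := Rintegral mu `]- n, n[%classic (fun s => nc (f s) ^+ 2)) _).
    by rewrite fineK//; exact: integrable_fin_num.
  apply: (@dominated_cvg _ _ _ mu _ _ _ _ (fun x => (nc (f x) ^+ 2)%:E)) => //.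
  - move=> j; have [_ /integrableP[m _]] := intA (eps_gt0 j).
    exact: measurable_funS m.
  - move=> x /=; rewrite in_itv /= -ltr_norml => xn.
    apply: cvg_EFin; first exact: nearW.
    by rewrite -[X in _ --> X]mulr1; apply: cvgMl_tmp; exact: cvg_mass.
  - move=> j x _; rewrite lee_fin ger0_norm ?(mulr_ge0 (sqr_ge0 _)) ?mass_ge0//.
    by rewrite ler_piMr ?sqr_ge0 ?mass_le1.
have cvE : 2^-1 * L ^+ 2 * eps_ j * C @[j --> \oo] --> (0 : R).
  rewrite -(mul0r C) -[X in X * C](mulr0 (2^-1 * L ^+ 2)).
  by apply: cvgMr_tmp; apply: cvgMl_tmp; exact: cvg_eps.
rewrite -[leLHS]subr0.
apply: (ler_cvg_to (cvgB cv cvE) (cvg_cst (nrm2 (FT f)))).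
by apply: nearW => j; exact: lower.
Qed.

End plancherel_lower_bound.

(** * Polynomial density in L^2 *)

Section bernstein.
Variable R : realType.
Implicit Types (h : nat -> R) (x M : R).

(* [bern N h] is the polynomial [\sum_k 'C(N, k) X^k (1 - X)^(N - k) h(k)]. *)
Fixpoint bern N h : {poly R} :=
  if N is N'.+1 then 'X * bern N' (fun k => h k.+1) + (1 - 'X) * bern N' h
  else (h 0%N)%:P.

Lemma bernS N h x : (bern N.+1 h).[x] =
  x * (bern N (fun k => h k.+1)).[x] + (1 - x) * (bern N h).[x].
Proof. by rewrite /= !hornerE. Qed.

Lemma le_bern N h h' x : 0 <= x <= 1 -> (forall k, h k <= h' k) ->
  (bern N h).[x] <= (bern N h').[x].
Proof.
move=> /andP[x0 x1]; elim: N h h' => [|N IH] h h' hh'.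
  by rewrite /= !hornerE.
by rewrite !bernS lerD// ler_wpM2l ?subr_ge0//; apply: IH => k.
Qed.

(** The second moment of the binomial law: variance N x (1 - x) plus the square of the mean. The
    shift [a] absorbs the index shift in the recursion, while [c] and [d] cover constants and
    quadratic comparison functions of both signs. *)
Lemma bern_sqr N (a c d x : R) :
  (bern N (fun k => c + d * (k%:R + a) ^+ 2)).[x] =
  c + d * (N%:R * x * (1 - x) + (N%:R * x + a) ^+ 2).
Proof.
elim: N a => [|N IH] a; first by rewrite /= hornerC; ring.
rewrite bernS IH.
have -> : (fun k : nat => c + d * (k.+1%:R + a) ^+ 2) =
    (fun k : nat => c + d * (k%:R + (1 + a)) ^+ 2).
  by apply/funext => k; rewrite -[k.+1]addn1 natrD addrA.
by rewrite IH -[N.+1]addn1 natrD; ring.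
Qed.

Variables (G : R -> R) (M : R).
Hypothesis GM : forall x, `|G x| <= M.

(** The degree is [N.+1], so that the sample points never divide by zero. *)
Definition bernstein N := bern N.+1 (fun k => G (k%:R / N.+1%:R)).

Lemma bernstein_le N x : 0 <= x <= 1 -> `|(bernstein N).[x]| <= M.
Proof.
move=> x01; have E (c : R) : (bern N.+1 (fun k => c + 0 * (k%:R + 0) ^+ 2)).[x] = c.
  by rewrite bern_sqr mul0r addr0.
rewrite ler_norml; apply/andP; split.
- rewrite -(E (- M)); apply: le_bern => // k /=.
  by rewrite mul0r addr0; have := GM (k%:R / N.+1%:R); rewrite ler_norml => /andP[].
- rewrite -[leRHS](E M); apply: le_bern => // k /=.
  by rewrite mul0r addr0; have := GM (k%:R / N.+1%:R); rewrite ler_norml => /andP[].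
Qed.

(** Chebyshev's argument: [bound] replaces the modulus of continuity by a constant plus a quadratic
    centred at [x]. The Bernstein mean of that square is the variance x (1 - x) / N.+1, at most 1 /
    N.+1. *)
Lemma bernstein_dist N x (e r : R) : 0 <= x <= 1 -> 0 < r -> 0 < e ->
  (forall y, `|x - y| < r -> `|G x - G y| < e) ->
  `|G x - (bernstein N).[x]| <= e + 2 * M / r ^+ 2 * N.+1%:R^-1.
Proof.
move=> x01 r0 e0 Ge; have /andP[x0 x1] := x01.
have M0 : 0 <= M by exact: le_trans (normr_ge0 _) (GM 0).
have N0 : 0 < N.+1%:R :> R by [].
pose D := 2 * M / r ^+ 2.
have D0 : 0 <= D by apply: divr_ge0; [exact: mulr_ge0|exact: sqr_ge0].
have bound y : `|G x - G y| <= e + D * (y - x) ^+ 2.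
  have [xy|xy] := ltP `|x - y| r.
    apply: le_trans (ltW (Ge _ xy)) _; rewrite lerDl.
    by rewrite mulr_ge0 ?sqr_ge0.
  have h1 : `|G x - G y| <= 2 * M.
    apply: le_trans (ler_normB _ _) _.
    have := GM x; have := GM y; lra.
  apply: le_trans h1 _.
  have rD : D * r ^+ 2 = 2 * M by rewrite /D divfK// expf_neq0// gt_eqF.
  have xyr : r ^+ 2 <= (y - x) ^+ 2.
    rewrite -(real_normK (num_real (y - x))) distrC.
    by rewrite ler_pXn2r ?nnegrE// ltW.
  by rewrite -rD; have := ler_wpM2l D0 xyr; lra.
have E (s : R) : (bern N.+1 (fun k => s + D / N.+1%:R ^+ 2 * (k%:R + - (N.+1%:R * x)) ^+ 2)).[x]
    <= s + D * N.+1%:R^-1.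
  rewrite bern_sqr lerD2l subrr expr0n addr0.
  have -> : D / N.+1%:R ^+ 2 * (N.+1%:R * x * (1 - x)) = D * N.+1%:R^-1 * (x * (1 - x)).
    by field; rewrite gt_eqF.
  by rewrite ler_piMr ?mulr_ge0 ?invr_ge0//; nra.
have E' (s : R) : (bern N.+1 (fun k => s + - (D / N.+1%:R ^+ 2) * (k%:R + - (N.+1%:R * x)) ^+ 2)).[x]
    >= s - D * N.+1%:R^-1.
  rewrite bern_sqr lerD2l subrr expr0n addr0 mulNr lerN2.
  have -> : D / N.+1%:R ^+ 2 * (N.+1%:R * x * (1 - x)) = D * N.+1%:R^-1 * (x * (1 - x)).
    by field; rewrite gt_eqF.
  by rewrite ler_piMr ?mulr_ge0 ?invr_ge0//; nra.
have sq k : D / N.+1%:R ^+ 2 * (k%:R + - (N.+1%:R * x)) ^+ 2 = D * (k%:R / N.+1%:R - x) ^+ 2.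
  by field; rewrite gt_eqF.
rewrite ler_distlC; apply/andP; split.
- have := E' (G x - e); rewrite /D => h; apply: le_trans (_ : _ <= G x - e - D * N.+1%:R^-1) _.
    by rewrite /D opprD addrA.
  apply: le_trans (E' _) _; apply: le_bern => // k /=; rewrite mulNr sq.
  by have := bound (k%:R / N.+1%:R); rewrite ler_distlC => /andP[h1 _]; rewrite -addrA -opprD.
- apply: le_trans (_ : G x + e + D * N.+1%:R^-1 <= _); last by rewrite /D addrA.
  apply: le_trans (E _); apply: le_bern => // k /=; rewrite sq.
  by have := bound (k%:R / N.+1%:R); rewrite ler_distlC => /andP[_ h2]; rewrite -addrA.
Qed.

Lemma bernstein_cvg x : 0 <= x <= 1 -> {for x, continuous G} ->
  (bernstein N).[x] @[N --> \oo] --> G x.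
Proof.
move=> x01 cG; apply/cvgrPdist_le => e e0.
have M0 : 0 <= M by exact: le_trans (normr_ge0 _) (GM 0).
have e2 : 0 < e / 2 by rewrite divr_gt0.
have /cvgrPdist_lt/(_ _ e2) [r /= r0 rG] := cG.
have cv : e / 2 + 2 * M / r ^+ 2 * N.+1%:R^-1 @[N --> \oo] --> e / 2 + 2 * M / r ^+ 2 * 0.
  by apply: cvgD; [exact: cvg_cst|apply: cvgMl_tmp; exact: cvg_harmonic].
have e3 : e / 2 + 2 * M / r ^+ 2 * 0 < e by rewrite mulr0 addr0; lra.
near=> N.
apply: le_trans (@bernstein_dist N x (e / 2) r x01 r0 e2 rG) _.
near: N; apply: (cvgr_le _ cv); exact: e3.
Unshelve. all: by end_near. Qed.

End bernstein.

Section polynomial_density.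
Local Open Scope complex_scope.
Local Open Scope ring_scope.
Variable R : realType.
Implicit Types (f : R -> R[i]) (u g G : R -> R) (p q : {poly R}) (n M x y : R).

Definition sq2 u : R := Rintegral mu setT (fun x => u x ^+ 2).

Definition rL2 u : Prop :=
  measurable_fun setT u /\ mu.-integrable setT (fun x => (u x ^+ 2)%:E).

Lemma rL2P u : rL2 u <-> inL2 (fun x => (u x)%:C).
Proof.
have E : (fun x => (nc (u x)%:C ^+ 2)%:E) = (fun x => (u x ^+ 2)%:E).
  by apply/funext => x; rewrite ncR real_normK// num_real.
split=> [[mu_ iu]|/inL2P[[mu_ _]]]; last by rewrite E.
by apply/inL2P; split; [exact: cmeas_real|rewrite E].
Qed.

Lemma rL2B u g : rL2 u -> rL2 g -> rL2 (fun x => u x - g x).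
Proof.
move=> /rL2P u2 /rL2P g2; apply/rL2P.
by have := inL2B u2 g2; under eq_fun do rewrite -rmorphB.
Qed.

(* The factor 2 avoids square roots. *)
Lemma sq2_triangle u g h : rL2 u -> rL2 g -> rL2 h ->
  sq2 (fun x => u x - h x) <=
  2 * (sq2 (fun x => u x - g x) + sq2 (fun x => g x - h x)).
Proof.
move=> u2 g2 h2; have [_ i1] := rL2B u2 g2; have [_ i2] := rL2B g2 h2.
have [_ i3] := rL2B u2 h2.
rewrite -RintegralD// -RintegralZl//; last exact: rintgD.
apply: le_Rintegral; [exact: measurableT|exact: i3|by apply: rintgZ; exact: rintgD|].
move=> x _; have := sqr_ge0 (u x - g x - (g x - h x)); nra.
Qed.

Lemma measurable_horner p : measurable_fun setT (fun x : R => p.[x]).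
Proof. by apply: continuous_measurable_fun; exact: continuous_horner. Qed.

Lemma rL2_bounded u n M : measurable_fun setT u -> (forall x, n <= `|x| -> u x = 0) ->
  (forall x, `|u x| <= M) -> rL2 u.
Proof.
move=> mu_ u0 uM; apply/rL2P; apply: (@bounded_supp_inL2 _ _ n M).
- exact: cmeas_real.
- by move=> x /u0 ->.
- by move=> x; rewrite ncR.
Qed.

Lemma horner_bounded p n : exists2 C : R, 0 <= C & forall x, `|x| < n -> `|p.[x]| <= C.
Proof.
elim/poly_ind: p => [|p c [C C0 pC]].
  by exists 0 => // x _; rewrite horner0 normr0.
exists (C * `|n| + `|c|); first by rewrite addr_ge0 ?mulr_ge0.
move=> x xn; rewrite !hornerE; apply: le_trans (ler_normD _ _) _.
rewrite lerD2r normrM; apply: ler_pM => //; first exact: pC.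
exact: le_trans (ltW xn) (ler_norm _).
Qed.

Lemma rL2_win_horner n p : rL2 (fun x => win n x * p.[x]).
Proof.
have [C C0 pC] := horner_bounded p n.
apply: (@rL2_bounded _ n C).
- by apply: measurable_funM; [exact: measurable_win|exact: measurable_horner].
- by move=> x xn; rewrite win_out ?mul0r.
- move=> x; have [xn|xn] := ltP `|x| n; last by rewrite win_out// mul0r normr0.
  by rewrite win_in// mul1r pC.
Qed.

Lemma cvg_sq2_eventually (v : nat -> R -> R) (b : R -> R) (e : R) : 0 < e ->
  (forall j, measurable_fun setT (v j)) ->
  mu.-integrable setT (fun x => (b x)%:E) ->
  (forall j x, v j x ^+ 2 <= b x) ->
  (forall x, v j x @[j --> \oo] --> (0 : R)) ->
  exists j, sq2 (v j) < e.
Proof.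
move=> e0 mv ib vb v0.
have H : (fun j : nat => \int[mu]_x (v j x ^+ 2)%:E)%E @ \oo --> (\int[mu]_x (0 : R)%:E)%E.
  apply: (@dominated_cvg _ _ _ mu setT measurableT _ _ (fun x => (b x)%:E)) => //.
  - by move=> j; apply/measurable_EFinP; exact: (measurable_funX 2 (mv j)).
  - move=> x _; have := cvgM (v0 x) (v0 x); rewrite mulr0 => h2.
    by apply: (@cvg_EFin _ _ _ _ _ 0); [exact: nearW|exact: h2].
  - by move=> j x _; rewrite lee_fin ger0_norm ?sqr_ge0.
rewrite integral0 in H.
have h0 : (fun j : nat => sq2 (v j)) @ \oo --> (0 : R) by exact: fine_cvg H.
have [j _ /(_ j (leqnn j)) /=] :=
  (cvgrPdist_lt (V := R^o) (fun j => sq2 (v j)) 0).1 h0 e e0.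
rewrite sub0r normrN => h; exists j; apply: le_lt_trans h; exact: ler_norm.
Qed.

(** Bernstein polynomials of [G] transported to [0, 1]. Pointwise convergence is enough: they share
    the bound [M], so dominated convergence applies. *)
Lemma continuous_poly_dense G n M (e : R) : 0 < n -> 0 < e -> continuous G ->
  (forall x, `|G x| <= M) ->
  exists p, sq2 (fun x => win n x * G x - win n x * p.[x]) < e.
Proof.
move=> n0 e0 cG GM; pose H t := G (2 * n * t - n).
have HM t : `|H t| <= M by exact: GM.
pose c : {poly R} := (2 * n)^-1%:P * ('X + n%:P).
pose P N := bernstein H N \Po c.
have n20 : 2 * n != 0 by rewrite mulf_neq0// gt_eqF.
have cE x : c.[x] = (2 * n)^-1 * (x + n) by rewrite /c !hornerE.
have c01 x : `|x| < n -> 0 <= c.[x] <= 1.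
  rewrite ltr_norml cE mulrC => /andP[x1 x2].
  by rewrite divr_ge0 ?ler_pdivrMr ?mulr_gt0//; lra.
have Hc x : H c.[x] = G x by rewrite /H cE mulVKf// addrK.
have M0 : 0 <= M by exact: le_trans (normr_ge0 _) (GM 0).
have cH : continuous H.
  move=> t; apply: (@continuous_comp _ _ _ (fun t => 2 * n * t - n) G); last exact: cG.
  by apply: cvgB; [apply: cvgMl_tmp; exact: cvg_id|exact: cvg_cst].
suff [j hj] : exists j, sq2 (fun x => win n x * G x - win n x * (P j).[x]) < e.
  by exists (P j).
apply: (@cvg_sq2_eventually (fun N x => win n x * G x - win n x * (P N).[x])
    (fun x => (2 * M) ^+ 2 * win n x) e e0).
- move=> N; apply: measurable_funB; apply: measurable_funM; try exact: measurable_win.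
    exact: continuous_measurable_fun.
  exact: measurable_horner.
- by apply: rintgZ; exact: integrable_win.
- move=> N x; have [xn|xn] := ltP `|x| n; last first.
    by rewrite win_out// !mul0r subr0 expr0n mulr0.
  rewrite win_in// !mul1r mulr1 -(real_normK (num_real (_ - _))).
  rewrite ler_pXn2r ?nnegrE ?mulr_ge0//.
  apply: le_trans (ler_normB _ _) _; rewrite mulrDl mul1r lerD//.
  by rewrite horner_comp; apply: bernstein_le => //; exact: c01.
- move=> x; have [xn|xn] := ltP `|x| n; last first.
    by rewrite win_out//; under eq_fun do rewrite !mul0r subr0; exact: cvg_cst.
  under eq_fun do rewrite win_in// !mul1r horner_comp.
  rewrite -(subrr (G x)); apply: cvgB; first exact: cvg_cst.
  by rewrite -Hc; apply: bernstein_cvg => //; [exact: c01|exact: cH].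
Qed.

(** For [M >= 0], the projection onto [-M, M]. The formula with absolute values makes continuity
    immediate and leaves the other properties to linear arithmetic. *)
Definition clamp M y : R := 2^-1 * (`|y + M| - `|y - M|).

Lemma clamp_id M y : `|y| <= M -> clamp M y = y.
Proof.
rewrite ler_norml /clamp => /andP[y1 y2].
by rewrite ger0_norm ?ler0_norm; lra.
Qed.

Lemma clamp_le M y : 0 <= M -> `|clamp M y| <= M.
Proof.
move=> M0; rewrite /clamp ler_norml.
by case: (ger0P (y + M)) => h1; case: (ger0P (y - M)) => h2; apply/andP; split; lra.
Qed.

Lemma clamp_dist M x y : `|clamp M x - clamp M y| <= `|x - y|.
Proof.
rewrite /clamp ler_norml.
case: (ger0P (x + M)) => h1; case: (ger0P (x - M)) => h2;
case: (ger0P (y + M)) => h3; case: (ger0P (y - M)) => h4;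
case: (ger0P (x - y)) => h5; apply/andP; split; lra.
Qed.

Lemma continuous_clamp M : continuous (clamp M).
Proof.
move=> y; apply: cvgMl_tmp; apply: cvgB; apply: cvg_norm.
- by apply: cvgD; [exact: cvg_id|exact: cvg_cst].
- by apply: cvgB; [exact: cvg_id|exact: cvg_cst].
Qed.

(** Continuous functions approximate [u] in L^1, and clamping upgrades this to L^2: when both
    functions are bounded by [M], the squared difference is at most 2 M times the absolute
    difference. *)
Lemma bounded_poly_dense u n M (e : R) : 0 < n -> 0 < e -> measurable_fun setT u ->
  (forall x, n <= `|x| -> u x = 0) -> (forall x, `|u x| <= M) ->
  exists p, sq2 (fun x => u x - win n x * p.[x]) < e.
Proof.
move=> n0 e0 mu_ u0 uM; have M0 : 0 <= M by exact: le_trans (normr_ge0 _) (uM 0).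
have e4 : 0 < e / 4 by rewrite divr_gt0.
have iu : mu.-integrable `[- n, n] (EFin \o u).
  apply: (@integrableS _ _ _ mu setT) => //.
  apply: (le_integrable measurableT _ _ (rintgZ M (integrable_win n))).
    exact/measurable_EFinP.
  move=> x _; rewrite lee_fin.
  have [xn|/u0 ->] := ltP `|x| n; last by rewrite normr0.
  by rewrite win_in// mulr1 (le_trans (uM x))// ler_norm.
have fin : (mu `[(- n)%R, n]%classic < +oo)%E.
  by rewrite lebesgue_measure_itv /=; case: ifP => // _; rewrite -EFinD ltry.
have mE : measurable (`[- n, n]%classic : set (measurableTypeR R)) by exact: measurable_itv.
have [g [cg ig gu]] := approximation_continuous_integrable mE fin iu.
have iug j : mu.-integrable `[- n, n] (fun z => (u z - g j z)%:E).
  apply: (le_integrable mE _ _ (integrableD mE (integrable_abse iu) (integrable_abse (ig j)))).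
    apply/measurable_EFinP; apply: measurable_funB; first exact: measurable_funS mu_.
    by apply: measurable_funS (continuous_measurable_fun (cg j)).
  move=> x _ /=; rewrite lee_fin; apply: le_trans (ler_normB _ _) _.
  exact: ler_norm.
(* Chosen so that 2 M d <= e / 4; the added 1 keeps the denominator positive when [M = 0]. *)
pose d := e / 4 / (2 * M + 1).
have d0 : 0 < d by rewrite divr_gt0// ltr_wpDl ?mulr_ge0.
have [j hj] : exists j, (\int[mu]_(z in `[(- n)%R, n]) `|(u z - g j z)%:E| < d%:E)%E.
  pose I j := fine (\int[mu]_(z in `[(- n)%R, n]) `|(u z - g j z)%:E|)%E.
  have h0 : I @ \oo --> (0 : R) by exact: fine_cvg gu.
  have [j _ /(_ j (leqnn j)) /=] := (cvgrPdist_lt (V := R^o) I 0).1 h0 d d0.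
  rewrite sub0r normrN => h; exists j.
  rewrite -[ltLHS]fineK ?lte_fin; first by apply: le_lt_trans h; exact: ler_norm.
  by apply: integrable_fin_num => //; exact: (integrable_abse (iug j)).
pose G x := clamp M (g j x).
have cG : continuous G.
  move=> x; apply: (@continuous_comp _ _ _ (g j) (clamp M)); first exact: cg.
  exact: continuous_clamp.
have GM x : `|G x| <= M by exact: clamp_le.
have [p hp] := continuous_poly_dense n0 e4 cG GM; exists p.
have wG : rL2 (fun x => win n x * G x).
  apply: (@rL2_bounded _ n M).
  - by apply: measurable_funM; [exact: measurable_win|exact: continuous_measurable_fun].
  - by move=> x xn; rewrite win_out ?mul0r.
  - move=> x; have [xn|xn] := ltP `|x| n; last by rewrite win_out// mul0r normr0.
    by rewrite win_in// mul1r.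
have uL2 : rL2 u by exact: rL2_bounded mu_ u0 uM.
apply: le_lt_trans (sq2_triangle uL2 wG (rL2_win_horner n p)) _.
suff : sq2 (fun x => u x - win n x * G x) <= e / 4 by lra.
have [_ iuG] := rL2B uL2 wG.
have ijn : mu.-integrable `[- n, n] (fun z => `|(u z - g j z)%:E|%E).
  exact: (integrable_abse (iug j)).
have h2 : 2 * M * d <= e / 4.
  rewrite /d mulrA ler_pdivrMr ?ltr_wpDl ?mulr_ge0//; nra.
apply: le_trans h2; rewrite -lee_fin.
have iuG' := integrable_fin_num measurableT iuG.
rewrite /sq2 fineK//.
apply: (@le_trans _ _ (\int[mu]_(x in `[(- n)%R, n]) ((2 * M)%:E * `|(u x - g j x)%:E|))%E); last first.
  have mabs : measurable_fun `[- n, n] (fun x => `|(u x - g j x)%:E|%E).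
    by have /integrableP[] := ijn.
  rewrite (ge0_integralZl mu mE mabs) ?lee_fin ?mulr_ge0//.
  by rewrite (EFinM (2 * M) d); apply: lee_wpmul2l; [rewrite lee_fin mulr_ge0|exact: ltW].
rewrite [leRHS]integral_mkcond; apply: ge0_le_integral => //.
- by move=> x _; rewrite lee_fin sqr_ge0.
- by have /integrableP[] := iuG.
- apply/(measurable_restrict _ mE measurableT); rewrite setTI.
  by apply: measurable_funeM; have /integrableP[] := ijn.
- move=> x _; rewrite patchE mem_setE in_itv /= -ler_norml.
  have [xn|xn] := ltP `|x| n; last first.
    rewrite u0// win_out// mul0r subr0 expr0n /=; case: ifP => // _.
    by rewrite lee_fin mulr_ge0// mulr_ge0.
  (* [u x] is its own clamp, so one factor of the square is at most [|u x - g j x|] by [clamp_dist]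
     and the other at most 2 M. *)
  rewrite (ltW xn) win_in// mul1r lee_fin -{1}(clamp_id (uM x)).
  rewrite -(real_normK (num_real (_ - _))) expr2.
  apply: ler_pM => //; last exact: clamp_dist.
  by apply: le_trans (ler_normB _ _) _; rewrite mulrDl mul1r lerD// clamp_le.
Qed.

(** Clamping at a large height [j] reduces to bounded functions. Two errors below e / 4 make up for
    the factor 2 of [sq2_triangle]. *)
Lemma real_poly_dense u n (e : R) : 0 < n -> 0 < e -> rL2 u ->
  (forall x, n <= `|x| -> u x = 0) ->
  exists p, sq2 (fun x => u x - win n x * p.[x]) < e.
Proof.
move=> n0 e0 u2 u0; have [mu_ iu] := u2; have e4 : 0 < e / 4 by rewrite divr_gt0.
have mclamp j : measurable_fun setT (fun x => clamp j%:R (u x)).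
  apply: measurableT_comp => //.
  by apply: continuous_measurable_fun; exact: continuous_clamp.
have clamp0 M : clamp M 0 = 0 by rewrite /clamp add0r sub0r normrN subrr mulr0.
have [j hj] : exists j, sq2 (fun x => u x - clamp j%:R (u x)) < e / 4.
  apply: (@cvg_sq2_eventually (fun j x => u x - clamp j%:R (u x))
    (fun x => u x ^+ 2) (e / 4) e4
    (fun j => measurable_funB mu_ (mclamp j)) iu).
- move=> j x; rewrite -(real_normK (num_real (_ - _))) -(real_normK (num_real (u x))).
  rewrite ler_pXn2r ?nnegrE//.
  by case: (ger0P (u x)) => h1; rewrite /clamp ler_norml;
    case: (ger0P (u x + j%:R)) => h2; case: (ger0P (u x - j%:R)) => h3;
    have := ler0n R j => h4; apply/andP; split; lra.
- move=> x; apply: cvg_near_cst; near=> j; apply/eqP; rewrite subr_eq0 eq_sym.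
  apply/eqP/clamp_id; near: j; exact: nbhs_infty_ger.
have mj : forall x, `|clamp j%:R (u x)| <= j%:R by move=> x; apply: clamp_le.
have u0j x : n <= `|x| -> clamp j%:R (u x) = 0 by move=> /u0 ->.
have [p hp] := bounded_poly_dense n0 e4 (mclamp j) u0j mj.
exists p; have c2 : rL2 (fun x => clamp j%:R (u x)) by exact: rL2_bounded (mclamp j) u0j mj.
by apply: le_lt_trans (sq2_triangle u2 c2 (rL2_win_horner n p)) _; lra.
Unshelve. all: by end_near. Qed.

Lemma poly_dense f n (e : R) : 0 < n -> 0 < e -> inL2 f ->
  (forall x, n <= `|x| -> f x = 0) ->
  exists p q, nrm2 (fun x => f x - (win n x * p.[x] +i* (win n x * q.[x]))) < e.
Proof.
move=> n0 e0 f2 f0; have e2 : 0 < e / 2 by rewrite divr_gt0.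
have /inL2P[[m1 m2] fi] := f2.
have R2 : rL2 (fun x => complex.Re (f x)).
  split=> //; apply: le_integrable fi => //.
    by apply/measurable_EFinP; exact: measurable_funX.
  by move=> x _; rewrite lee_fin !ger0_norm ?sqr_ge0// sqr_nc lerDl sqr_ge0.
have I2 : rL2 (fun x => complex.Im (f x)).
  split=> //; apply: le_integrable fi => //.
    by apply/measurable_EFinP; exact: measurable_funX.
  by move=> x _; rewrite lee_fin !ger0_norm ?sqr_ge0// sqr_nc lerDr sqr_ge0.
have [p hp] := real_poly_dense n0 e2 R2 (fun x xn => congr1 (@complex.Re R) (f0 x xn)).
have [q hq] := real_poly_dense n0 e2 I2 (fun x xn => congr1 (@complex.Im R) (f0 x xn)).
exists p, q; rewrite [ltLHS](_ : _ = sq2 (fun x => complex.Re (f x) - win n x * p.[x]) +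
  sq2 (fun x => complex.Im (f x) - win n x * q.[x])); first lra.
have [_ i1] := rL2B R2 (rL2_win_horner n p).
have [_ i2] := rL2B I2 (rL2_win_horner n q).
rewrite -RintegralD//; apply: eq_Rintegral => x _.
by rewrite sqr_nc !ReImE.
Qed.

End polynomial_density.

(** * Plancherel for compactly supported functions and the inversion estimate *)

Section plancherel_equality.
Local Open Scope complex_scope.
Local Open Scope ring_scope.
Variable R : realType.
Implicit Types (f g h y : R -> R[i]) (n B : R).

Local Notation l2 f := (Num.sqrt (nrm2 f)).

Lemma horner_lipschitz (p : {poly R}) n : exists2 L : R, 0 <= L &
  forall s t, `|s| < n -> `|t| < n -> `|p.[s] - p.[t]| <= L * `|s - t|.
Proof.
elim/poly_ind: p => [|p c [L L0 pL]].
  by exists 0 => // s t _ _; rewrite !horner0 subrr normr0 mul0r.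
have [C C0 pC] := horner_bounded p n.
exists (C + L * `|n|); first by rewrite addr_ge0 ?mulr_ge0.
move=> s t sn tn; rewrite !hornerE.
have -> : p.[s] * s + c - (p.[t] * t + c) = p.[s] * (s - t) + (p.[s] - p.[t]) * t by ring.
apply: le_trans (ler_normD _ _) _; rewrite [leRHS]mulrDl lerD// normrM.
  by apply: ler_wpM2r => //; exact: pC.
rewrite mulrAC; apply: ler_pM => //; first exact: pL.
exact: le_trans (ltW tn) (ler_norm _).
Qed.

Lemma FTB f g : cintg mu f -> cintg mu g ->
  FT (fun x => f x - g x) = (fun xi => FT f xi - FT g xi).
Proof.
move=> cf cg; apply/funext => xi; rewrite /FT -CintB; [|exact: cintg_FT|exact: cintg_FT].
by apply: eq_Cint => x; rewrite mulrBl.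
Qed.

Lemma le_eps2 (a b : R) : (forall e, 0 < e -> a <= b + 2 * e) -> a <= b.
Proof.
move=> h; apply/ler_addgt0Pr => e e0.
have e2 : 0 < e / 2 by rewrite divr_gt0.
by have := h _ e2; rewrite mulrCA mulfV// mulr1.
Qed.

(** Windowed polynomials are Lipschitz inside the window, so the lower bound holds for them; their
    density and the contractivity of [FT] carry it over to [f]. *)
Lemma nrm2_FT f n : 0 < n -> inL2 f -> (forall x, n <= `|x| -> f x = 0) ->
  nrm2 (FT f) = nrm2 f.
Proof.
move=> n0 f2 f0; have cf := inL2_supp_cintg f2 f0.
have [F2 Fle] := FT_inL2_le cf f2.
apply/eqP; rewrite eq_le Fle /=; rewrite -ler_sqrt ?nrm2_ge0//.
apply: le_eps2 => e e0; have e20 : 0 < e ^+ 2 by rewrite exprn_gt0.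
have [p [q hpq]] := poly_dense n0 e20 f2 f0.
pose g x : R[i] := win n x * p.[x] +i* (win n x * q.[x]).
have [Cp Cp0 pC] := horner_bounded p n; have [Cq Cq0 qC] := horner_bounded q n.
have [Lp Lp0 pL] := horner_lipschitz p n; have [Lq Lq0 qL] := horner_lipschitz q n.
have g0 x : n <= `|x| -> g x = 0 by move=> xn; rewrite /g win_out// !mul0r.
have gE x : `|x| < n -> g x = p.[x] +i* q.[x] by move=> xn; rewrite /g win_in// !mul1r.
have mg : cmeas g.
  by split; apply: measurable_funM; (exact: measurable_win || exact: measurable_horner).
have gM x : nc (g x) <= Cp + Cq.
  have [xn|/g0 ->] := ltP `|x| n; last by rewrite Normc.normc0 addr_ge0.
  by apply: le_trans (nc_le_ReIm _) _; rewrite gE//= lerD ?pC ?qC.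
have gL s t : `|s| < n -> `|t| < n -> nc (g s - g t) <= (Lp + Lq) * `|s - t|.
  move=> sn tn; apply: le_trans (nc_le_ReIm _) _.
  by rewrite !gE// mulrDl !ReImE /= lerD ?pL ?qL.
have g2 := bounded_supp_inL2 mg g0 gM; have cg := inL2_supp_cintg g2 g0.
have gF := lipschitz_nrm2_le_FT n0 mg g0 gM gL.
have fg2 := inL2B f2 g2.
have fg : l2 (fun x => f x - g x) <= e.
  by rewrite -(ger0_norm (ltW e0)) -sqrtr_sqr ler_sqrt ?ltW.
have [Fg2 _] := FT_inL2_le cg g2.
have [Ffg2 Ffg] := FT_inL2_le (cintgB cf cg) fg2.
have h1 : l2 f <= l2 (fun x => f x - g x) + l2 g.
  have := l2D fg2 g2; by under eq_fun do rewrite subrK.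
have h2 : l2 g <= l2 (FT g) by rewrite ler_sqrt ?nrm2_ge0.
have h3 : l2 (FT g) <= l2 (FT f) + l2 (FT (fun x => f x - g x)).
  have := l2D F2 (inL2N Ffg2); rewrite nrm2N FTB//.
  by under eq_fun do rewrite opprB addrC subrK.
have h4 : l2 (FT (fun x => f x - g x)) <= l2 (fun x => f x - g x).
  by rewrite ler_sqrt ?nrm2_ge0.
apply: (le_trans h1); apply: (le_trans (lerD fg (le_trans h2 h3))).
by rewrite addrCA mulr_natl mulr2n lerD2l lerD2l; exact: le_trans h4 fg.
Qed.

Definition IFT h (x : R) : R[i] := Cint mu (fun xi => h xi * cis (2 * pi * x * xi)).

Lemma IFTE h : cintg mu h -> IFT h = (fun x => (FT (fun xi => (h xi)^*) x)^*).
Proof.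
move=> ch; apply/funext => x; rewrite -CintJ; last by apply: cintg_FT; exact: cintgJ.
apply: eq_Cint => xi; rewrite conjcM -cisN opprK.
have -> : (h xi)^*^* = h xi by exact: conjcK.
by congr (_ * cis _); ring.
Qed.

Lemma IFT_inL2_le h : cintg mu h -> inL2 h -> inL2 (IFT h) /\ nrm2 (IFT h) <= nrm2 h.
Proof.
move=> ch h2; rewrite IFTE//; have [F2 Fle] := FT_inL2_le (cintgJ ch) (inL2J h2).
by split; [exact: inL2J|rewrite nrm2J -(nrm2J h)].
Qed.

Lemma inner_IFT h f : cintg mu h -> cintg mu f -> inner (IFT h) f = inner h (FT f).
Proof.
move=> ch cf.
pose K (z : R * R) : R[i] := h z.2 * cis (2 * pi * z.1 * z.2) * (f z.1)^*.
have mK : cmeas K.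
  apply: cmeasM.
    apply: cmeasM; first exact: (cmeas_comp measurable_snd (cintg_meas ch)).
    by apply: cmeas_cis; apply: measurable_funM => //; exact: measurable_funM.
  by apply: cmeasJ; exact: (cmeas_comp measurable_fst (cintg_meas cf)).
have Kab (x xi : R) : nc (K (x, xi)) <= nc (f x) * nc (h xi).
  by rewrite /K !Normc.normcM nc_cis mulr1 ncJ mulrC.
transitivity (Cint mu (fun x => Cint mu (fun xi => K (x, xi)))).
  apply: eq_Cint => x; rewrite mulrC -CintZ.
    by apply: eq_Cint => xi; rewrite mulrC.
  by apply: cintg_phase => //; exact: measurable_funM.
rewrite (cdom_fubini (cintg_nc cf) (cintg_nc ch) mK Kab).
apply: eq_Cint => xi; rewrite -CintJ; last exact: cintg_FT.
rewrite -CintZ; last by apply: cintgJ; exact: cintg_FT.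
apply: eq_Cint => x; rewrite conjcM -cisN opprK /K /=.
by rewrite -mulrA (mulrC (cis _)).
Qed.

(** The substitute for Fourier inversion. When both squares are expanded, the cross terms agree by
    adjointness, [f] and [FT f] have equal norms by Plancherel, and [IFT] does not increase the norm
    of [h]. *)
Lemma nrm2_IFT_sub h f B n : 0 < n -> inL2 h -> inL2 f ->
  (forall x, B <= `|x| -> h x = 0) -> (forall x, n <= `|x| -> f x = 0) ->
  nrm2 (fun x => IFT h x - f x) <= nrm2 (fun xi => h xi - FT f xi).
Proof.
move=> n0 h2 f2 h0 f0.
have ch := inL2_supp_cintg h2 h0; have cf := inL2_supp_cintg f2 f0.
have [I2 Ile] := IFT_inL2_le ch h2; have [F2 _] := FT_inL2_le cf f2.
by rewrite !nrm2B// inner_IFT// (nrm2_FT n0 f2 f0) lerD2r lerD2r.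
Qed.

(** The interval is closed, to agree with [truncated_fourier]; this is why [trunc_supp] has the
    radius [n.+1]. *)
Definition trunc (n : nat) y (x : R) : R[i] := if `|x| <= n%:R then y x else 0.

Lemma trunc_supp (n : nat) y (x : R) : n.+1%:R <= `|x| -> trunc n y x = 0.
Proof.
move=> xn; rewrite /trunc leNgt (lt_le_trans _ xn) ?ltr_nat//.
Qed.

Lemma nc_trunc_le (n : nat) y (x : R) : nc (trunc n y x) <= nc (y x).
Proof. by rewrite /trunc; case: ifP => // _; rewrite Normc.normc0 nc_ge0. Qed.

Lemma truncE (n : nat) y : trunc n y = (fun x => (\1_(`[- n%:R, n%:R]%classic : set R) x)%:C * y x).
Proof.
apply/funext => x; rewrite indicE mem_setE in_itv /= -ler_norml /trunc.
by case: (_ <= _); rewrite ?mul1r ?mul0r.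
Qed.

Lemma cmeas_trunc (n : nat) y : cmeas y -> cmeas (trunc n y).
Proof.
by move=> my; rewrite truncE; apply: cmeasM => //; apply: cmeas_real; exact: measurable_indic.
Qed.

Lemma inL2_trunc (n : nat) y : inL2 y -> inL2 (trunc n y).
Proof.
move=> y2; apply: le_inL2 (y2) (nc_trunc_le n y).
exact: cmeas_trunc (inL2_meas y2).
Qed.

Lemma FT_trunc (n : nat) y : FT (trunc n y) = truncated_fourier n y.
Proof.
have E (x xi : R) (h : R[i] -> R) : h 0 = 0 ->
    h (trunc n y x * cis (- (2 * pi * x * xi))) =
    ((fun x => h (y x * cis (- (2 * pi * x * xi)))) \_ `[- n%:R, n%:R]%classic) x.
  move=> h0; rewrite patchE mem_setE in_itv /= -ler_norml /trunc.
  by case: ifP => // _; rewrite mul0r.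
have EI xi (h : R[i] -> R) : h 0 = 0 ->
    Rintegral mu setT (fun x => h (trunc n y x * cis (- (2 * pi * x * xi)))) =
    Rintegral mu `[- n%:R, n%:R]%classic (fun x => h (y x * cis (- (2 * pi * x * xi)))).
  by move=> h0; rewrite [RHS]Rintegral_mkcond; apply: eq_Rintegral => x _; exact: E.
by apply/funext => xi; apply: ReIm_inj;
  [exact: (EI xi (@complex.Re R))|exact: (EI xi (@complex.Im R))].
Qed.

Lemma trunc_dist y (e : R) : 0 < e -> inL2 y ->
  exists N : nat, forall n : nat, (N <= n)%N -> l2 (fun x => y x - trunc n y x) < e.
Proof.
move=> e0 y2; have /inL2P[my iy] := y2.
have H : (fun n : nat => \int[mu]_x (nc (y x - trunc n y x) ^+ 2)%:E)%E @ \oo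
    --> (\int[mu]_x (0 : R)%:E)%E.
  apply: (@dominated_cvg _ _ _ mu setT measurableT _ _ (fun x => (nc (y x) ^+ 2)%:E)) => //.
  - move=> n; apply/measurable_EFinP; apply: measurable_nc2.
    by apply: cmeasB => //; exact: cmeas_trunc.
  - move=> x _; apply: cvg_near_cst; near=> n.
    have -> : trunc n y x = y x by rewrite /trunc ifT//; near: n; exact: nbhs_infty_ger.
    by rewrite subrr Normc.normc0 expr0n.
  - move=> n x _; rewrite lee_fin ger0_norm ?sqr_ge0// ler_pXn2r ?nnegrE ?nc_ge0//.
    by rewrite /trunc; case: ifP => _; rewrite ?subrr ?subr0 ?Normc.normc0 ?nc_ge0.
rewrite integral0 in H; have e20 : 0 < e ^+ 2 by rewrite exprn_gt0.
have h0 : (fun n : nat => nrm2 (fun x => y x - trunc n y x)) @ \oo --> (0 : R).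
  exact: fine_cvg H.
have [N _ hN] := (cvgrPdist_lt (V := R^o)
  (fun n : nat => nrm2 (fun x => y x - trunc n y x)) 0).1 h0 _ e20.
exists N => n /hN /=; rewrite sub0r normrN ger0_norm ?nrm2_ge0// => h.
by rewrite -(ger0_norm (ltW e0)) -sqrtr_sqr ltr_sqrt.
Unshelve. all: by end_near. Qed.

(** The estimate [nrm2_IFT_sub] for truncations passes to the limit: [trunc n y] tends to [y] in
    L^2, and its transform tends to [yhat] by the very definition of [is_fourier]. Each convergence
    costs one [e]. *)
Lemma l2_IFT_sub h y yhat B : inL2 h -> (forall x, B <= `|x| -> h x = 0) ->
  inL2 y -> is_fourier y yhat ->
  l2 (fun x => IFT h x - y x) <= l2 (fun xi => h xi - yhat xi).
Proof.
move=> h2 h0 y2 [yh2 cv]; have ch := inL2_supp_cintg h2 h0.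
have [I2 _] := IFT_inL2_le ch h2.
apply: le_eps2 => e e0; have [N1 hN1] := trunc_dist e0 y2.
have T2 (n : nat) := inL2_trunc n y2.
have cT (n : nat) := inL2_supp_cintg (T2 n) (@trunc_supp n y).
have F2 (n : nat) := (FT_inL2_le (cT n) (T2 n)).1.
have D2 (n : nat) := inL2B (F2 n) yh2.
have cv' : (fun n : nat => l2 (fun xi => FT (trunc n y) xi - yhat xi)) @ \oo --> (0 : R).
  suff : (fun n : nat => (l2 (fun xi => FT (trunc n y) xi - yhat xi))%:E) @ \oo --> 0%:E.
    by move=> H; exact: (fine_cvg H).
  by under eq_fun do rewrite -L2norm_nrm2// FT_trunc.
have [N2 _ hN2] := (cvgrPdist_lt (V := R^o)
  (fun n : nat => l2 (fun xi => FT (trunc n y) xi - yhat xi)) 0).1 cv' _ e0.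
pose n := maxn N1 N2; have /= := hN2 n (leq_maxr _ _).
rewrite sub0r normrN ger0_norm ?sqrtr_ge0// => hn2; have hn1 := hN1 n (leq_maxl _ _).
have k1 := l2B I2 (T2 n) y2.
have k3 := l2B h2 yh2 (F2 n).
have k4 : l2 (fun x => trunc n y x - y x) = l2 (fun x => y x - trunc n y x).
  by rewrite -nrm2N; under eq_fun do rewrite opprB.
have k5 : l2 (fun x => yhat x - FT (trunc n y) x) = l2 (fun x => FT (trunc n y) x - yhat x).
  by rewrite -nrm2N; under eq_fun do rewrite opprB.
have k6 : l2 (fun x => IFT h x - trunc n y x) <= l2 (fun xi => h xi - FT (trunc n y) xi).
  rewrite ler_sqrt ?nrm2_ge0//.
  exact: (nrm2_IFT_sub (ltr0Sn R n) h2 (T2 n) h0 (@trunc_supp n y)).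
rewrite k4 in k1; rewrite k5 in k3.
apply: (le_trans k1); apply: (le_trans (lerD (le_trans k6 k3) (ltW hn1))).
by rewrite mulr_natl mulr2n addrA lerD2r lerD2l ltW.
Qed.

(** Supplies a transform where none is given, as in the bare existence of B. The sequence of
    truncated transforms is constant from index [n] on. *)
Lemma is_fourier_trunc (n : nat) y : inL2 y -> is_fourier (trunc n y) (FT (trunc n y)).
Proof.
move=> y2; have T2 := inL2_trunc n y2.
have cT := inL2_supp_cintg T2 (@trunc_supp n y).
split; first exact: (FT_inL2_le cT T2).1.
apply: cvg_near_cst; near=> m.
have nm : (n <= m)%N by near: m; exact: nbhs_infty_ge.
have -> : (fun xi => truncated_fourier m (trunc n y) xi - FT (trunc n y) xi) = cst 0.
  apply/funext => xi; rewrite -FT_trunc.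
  have -> : trunc m (trunc n y) = trunc n y; last by rewrite subrr.
  apply/funext => x; rewrite {1}/trunc; case: ifPn => // xm.
  by rewrite /trunc ifN//; apply: contra xm => /le_trans; apply; rewrite ler_nat.
rewrite L2normE; under eq_integral do rewrite Normc.normc0 expr0n /=.
by rewrite integral0 poweR0r// invr_neq0.
Unshelve. all: by end_near. Qed.

End plancherel_equality.

(** * Density of transforms of short kernels *)

Section kernel_density.
Local Open Scope complex_scope.
Local Open Scope ring_scope.
Variable R : realType.
Implicit Types (f g k : R -> R[i]) (a e u : R).

Lemma cos_sub1_le u : `|cos u - 1| <= `|u|.
Proof.
wlog u0 : u / 0 <= u => [h|].
  have [/h//|u0] := leP 0 u; have := h (- u); rewrite cosN normrN; apply.
  by rewrite oppr_ge0 ltW.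
have cc : {within `[0, u], continuous (@cos R)}.
  by apply: continuous_subspaceT; exact: continuous_cos.
have [c _] := MVT_segment u0 (fun x _ => is_derive_cos x) cc.
rewrite cos0 subr0 => ->; rewrite normrM normrN -[leRHS]mul1r ler_wpM2r//.
by rewrite ler_norml sin_geN1 sin_le1.
Qed.

Lemma sin_le_norm u : `|sin u| <= `|u|.
Proof.
wlog u0 : u / 0 <= u => [h|].
  have [/h//|u0] := leP 0 u; have := h (- u); rewrite sinN !normrN; apply.
  by rewrite oppr_ge0 ltW.
have cc : {within `[0, u], continuous (@sin R)}.
  by apply: continuous_subspaceT; exact: continuous_sin.
have [c _] := MVT_segment u0 (fun x _ => is_derive_sin x) cc.
rewrite sin0 !subr0 => ->; rewrite normrM -[leRHS]mul1r ler_wpM2r//.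
by rewrite ler_norml cos_geN1 cos_le1.
Qed.

(** The error of a symmetric difference quotient: divided by the step size it still leaves one power
    of the step. *)
Lemma sin_sub_le u : `|sin u - u| <= u ^+ 2.
Proof.
wlog u0 : u / 0 <= u => [h|].
  have [/h//|u0] := leP 0 u; have := h (- u).
  by rewrite sinN -opprD normrN sqrrN; apply; rewrite oppr_ge0 ltW.
have cc : {within `[0, u], continuous (@sin R)}.
  by apply: continuous_subspaceT; exact: continuous_sin.
have [c] := MVT_segment u0 (fun x _ => is_derive_sin x) cc.
rewrite in_itv /= => /andP[c0 cu]; rewrite sin0 !subr0 => ->.
have -> : cos c * u - u = (cos c - 1) * u by ring.
rewrite normrM expr2 (ger0_norm u0) ler_wpM2r//.
by apply: le_trans (cos_sub1_le c) _; rewrite ger0_norm.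
Qed.

Lemma nc_cis_sub1 u : nc (cis u - 1) <= 2 * `|u|.
Proof.
apply: le_trans (nc_le_ReIm _) _; rewrite !ReImE /= subr0.
by have := cos_sub1_le u; have := sin_le_norm u; lra.
Qed.

Record kernel_on a k : Prop := {
  kernel_meas : cmeas k ;
  kernel_supp : forall t, a <= `|t| -> k t = 0 ;
  kernel_bounded : exists M, forall t, nc (k t) <= M }.

Lemma kernel_cintg a k : kernel_on a k -> cintg mu k.
Proof. by move=> [mk k0 [M kM]]; exact: bounded_supp_cintg mk k0 kM. Qed.

Lemma kernel_inL2 a k : kernel_on a k -> inL2 k.
Proof. by move=> [mk k0 [M kM]]; exact: bounded_supp_inL2 mk k0 kM. Qed.

Lemma kernelD a k l : kernel_on a k -> kernel_on a l ->
  kernel_on a (fun t => k t + l t).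
Proof.
move=> [mk k0 [M kM]] [ml l0 [N lN]]; split.
- exact: cmeasD.
- by move=> t ta; rewrite k0// l0// addr0.
- by exists (M + N) => t; apply: le_trans (ncD _ _) _; rewrite lerD.
Qed.

Lemma kernelZ a (c : R[i]) k : kernel_on a k -> kernel_on a (fun t => c * k t).
Proof.
move=> [mk k0 [M kM]]; split.
- by apply: cmeasM => //; exact: cmeas_cst.
- by move=> t ta; rewrite k0// mulr0.
- by exists (nc c * M) => t; rewrite Normc.normcM ler_wpM2l// nc_ge0.
Qed.

Lemma cmeas_shift (s : R) f : cmeas f -> cmeas (fun t : R => f (t + s)).
Proof.
have ms : measurable_fun setT (fun t : R => t + s) by exact: measurable_funD.
by move=> [f1 f2]; split; [exact: (measurableT_comp f1 ms)|exact: (measurableT_comp f2 ms)].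
Qed.

Lemma kernel_shift a (b s : R) k : `|s| <= b -> kernel_on a k ->
  kernel_on (a + b) (fun t : R => k (t + s)).
Proof.
move=> sb [mk k0 [M kM]]; split; first exact: cmeas_shift.
- move=> t tab; apply: k0; have := ler_normB (t + s) s; rewrite addrK; lra.
- by exists M.
Qed.

Lemma FTD f g xi : cintg mu f -> cintg mu g ->
  FT (fun x => f x + g x) xi = FT f xi + FT g xi.
Proof.
move=> cf cg; rewrite /FT -CintD; [|exact: cintg_FT|exact: cintg_FT].
by apply: eq_Cint => x; rewrite mulrDl.
Qed.

Lemma FTZ (c : R[i]) f xi : cintg mu f -> FT (fun x => c * f x) xi = c * FT f xi.
Proof.
move=> cf; rewrite /FT -CintZ; last exact: cintg_FT.
by apply: eq_Cint => x; rewrite mulrA.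
Qed.

Lemma FT_shift (s : R) f (xi : R) : cintg mu f ->
  FT (fun t : R => f (t + s)) xi = cis (2 * pi * s * xi) * FT f xi.
Proof.
move=> cf; pose g (t : R) := cis (2 * pi * s * xi) * (f t * cis (- (2 * pi * t * xi))).
have mg : cmeas g.
  by apply: cmeasM; [exact: cmeas_cst|exact: (cintg_meas (cintg_FT xi cf))].
rewrite -CintZ; last exact: cintg_FT.
rewrite -[RHS](Cint_shift s mg); apply: eq_Cint => t; rewrite /g mulrCA; congr (_ * _).
by rewrite -cisD; congr cis; ring.
Qed.

(** The support radius [a] is quantified inside: multiplication by xi shifts a kernel of radius a /
    2 by up to a / 2, so the induction on polynomials needs approximants of every radius. *)
Definition FT_approximable (B : R) g : Prop := forall a e, 0 < a -> 0 < e ->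
  exists2 k, kernel_on a k &
    forall xi, `|xi| < B -> nc (FT k xi - g xi) <= e.

Lemma FT_approximableD B f g : FT_approximable B f -> FT_approximable B g ->
  FT_approximable B (fun xi => f xi + g xi).
Proof.
move=> Af Ag a e a0 e0; have e2 : 0 < e / 2 by rewrite divr_gt0.
have [k kk hk] := Af _ _ a0 e2; have [l ll hl] := Ag _ _ a0 e2.
exists (fun t => k t + l t); first exact: kernelD.
move=> xi xiB; rewrite FTD; [|exact: kernel_cintg kk|exact: kernel_cintg ll].
rewrite opprD addrACA; apply: le_trans (ncD _ _) _.
by have := hk _ xiB; have := hl _ xiB; lra.
Qed.

Lemma FT_approximableZ B (c : R[i]) f : FT_approximable B f ->
  FT_approximable B (fun xi => c * f xi).
Proof.
move=> Af a e a0 e0; have c0 := nc_ge0 c.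
have e2 : 0 < e / (nc c + 1) by rewrite divr_gt0// ltr_wpDl.
have [k kk hk] := Af _ _ a0 e2.
exists (fun t => c * k t); first exact: kernelZ.
move=> xi xiB; rewrite FTZ; last exact: kernel_cintg kk.
rewrite -mulrBr Normc.normcM; apply: le_trans (ler_wpM2l c0 (hk _ xiB)) _.
by rewrite mulrA ler_pdivrMr ?ltr_wpDl//; nra.
Qed.

Lemma Cint_win (s : R) : 0 < s -> Cint mu (fun t : R => (win s t)%:C : R[i]) = (2 * s)%:C.
Proof.
move=> s0; apply: ReIm_inj => /=.
- under eq_Rintegral do rewrite -[win _ _]mulr1.
  rewrite Rintegral_win Rintegral_cst//= lebesgue_measure_itv /= lte_fin.
  by rewrite ifT ?gtrN//= mul1r; ring.
- by rewrite /Rintegral integral0.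
Qed.

Lemma FT_approximable1 B : 0 < B -> FT_approximable B (cst 1).
Proof.
(* The kernel is the normalised indicator of a window of radius [s], an approximate identity. The
   phases satisfy |2 pi t xi| <= 2 pi s B, so by [nc_cis_sub1] the error is at most 4 pi B s = C
   s. *)
move=> B0 a e a0 e0; pose C : R := 4 * pi * B.
have C0 : 0 < C by rewrite !mulr_gt0// pi_gt0.
pose s := Num.min a (e / C).
have s0 : 0 < s by rewrite lt_min a0 divr_gt0.
have sa : s <= a by rewrite ge_min lexx.
have sC : C * s <= e.
  by rewrite mulrC -ler_pdivlMr// ge_min lexx orbT.
pose k t : R[i] := ((2 * s)^-1)%:C * (win s t)%:C.
have s20 : 0 < 2 * s by rewrite mulr_gt0.
have kk : kernel_on a k.
  split.
  - by apply: cmeasM; [exact: cmeas_cst|apply: cmeas_real; exact: measurable_win].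
  - by move=> t ta; rewrite /k win_out ?mulr0// (le_trans sa).
  - exists (2 * s)^-1 => t; rewrite Normc.normcM !ncR ger0_norm ?invr_ge0 ?(ltW s20)//.
    by rewrite ger0_norm ?win_ge0// ler_piMr ?win_le1// invr_ge0 ltW.
exists k => // xi xiB; have ck := kernel_cintg kk.
have cw : cintg mu (fun t => (win s t)%:C : R[i]).
  apply: (@bounded_supp_cintg _ _ s 1).
  - by apply: cmeas_real; exact: measurable_win.
  - by move=> t ts; rewrite win_out.
  - by move=> t; rewrite ncR ger0_norm ?win_ge0 ?win_le1.
have -> : cst 1 xi = Cint mu k.
  by rewrite CintZ// Cint_win// -rmorphM mulVf// gt_eqF.
rewrite /FT -CintB//; last exact: cintg_FT.
have cI : cintg mu (fun x => k x * cis (- (2 * pi * x * xi)) - k x).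
  by apply: cintgB => //; exact: cintg_FT.
apply: le_trans (le_nc_Cint cI) _; apply: (le_trans _ sC).
have -> : C * s = Rintegral mu setT (fun t => (2 * s)^-1 * (C * s) * win s t).
  rewrite RintegralZl; [|exact: measurableT|exact: integrable_win].
  have /(congr1 (@complex.Re R)) /= -> := Cint_win s0.
  by field; rewrite gt_eqF.
apply: le_Rintegral; [exact: measurableT|exact: cintg_nc| |].
  by apply: rintgZ; exact: integrable_win.
move=> t _; have -> : k t * cis (- (2 * pi * t * xi)) - k t = k t * (cis (- (2 * pi * t * xi)) - 1) by ring.
have [ts|ts] := ltP `|t| s; last first.
  by rewrite /k win_out// mulr0 mul0r Normc.normc0 mulr0.
rewrite Normc.normcM /k win_in// mulr1 ncR mulr1 ger0_norm ?invr_ge0 ?(ltW s20)//.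
rewrite ler_wpM2l ?invr_ge0 ?(ltW s20)//; apply: le_trans (nc_cis_sub1 _) _.
rewrite normrN !normrM (ger0_norm (ltW (pi_gt0 R))) (ger0_norm (_ : 0 <= 2))//.
have -> : C * s = 2 * (2 * pi * s * B) by rewrite /C; ring.
rewrite ler_wpM2l// ler_pM ?mulr_ge0 ?(ltW (pi_gt0 R))// ?(ltW xiB)//.
by rewrite ler_wpM2l ?mulr_ge0 ?(ltW (pi_gt0 R))// ltW.
Qed.

(* Multiplication by [xi] is the limit of symmetric difference quotients of the kernel. *)
Lemma FT_approximableX B (C : R) g : 0 < B -> (forall xi, `|xi| < B -> nc (g xi) <= C) ->
  FT_approximable B g -> FT_approximable B (fun xi => xi%:C * g xi).
Proof.
move=> B0 gC Ag a e a0 e0; have p0 := pi_gt0 R.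
have C0 : 0 <= C by apply: le_trans (gC 0 _); rewrite ?nc_ge0// normr0.
(* The error will be split as (S - xi) FT k + xi (FT k - g). The first part is at most 2 pi h B^2 (C
   + e1) = h D and the second at most B e1; [e1], [D] and [h] make each at most e / 2. *)
pose e1 := e / (2 * B); have e10 : 0 < e1 by rewrite divr_gt0// mulr_gt0.
have a20 : 0 < a / 2 by rewrite divr_gt0.
have [k kk hk] := Ag _ _ a20 e10; have ck := kernel_cintg kk.
pose D := 2 * pi * B ^+ 2 * (C + e1).
have D0 : 0 < D by rewrite !mulr_gt0 ?exprn_gt0// ltr_wpDl.
pose h := Num.min (a / 2) (e / 2 / D).
have h0 : 0 < h by rewrite lt_min a20 !divr_gt0.
have ha : h <= a / 2 by rewrite ge_min lexx.
have hD : h * D <= e / 2 by rewrite -ler_pdivlMr// ge_min lexx orbT.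
(* This is 1 / (4 pi i h). The transform of k(t + h) - k(t - h) is 2 i sin(2 pi h xi) FT k, so the
   resulting factor is [S] = sin(2 pi h xi) / (2 pi h), which is close to xi. *)
pose c : R[i] := 0 -i* (4 * pi * h)^-1.
have kh (s : R) : `|s| = h -> kernel_on a (fun t : R => k (t + s)).
  by move=> sh; have := kernel_shift (b := a / 2) (s := s) _ kk; rewrite -splitr sh; apply.
have kp : kernel_on a (fun t : R => k (t + h)) by apply: kh; rewrite gtr0_norm.
have km : kernel_on a (fun t : R => k (t + - h)) by apply: kh; rewrite normrN gtr0_norm.
exists (fun t => c * (k (t + h) + (-1) * k (t + - h))).
  by apply: kernelZ; apply: kernelD => //; exact: kernelZ.
move=> xi xiB; have ckm := kernel_cintg (kernelZ (-1) km).
rewrite FTZ; last exact: kernel_cintg (kernelD kp (kernelZ (-1) km)).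
rewrite FTD; [|exact: kernel_cintg kp|exact: ckm].
rewrite FTZ; last exact: kernel_cintg km.
rewrite !FT_shift// !mulNr mul1r.
pose S := sin (2 * pi * h * xi) / (2 * pi * h).
have -> : c * (cis (2 * pi * h * xi) * FT k xi - cis (2 * pi * - h * xi) * FT k xi) =
    S%:C * FT k xi.
  rewrite -mulrBl mulrA; congr (_ * _).
  have -> : 2 * pi * - h * xi = - (2 * pi * h * xi) by ring.
  rewrite /S /c; move: (2 * pi * h * xi) => w; move: (pi : R) p0 => p p0.
  rewrite cisN; apply: ReIm_inj; rewrite !ReImE /=.
    by field; rewrite !gt_eqF.
  by ring.
have Sxi : `|S - xi| <= 2 * pi * h * B ^+ 2.
  have w0 : 0 < 2 * pi * h by rewrite !mulr_gt0.
  have -> : S - xi = (sin (2 * pi * h * xi) - 2 * pi * h * xi) / (2 * pi * h).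
    by rewrite /S; move: (2 * pi * h) w0 => w w0; field; rewrite gt_eqF.
  rewrite normrM normfV (gtr0_norm w0) ler_pdivrMr//.
  apply: le_trans (sin_sub_le _) _; rewrite exprMn.
  have : xi ^+ 2 <= B ^+ 2.
    by rewrite -(real_normK (num_real xi)) ler_pXn2r ?nnegrE ?(ltW B0)// ltW.
  by move: (2 * pi * h) w0 => w w0 xB; have := ler_wpM2l (sqr_ge0 w) xB; nra.
have -> : S%:C * FT k xi - xi%:C * g xi =
    (S - xi)%:C * FT k xi + xi%:C * (FT k xi - g xi).
  by rewrite rmorphB; ring.
apply: le_trans (ncD _ _) _; rewrite !Normc.normcM !ncR.
have Fk : nc (FT k xi) <= C + e1.
  have -> : FT k xi = g xi + (FT k xi - g xi) by rewrite addrC subrK.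
  by apply: le_trans (ncD _ _) _; rewrite lerD ?gC ?hk.
have t1 : `|S - xi| * nc (FT k xi) <= e / 2.
  apply: le_trans hD; have -> : h * D = 2 * pi * h * B ^+ 2 * (C + e1) by rewrite /D; ring.
  by apply: ler_pM => //; exact: nc_ge0.
have t2 : `|xi| * nc (FT k xi - g xi) <= e / 2.
  have -> : e / 2 = B * e1 by rewrite /e1; field; rewrite gt_eqF.
  by apply: ler_pM => //; [exact: nc_ge0|exact: ltW|exact: hk].
lra.
Qed.

Lemma FT_approximable_horner B (p : {poly R}) : 0 < B ->
  FT_approximable B (fun xi => (p.[xi])%:C).
Proof.
move=> B0; elim/poly_ind: p => [|p c IH].
  rewrite (_ : (fun xi => _) = (fun xi : R => 0 * cst (1 : R[i]) xi)).
    exact: FT_approximableZ (FT_approximable1 B0).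
  by apply/funext => xi; rewrite horner0 mul0r.
have [C _ pC] := horner_bounded p B.
rewrite (_ : (fun xi => _) =
    (fun xi : R => xi%:C * (p.[xi])%:C + c%:C * cst (1 : R[i]) xi)).
  apply: FT_approximableD; last exact: FT_approximableZ (FT_approximable1 B0).
  by apply: (@FT_approximableX B C) => // xi xiB; rewrite ncR pC.
apply/funext => xi; have -> : cst (1 : R[i]) xi = 1 by [].
by rewrite mulr1 !hornerE rmorphD rmorphM mulrC.
Qed.

Lemma FT_kernel_dense f B a e : 0 < B -> 0 < a -> 0 < e -> inL2 f ->
  (forall x, B <= `|x| -> f x = 0) ->
  exists2 k, kernel_on a k &
    nrm2 (fun xi => (win B xi)%:C * FT k xi - f xi) < e.
Proof.
move=> B0 a0 e0 f2 f0; pose d := Num.sqrt e / 2.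
have d0 : 0 < d by rewrite divr_gt0// sqrtr_gt0.
have d20 : 0 < d ^+ 2 by rewrite exprn_gt0.
have [p [q hpq]] := poly_dense B0 d20 f2 f0.
pose P xi : R[i] := (p.[xi])%:C + 'i%C * (q.[xi])%:C.
have AP : FT_approximable B P.
  apply: FT_approximableD; first exact: FT_approximable_horner.
  by apply: FT_approximableZ; exact: FT_approximable_horner.
(* A uniform error [r] on an interval of length 2 B costs r sqrt(2 B) = d in L^2. The polynomial
   approximation costs another [d], and d + d is the square root of [e]. *)
pose r := d / Num.sqrt (2 * B).
have B20 : 0 < Num.sqrt (2 * B) by rewrite sqrtr_gt0 mulr_gt0.
have r0 : 0 < r by rewrite divr_gt0.
have [k kk hk] := AP _ _ a0 r0; exists k => //; have ck := kernel_cintg kk.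
pose w xi : R[i] := (win B xi)%:C.
have mw : cmeas w by apply: cmeas_real; exact: measurable_win.
have [Cp Cp0 pC] := horner_bounded p B; have [Cq Cq0 qC] := horner_bounded q B.
have mP : cmeas P.
  apply: cmeasD; first by apply: cmeas_real; exact: measurable_horner.
  apply: cmeasM; first exact: cmeas_cst.
  by apply: cmeas_real; exact: measurable_horner.
have wP2 : inL2 (fun xi => w xi * P xi).
  apply: (@bounded_supp_inL2 _ _ B (Cp + Cq)); first exact: cmeasM.
  - by move=> x xB; rewrite /w win_out// mul0r.
  - move=> x; have [xB|xB] := ltP `|x| B; last by rewrite /w win_out// mul0r Normc.normc0 addr_ge0.
    rewrite /w win_in// mul1r; apply: le_trans (ncD _ _) _.
    rewrite Normc.normcM !ncR /= expr0n add0r expr1n sqrtr1 mul1r.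
    by rewrite lerD ?pC ?qC.
have wF2 : inL2 (fun xi => w xi * FT k xi).
  apply: (@bounded_supp_inL2 _ _ B (Rintegral mu setT (fun x => nc (k x)))).
  - by apply: cmeasM => //; exact: cmeas_FT.
  - by move=> x xB; rewrite /w win_out// mul0r.
  - move=> x; rewrite Normc.normcM ncR ger0_norm ?win_ge0//.
    by apply: le_trans (le_nc_FT x ck); rewrite ler_piMl ?nc_ge0// win_le1.
have eE : (d + d) ^+ 2 = e by rewrite /d -splitr sqr_sqrtr// ltW.
rewrite -[ltRHS]eE.
rewrite -ltr_sqrt ?exprn_gt0 ?addr_gt0// sqrtr_sqr ger0_norm ?addr_ge0 ?(ltW d0)//.
apply: le_lt_trans (l2B wF2 wP2 f2) _.
apply: ler_ltD.
- have -> : d = Num.sqrt (r ^+ 2 * (2 * B)).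
    rewrite sqrtrM ?sqr_ge0// sqrtr_sqr ger0_norm ?(ltW r0)//.
    by rewrite /r divfK// gt_eqF.
  rewrite ler_sqrt ?mulr_ge0 ?sqr_ge0 ?(ltW B0)//.
  have -> : r ^+ 2 * (2 * B) = Rintegral mu setT (fun xi => r ^+ 2 * win B xi).
    rewrite RintegralZl; [|exact: measurableT|exact: integrable_win].
    by have /(congr1 (@complex.Re R)) /= -> := Cint_win B0.
  have /inL2P[_ iD] := inL2B wF2 wP2.
  apply: le_Rintegral; [exact: measurableT|exact: iD| |].
    by apply: rintgZ; exact: integrable_win.
  move=> xi _; rewrite -mulrBr Normc.normcM ncR exprMn.
  have [xB|xB] := ltP `|xi| B; last by rewrite win_out// normr0 expr0n mul0r mulr0.
  rewrite win_in// normr1 expr1n mul1r mulr1 ler_pXn2r ?nnegrE ?nc_ge0 ?(ltW r0)//.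
  exact: hk.
- rewrite -(ger0_norm (ltW d0)) -sqrtr_sqr ltr_sqrt//; apply: le_lt_trans hpq.
  rewrite -nrm2N le_eqVlt; apply/orP; left; apply/eqP; congr nrm2.
  apply/funext => xi; rewrite opprB /w /P; congr (_ - _).
  by apply: ReIm_inj; rewrite !ReImE /=; ring.
Qed.

End kernel_density.

(** * The Hilbert-Schmidt operator *)

Section bessel.
Local Open Scope complex_scope.
Local Open Scope ring_scope.
Variable R : realType.
Implicit Types (f g h : R -> R[i]).

Lemma innerC f g : inL2 f -> inL2 g -> inner g f = (inner f g)^*.
Proof.
move=> f2 g2; rewrite -[inner f g]/(Cint mu _) -CintJ; last exact: cintg_L2MJ.
apply: eq_Cint => x; rewrite conjcM mulrC.
by have -> : (g x)^*^* = g x by exact: conjcK.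
Qed.

Lemma innerB f g h : inL2 f -> inL2 g -> inL2 h ->
  inner f (fun x => g x - h x) = inner f g - inner f h.
Proof.
move=> f2 g2 h2; rewrite -[RHS]CintB; [|exact: cintg_L2MJ|exact: cintg_L2MJ].
by apply: eq_Cint => x; rewrite rmorphB mulrBr.
Qed.

Lemma innerZ (c : R[i]) f g : inL2 f -> inL2 g ->
  inner f (fun x => c * g x) = c^* * inner f g.
Proof.
move=> f2 g2; rewrite -[RHS]CintZ; last exact: cintg_L2MJ.
by apply: eq_Cint => x; rewrite conjcM mulrCA.
Qed.

Lemma inner_self f : inL2 f -> inner f f = (nrm2 f)%:C.
Proof.
move=> f2; rewrite -[LHS]/(Cint mu _); apply: ReIm_inj => /=.
  by apply: eq_Rintegral => x _; rewrite mulJc.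
rewrite /Rintegral; under eq_integral do rewrite mulJc /=.
by rewrite integral0.
Qed.

Lemma bessel (e : nat -> R -> R[i]) g N : (forall n, inL2 (e n)) ->
  (forall m n, inner (e m) (e n) = (m == n)%:R) -> inL2 g ->
  \sum_(0 <= n < N) nc (inner (e n) g) ^+ 2 <= nrm2 g.
Proof.
move=> e2 eo g2.
(* [r] is the remainder of [g] after removing its components along the first [N] vectors. The
   induction closes because its coefficients along the later vectors are still those of [g]. *)
suff [r [r2 rE rS]] : exists r, [/\ inL2 r,
    forall j, (N <= j)%N -> inner (e j) r = inner (e j) g &
    nrm2 r + \sum_(0 <= n < N) nc (inner (e n) g) ^+ 2 = nrm2 g].
  by rewrite -rS lerDr nrm2_ge0.
elim: N => [|N [r [r2 rE rS]]].
  by exists g; split => //; rewrite big_geq// addr0.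
(* [inner] is linear in its first argument, so the component of [g] along [e N] has the conjugate of
   [c] as its coefficient. *)
pose c := inner (e N) g; have ce2 := inL2Z c^* (e2 N).
exists (fun x => r x - c^* * e N x); split.
- exact: inL2B.
- move=> j Nj; rewrite innerB// innerZ// eo gtn_eqF// mulr0 subr0 rE//.
  exact: ltnW.
- suff E : nrm2 (fun x => r x - c^* * e N x) = nrm2 r - nc c ^+ 2.
    by rewrite big_nat_recr// E -rS -/c [X in _ + X]addrC addrA subrK.
  rewrite nrm2B// innerZ// nrm2Z// ncJ innerC// rE// -/c.
  have -> : nrm2 (e N) = 1.
    by have := inner_self (e2 N); rewrite eo eqxx => /(congr1 (@complex.Re R)) /= <-.
  have -> : c^*^* = c by exact: conjcK.
  by rewrite mulJc -[complex.Re _]/(nc c ^+ 2) mulr1; ring.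
Qed.

End bessel.

Section parametric_measurability.
Local Open Scope complex_scope.
Local Open Scope ring_scope.
Variable R : realType.

(** Tonelli on the positive and negative parts, so joint integrability is not asked for: k(t) f(x -
    t) with [f] merely in L^2 may fail to be integrable on the plane. *)
Lemma measurable_Rintegral_param (h : R * R -> R) : measurable_fun setT h ->
  measurable_fun setT (fun x : R => Rintegral mu setT (fun t => h (x, t))).
Proof.
move=> mh; have mh' : measurable_fun setT (fun z : R * R => (h z)%:E) by exact/measurable_EFinP.
apply: (measurableT_comp (fine_measurable measurableT)).
under eq_fun do rewrite integralE.
apply: emeasurable_funB.
- have := @measurable_fun_fubini_tonelli_F _ _ (measurableTypeR R) (measurableTypeR R) R mu _
    (measurable_funepos mh') (funepos_ge0 _).
  apply: eq_measurable_fun => x _; apply: eq_integral => t _.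
  by rewrite !funeposE.
- have := @measurable_fun_fubini_tonelli_F _ _ (measurableTypeR R) (measurableTypeR R) R mu _
    (measurable_funeneg mh') (funeneg_ge0 _).
  apply: eq_measurable_fun => x _; apply: eq_integral => t _.
  by rewrite !funenegE.
Qed.

Lemma cmeas_Cint_param (h : R * R -> R[i]) : cmeas h ->
  cmeas (fun x : R => Cint mu (fun t => h (x, t))).
Proof.
move=> [h1 h2]; split.
- exact: (measurable_Rintegral_param h1).
- exact: (measurable_Rintegral_param h2).
Qed.

End parametric_measurability.

(** * Convolution followed by multiplication *)

Section convolution_operator.
Local Open Scope complex_scope.
Local Open Scope ring_scope.
Variables (R : realType) (a : R) (k m : R -> R[i]).
Hypotheses (kk : kernel_on a k) (m2 : inL2 m).
Implicit Types (f g : R -> R[i]) (x : R).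

Definition conv f x : R[i] := Cint mu (fun t => k t * f (x - t)).

Definition mconv f x : R[i] := m x * conv f x.

Let k2 := kernel_inL2 kk.

Lemma conv_cintg f x : inL2 f -> cintg mu (fun t => k t * f (x - t)).
Proof. by move=> f2; apply: cintg_L2M => //; exact: inL2_reflect. Qed.

Lemma cmeas_conv f : inL2 f -> cmeas (conv f).
Proof.
move=> f2; apply: (@cmeas_Cint_param R (fun z => k z.2 * f (z.1 - z.2))).
apply: cmeasM; first exact: (cmeas_comp measurable_snd (inL2_meas k2)).
have ms : measurable_fun setT (fun z : R * R => z.1 - z.2) by exact: measurable_funB.
exact: (cmeas_comp ms (inL2_meas f2)).
Qed.

(** Cauchy-Schwarz bounds the convolution uniformly in [x], so the square-integrability of [mconv]
    comes from [m] alone. *)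
Lemma conv_bound f x : inL2 f -> nc (conv f x) ^+ 2 <= nrm2 k * nrm2 f.
Proof.
move=> f2; rewrite -(nrm2_reflect x (inL2_meas f2)).
by apply: L2_cauchy_schwarz => //; exact: inL2_reflect.
Qed.

Lemma mconv_bound f x : inL2 f ->
  nc (mconv f x) ^+ 2 <= nrm2 k * nrm2 f * nc (m x) ^+ 2.
Proof.
by move=> f2; rewrite Normc.normcM exprMn mulrC ler_wpM2r ?sqr_ge0// conv_bound.
Qed.

Lemma mconv_inL2 f : inL2 f -> inL2 (mconv f).
Proof.
move=> f2; have [mm im] := (inL2P m).1 m2.
have mf : cmeas (mconv f) by apply: cmeasM => //; exact: cmeas_conv.
apply/inL2P; split => //.
apply: (le_integrable measurableT _ _ (rintgZ (nrm2 k * nrm2 f) im)).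
  by apply/measurable_EFinP; exact: measurable_nc2.
move=> x _; rewrite lee_fin ger0_norm ?sqr_ge0//.
by apply: le_trans (ler_norm _); exact: mconv_bound.
Qed.

Lemma nrm2_mconv f : inL2 f -> nrm2 (mconv f) <= nrm2 k * nrm2 f * nrm2 m.
Proof.
move=> f2; have [_ im] := (inL2P m).1 m2; have [_ imf] := (inL2P _).1 (mconv_inL2 f2).
rewrite -RintegralZl//; apply: le_Rintegral; [exact: measurableT|exact: imf|exact: rintgZ|].
by move=> x _; exact: mconv_bound.
Qed.

Lemma mconv_bounded : bounded_operator mconv.
Proof.
split.
- exact: mconv_inL2.
(* A change of [f] on a null set leaves the integral unchanged at every [x], so the images are equal
   as functions. *)
- move=> f g f2 g2 fg; rewrite (_ : mconv f = mconv g).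
    by exists set0; split => // x /= /(_ erefl).
  apply/funext => x; congr (_ * _).
  apply: eq_Cint_ae; [exact: cintg_meas (conv_cintg x f2)|exact: cintg_meas (conv_cintg x g2)|].
  have [A [mA A0 fgA]] := aeeq_reflect x fg; exists A; split => // t /= ft.
  by apply: fgA => /= E; apply: ft; rewrite E.
- move=> c f g f2 g2; exists set0; split => // x /= []; rewrite /mconv.
  have -> : conv (fun x => c * f x + g x) x = c * conv f x + conv g x.
    rewrite /conv -CintZ; last exact: conv_cintg.
    rewrite -CintD; [|by apply: cintgZ; exact: conv_cintg|exact: conv_cintg].
    by apply: eq_Cint => t; rewrite mulrDr mulrCA.
  by rewrite mulrDr mulrCA.
- exists (Num.sqrt (nrm2 k * nrm2 m)) => f f2.
  rewrite (L2norm_nrm2 (mconv_inL2 f2)) (L2norm_nrm2 f2) -EFinM lee_fin.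
  rewrite -sqrtrM ?mulr_ge0 ?nrm2_ge0// ler_sqrt ?mulr_ge0 ?nrm2_ge0//.
  by rewrite mulrAC nrm2_mconv.
Qed.

Lemma mconv_hilbert_schmidt : hilbert_schmidt mconv.
Proof.
split; first exact: mconv_bounded.
move=> e [e2 eo _]; have [_ im] := (inL2P m).1 m2.
pose u n x := (nc (mconv (e n) x) ^+ 2)%:E.
have mu_ n : measurable_fun setT (u n).
  apply/measurable_EFinP; apply: measurable_nc2.
  exact: inL2_meas (mconv_inL2 (e2 n)).
have u0 n x : (0 <= u n x)%E by rewrite lee_fin sqr_ge0.
rewrite (eq_eseriesr (g := fun n => \int[mu]_x u n x)%E); last by move=> n _; rewrite sqr_L2norm.
rewrite -(integral_nneseries mu measurableT mu_ (fun n x _ => u0 n x)).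
have ib := rintgZ (nrm2 k) im.
apply: le_lt_trans (integrable_lty measurableT ib).
have us0 x : (0 <= \sum_(0 <= n <oo) u n x)%E by exact: nneseries_ge0.
apply: ge0_le_integral => //.
- by apply: ge0_emeasurable_sum => [n x _ _|n _]; [exact: u0|exact: mu_].
- by have /integrableP[] := ib.
move=> x _; apply: lime_le; first exact: is_cvg_nneseries.
apply: nearW => N; rewrite sumEFin lee_fin.
under eq_bigr do rewrite Normc.normcM exprMn.
rewrite -mulr_sumr mulrC ler_wpM2r ?sqr_ge0//.
(* Bessel is applied to the conjugate of [k]: the convolution of [k] with [e n] at [x] is the inner
   product of t -> e n (x - t) with that conjugate. *)
rewrite -(nrm2J k).
have r2 n : inL2 (fun t : R => e n (x - t)) by exact: inL2_reflect.
have ro i j : inner (fun t : R => e i (x - t)) (fun t : R => e j (x - t)) = (i == j)%:R.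
  rewrite -eo; apply: (@Cint_reflect R x (fun t => e i t * (e j t)^*)).
  by apply: cmeasM; [exact: inL2_meas|apply: cmeasJ; exact: inL2_meas].
have := bessel N r2 ro (inL2J k2); apply: le_trans.
rewrite le_eqVlt; apply/orP; left; apply/eqP; apply: eq_bigr => n _.
congr (nc _ ^+ 2); apply: eq_Cint => t; rewrite mulrC.
by have -> : (k t)^*^* = k t by exact: conjcK.
Qed.

End convolution_operator.

(** * The band-limited multiplier and its action on [phi] *)

Section bandlimited_multiplier.
Local Open Scope complex_scope.
Local Open Scope ring_scope.
Variable R : realType.
Implicit Types (B d x u : R).

Lemma cintg_win B : cintg mu (fun t : R => (win B t)%:C : R[i]).
Proof.
apply: (@bounded_supp_cintg _ _ B 1).
- by apply: cmeas_real; exact: measurable_win.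
- by move=> t tB; rewrite win_out.
- by move=> t; rewrite ncR ger0_norm ?win_ge0 ?win_le1.
Qed.

Lemma inL2_win B : inL2 (fun t : R => (win B t)%:C : R[i]).
Proof.
apply: (@bounded_supp_inL2 _ _ B 1).
- by apply: cmeas_real; exact: measurable_win.
- by move=> t tB; rewrite win_out.
- by move=> t; rewrite ncR ger0_norm ?win_ge0 ?win_le1.
Qed.

Lemma integral_cos_itv B u : 0 < B -> u != 0 ->
  Rintegral mu `[- B, B]%classic (fun t => cos (u * t)) = 2 * sin (u * B) / u.
Proof.
move=> B0 u0; pose F (t : R) := u^-1 * sin (u * t).
have dF (t : R) : is_derive t 1 F (cos (u * t)).
  have h := is_deriveZ (u^-1) (is_derive1_comp (is_derive_sin _) (is_derive_mull u t)).
  by apply: (is_derive_eq h); rewrite /GRing.scale /= mulrCA mulVf ?mulr1.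
rewrite /Rintegral (@continuous_FTC2 _ _ F).
- change (F B - F (- B) = 2 * sin (u * B) / u).
  by rewrite /F mulrN sinN; field; exact: u0.
- lra.
- apply: continuous_subspaceT => t.
  apply: continuous_comp; last exact: continuous_cos.
  by apply: cvgMl_tmp; exact: cvg_id.
- have cF : continuous F.
    by move=> t; apply: differentiable_continuous; apply/derivable1_diffP; exact: ex_derive.
  split.
  + by move=> t _; exact: ex_derive.
  + by apply: cvg_at_right_filter; exact: cF.
  + by apply: cvg_at_left_filter; exact: cF.
- by move=> t _; rewrite derive1E; exact: derive_val.
Qed.

Lemma Rintegral_win_cc B (h : R -> R) : continuous h ->
  Rintegral mu setT (fun x => win B x * h x) = Rintegral mu `[- B, B]%classic h.
Proof.
move=> ch; rewrite Rintegral_win.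
have ic : mu.-integrable `[- B, B] (EFin \o h).
  apply: continuous_compact_integrable; first exact: segment_compact.
  exact: continuous_subspaceT.
rewrite Rintegral_itv_obnd_cbnd; last first.
  by apply: integrableS ic => // x /=; rewrite !in_itv /= => /andP[? ?]; rewrite !ltW.
rewrite Rintegral_itv_bndo_bndc//.
by apply: integrableS ic => // x /=; rewrite !in_itv /= => /andP[-> /ltW].
Qed.

Lemma phi_IFT B : 0 < B -> phi B = IFT (fun xi : R => (win B xi)%:C : R[i]).
Proof.
move=> B0; apply/funext => x; apply: ReIm_inj.
- transitivity (Rintegral mu setT (fun xi => win B xi * cos (2 * pi * x * xi))); last first.
    by apply: eq_Rintegral => xi _; rewrite ReZ Re_cis.
  rewrite -[LHS]/(if x == 0 then 2 * B else sin (2 * pi * B * x) / (pi * x)).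
  have [->|x0] := eqVneq x 0.
    have /(congr1 (@complex.Re R)) /= <- := Cint_win B0.
    by apply: eq_Rintegral => xi _; rewrite mulr0 mul0r cos0 mulr1.
  have p0 : (pi : R) != 0 by rewrite gt_eqF// pi_gt0.
  rewrite Rintegral_win_cc; last first.
    move=> t; apply: continuous_comp; last exact: continuous_cos.
    by apply: cvgMl_tmp; exact: cvg_id.
  rewrite integral_cos_itv ?mulf_neq0//.
  have -> : 2 * pi * B * x = 2 * pi * x * B by ring.
  by move: (sin _) => w; move: (pi : R) p0 => p p0; field; rewrite p0 x0.
- transitivity (Rintegral mu setT (fun xi => win B xi * sin (2 * pi * x * xi))); last first.
    by apply: eq_Rintegral => xi _; rewrite ImZ Im_cis.
  rewrite -[LHS]/(0 : R); set I := RHS.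
  have ms : measurable_fun setT (fun xi : R => win B xi * sin (2 * pi * x * xi)).
    apply: measurable_funM; first exact: measurable_win.
    apply: measurableT_comp; last exact: measurable_funM.
    by apply: continuous_measurable_fun; exact: continuous_sin.
  suff : I = - I by move=> II; lra.
  rewrite {1}/I -(Rintegral_reflect 0 ms) -mulN1r -RintegralZl//.
    by apply: eq_Rintegral => t _; rewrite sub0r /win normrN mulrN sinN mulrN mulN1r.
  apply: le_integrable (integrable_win B) => //; first exact/measurable_EFinP.
  move=> t _; rewrite lee_fin normrM -[leRHS]mulr1; apply: ler_wpM2l => //.
  by rewrite ler_norml sin_geN1 sin_le1.
Qed.

Lemma phi_inL2 B : 0 < B -> inL2 (phi B).
Proof.
by move=> B0; rewrite phi_IFT//; exact: (IFT_inL2_le (cintg_win B) (inL2_win B)).1.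
Qed.

(** The average of the characters with frequencies in ]-d, d[. As such it is bounded by 1, equals 1
    at the origin and tends to 1 pointwise as d -> 0. *)
Definition multiplier d x : R[i] := ((2 * d)^-1)%:C * phi d x.

Lemma multiplier_inL2 d : 0 < d -> inL2 (multiplier d).
Proof. by move=> d0; apply: inL2Z; exact: phi_inL2. Qed.

Lemma cintg_win_phase B x : cintg mu (fun xi : R => (win B xi)%:C * cis (2 * pi * x * xi)).
Proof. by apply: cintg_phase; [exact: measurable_funM|exact: cintg_win]. Qed.

Lemma multiplier_sub1_le d x : 0 < d -> nc (multiplier d x - 1) <= 4 * pi * `|x| * d.
Proof.
move=> d0; have d20 : 0 < 2 * d by rewrite mulr_gt0.
have -> : multiplier d x - 1 =
    ((2 * d)^-1)%:C * (phi d x - Cint mu (fun t : R => (win d t)%:C : R[i])).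
  have E : ((2 * d)^-1)%:C * (2 * d)%:C = 1 :> R[i] by rewrite -rmorphM mulVf// gt_eqF.
  by rewrite mulrBr Cint_win// E.
rewrite phi_IFT// /IFT -CintB; [|exact: cintg_win_phase|exact: cintg_win].
have cI := cintgB (cintg_win_phase d x) (cintg_win d).
rewrite Normc.normcM ncR gtr0_norm ?invr_gt0// ler_pdivrMl//.
apply: le_trans (le_nc_Cint cI) _.
have -> : 2 * d * (4 * pi * `|x| * d) =
    Rintegral mu setT (fun t => 4 * pi * `|x| * d * win d t).
  rewrite RintegralZl; [|exact: measurableT|exact: integrable_win].
  by have /(congr1 (@complex.Re R)) /= -> := Cint_win d0; ring.
apply: le_Rintegral; [exact: measurableT|exact: (cintg_nc cI)| |].
  by apply: rintgZ; exact: integrable_win.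
move=> t _; have [td|td] := ltP `|t| d; last first.
  by rewrite win_out// mul0r subrr Normc.normc0 mulr0.
rewrite win_in// mul1r mulr1; apply: le_trans (nc_cis_sub1 _) _.
rewrite !normrM (ger0_norm (ltW (pi_gt0 R))) (ger0_norm (_ : 0 <= 2))//.
have -> : 4 * pi * `|x| * d = 2 * (2 * pi * `|x| * d) by ring.
by rewrite ler_wpM2l// ler_wpM2l ?mulr_ge0 ?(ltW (pi_gt0 R))// ltW.
Qed.

Lemma multiplier_le1 d x : 0 < d -> nc (multiplier d x) <= 1.
Proof.
move=> d0; have d20 : 0 < 2 * d by rewrite mulr_gt0.
rewrite Normc.normcM ncR gtr0_norm ?invr_gt0// ler_pdivrMl// mulr1.
rewrite phi_IFT//; apply: le_trans (le_nc_Cint (cintg_win_phase d x)) _.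
have /(congr1 (@complex.Re R)) /= <- := Cint_win d0.
rewrite le_eqVlt; apply/orP; left; apply/eqP; apply: eq_Rintegral => t _.
transitivity (nc ((win d t)%:C * cis (2 * pi * x * t))) => //.
by rewrite Normc.normcM nc_cis mulr1 ncR ger0_norm// win_ge0.
Qed.

Lemma multiplier_approx1 (f : R -> R[i]) (b e : R) : 0 < b -> 0 < e -> inL2 f ->
  exists2 d, 0 < d <= b & nrm2 (fun x => multiplier d x * f x - f x) < e.
Proof.
move=> b0 e0 f2; have [mf fi] := (inL2P f).1 f2.
pose d j : R := b * j.+1%:R^-1.
have d0 j : 0 < d j by rewrite mulr_gt0// invr_gt0.
have H : (fun j : nat => \int[mu]_x (nc (multiplier (d j) x * f x - f x) ^+ 2)%:E)%E @ \oo
    --> (\int[mu]_x (0 : R)%:E)%E.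
  apply: (@dominated_cvg _ _ _ mu setT measurableT _ _
    (fun x => (4 * nc (f x) ^+ 2)%:E)) => //.
  - move=> j; apply/measurable_EFinP; apply: measurable_nc2; apply: cmeasB => //.
    by apply: cmeasM => //; exact: inL2_meas (multiplier_inL2 (d0 j)).
  - move=> x _; apply: (@cvg_EFin _ _ _ _ _ 0); first exact: nearW.
    apply: (@squeeze_cvgr _ _ _ _ (cst 0)
      (fun j => (4 * pi * `|x| * nc (f x)) ^+ 2 * ((b * j.+1%:R^-1) * (b * j.+1%:R^-1)))).
    + near=> j; rewrite /= sqr_ge0 /= -{2}(mul1r (f x)) -mulrBl Normc.normcM.
      rewrite -expr2 -exprMn ler_pXn2r ?nnegrE ?mulr_ge0 ?nc_ge0 ?(ltW (pi_gt0 R)) ?(ltW b0) ?invr_ge0//.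
      rewrite mulrAC; apply: ler_wpM2r; first exact: nc_ge0.
      exact: multiplier_sub1_le.
    + exact: cvg_cst.
    + have cv : (fun j : nat => b * (j.+1%:R^-1 : R)) @ \oo --> b * 0.
        by apply: (cvgMl_tmp (a := b)); exact: (@cvg_harmonic R).
      have := cvgMl_tmp (a := (4 * pi * `|x| * nc (f x)) ^+ 2) (cvgM cv cv).
      by rewrite !mulr0 => cv2; exact: cv2.
  - exact: rintgZ.
  - move=> j x _; rewrite lee_fin ger0_norm ?sqr_ge0//.
    have -> : 4 * nc (f x) ^+ 2 = (2 * nc (f x)) ^+ 2 by ring.
    rewrite ler_pXn2r ?nnegrE ?mulr_ge0 ?nc_ge0//.
    apply: le_trans (ncB _ _) _; rewrite mulr_natl mulr2n lerD2r Normc.normcM.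
    by rewrite ler_piMl ?nc_ge0 ?multiplier_le1.
rewrite integral0 in H.
have h0 : (fun j : nat => nrm2 (fun x => multiplier (d j) x * f x - f x)) @ \oo --> (0 : R).
  exact: fine_cvg H.
have [j _ /(_ j (leqnn j)) /=] := (cvgrPdist_lt (V := R^o)
  (fun j : nat => nrm2 (fun x => multiplier (d j) x * f x - f x)) 0).1 h0 e e0.
rewrite sub0r normrN ger0_norm ?nrm2_ge0// => h.
exists (d j) => //; rewrite d0 /= /d ler_piMr ?(ltW b0)//.
by rewrite invf_le1// ler1n.
Unshelve. all: by end_near. Qed.

Lemma conv_phi (a B : R) k : kernel_on a k -> 0 < B ->
  conv k (phi B) = IFT (fun xi => (win B xi)%:C * FT k xi).
Proof.
move=> kk B0; have ck := kernel_cintg kk; apply/funext => x.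
pose K (z : R * R) : R[i] := k z.1 * ((win B z.2)%:C * cis (2 * pi * (x - z.1) * z.2)).
have mK : cmeas K.
  apply: cmeasM; first exact: (cmeas_comp measurable_fst (cintg_meas ck)).
  apply: cmeasM; first by apply: cmeas_real; exact: (measurableT_comp (measurable_win B) measurable_snd).
  apply: cmeas_cis; apply: measurable_funM => //; apply: measurable_funM => //.
  exact: measurable_funB.
have Kab (t xi : R) : nc (K (t, xi)) <= nc (k t) * win B xi.
  by rewrite !Normc.normcM nc_cis mulr1 ncR ger0_norm ?win_ge0.
transitivity (Cint mu (fun t => Cint mu (fun xi => K (t, xi)))).
  apply: eq_Cint => t; rewrite phi_IFT// -CintZ//.
  exact: cintg_win_phase.
rewrite (cdom_fubini (cintg_nc ck) (integrable_win B) mK Kab).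
apply: eq_Cint => xi.
transitivity ((win B xi)%:C * cis (2 * pi * x * xi) * FT k xi); last by rewrite mulrAC.
rewrite -CintZ; last exact: cintg_FT.
apply: eq_Cint => t; rewrite /K /=.
have -> : 2 * pi * (x - t) * xi = 2 * pi * x * xi + - (2 * pi * t * xi) by ring.
by rewrite cisD; ring.
Qed.

End bandlimited_multiplier.

(** * The spreading function *)

Section plane_borel.
Local Open Scope complex_scope.
Local Open Scope ring_scope.
Variable R : realType.

(** Links the norm topology of the plane to the product sigma-algebra: an open set is the union of
    the rational boxes that it contains, and these are countably many. *)
Lemma open_measurable_plane (U : set (R^o * R^o)%type) : open U ->
  measurable (U : set (measurableTypeR R * measurableTypeR R)).
Proof.
move=> oU.
pose box (q : (rat * rat) * (rat * rat)) : set (measurableTypeR R * measurableTypeR R) :=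
  ball (ratr q.1.1 : R) (ratr q.1.2) `*` ball (ratr q.2.1 : R) (ratr q.2.2).
pose F q : set (measurableTypeR R * measurableTypeR R) :=
  if `[< box q `<=` U >] then box q else set0.
have -> : U = \bigcup_q F q.
  apply/seteqP; split => [z Uz|z [q _]]; last by rewrite /F; case: asboolP => // h /h.
  have /nbhs_ballP [r /= r0 rU] : nbhs z U by rewrite nbhsE; exists U.
  have ball_rat (x : R) : exists c s, let B : set R := ball (@ratr R c) (ratr s) in
      x \in B /\ B `<=` ball x r.
    by apply: open_subball_rat; [exact: ball_open|rewrite inE; exact: ballxx].
  have [c1 [s1 [zB1 B1]]] := ball_rat z.1.
  have [c2 [s2 [zB2 B2]]] := ball_rat z.2.
  rewrite !inE in zB1 zB2.
  exists ((c1, s1), (c2, s2)) => //; rewrite /F; case: asboolP => [_|[]]; first by split.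
  by move=> w [w1 w2]; apply: rU; split; [exact: B1|exact: B2].
apply: countable_bigcupT_measurable; first exact: countableP.
move=> q; rewrite /F; case: asboolP => _; last exact: measurable0.
by apply: measurableX; exact: measurable_ball.
Qed.

Lemma continuous_measurable_plane (h : (R^o * R^o)%type -> R^o) : continuous h ->
  measurable_fun setT (h : measurableTypeR R * measurableTypeR R -> R).
Proof.
move=> /continuousP ch; apply: (measurability _ (RGenOpens.measurableE R)).
move=> _ [_ [a [b ->] <-]]; rewrite setTI; apply: open_measurable_plane.
by apply: ch; exact: interval_open.
Qed.

End plane_borel.

(** * Measurability and integrability of Schwartz functions *)

Section schwartz_functions.
Local Open Scope complex_scope.
Local Open Scope ring_scope.
Variable R : realType.

Lemma schwartz_decay (V : normedModType R) (f : V -> R[i]) n : schwartz f ->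
  exists C : R, forall z, (1 + `|z|) ^+ n * nc (f z) <= C.
Proof.
move=> [_ /(_ [::] n)[C fC]]; exists C => z; apply: le_trans (fC z).
rewrite le_eqVlt; apply/orP; left; apply/eqP; congr (_ * nc _).
by rewrite /citer_derive /=; case: (f z).
Qed.

Lemma schwartz_bounded (V : normedModType R) (f : V -> R[i]) : schwartz f ->
  exists C : R, forall z, nc (f z) <= C.
Proof.
by move=> /(@schwartz_decay _ _ 0)[C fC]; exists C => z; have := fC z; rewrite expr0 mul1r.
Qed.

Lemma schwartz_cmeas_plane (F : (R^o * R^o)%type -> R[i]) : schwartz F ->
  cmeas (F : measurableTypeR R * measurableTypeR R -> R[i]).
Proof.
move=> [[/(_ [::])[c1 _] /(_ [::])[c2 _]] _].
by split; exact: continuous_measurable_plane.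
Qed.

Lemma schwartz_cmeas (f : R^o -> R[i]) : schwartz f -> cmeas (f : R -> R[i]).
Proof.
move=> [[/(_ [::])[c1 _] /(_ [::])[c2 _]] _].
by split; exact: continuous_measurable_fun.
Qed.

Lemma schwartz_cintg (f : R^o -> R[i]) : schwartz f -> cintg mu (f : R -> R[i]).
Proof.
move=> sf; have [C fC] := schwartz_decay 2 sf; have p0 := pi_gt0 R.
have e0 : 0 < 2 * pi :> R by rewrite mulr_gt0.
(* With parameter 2 pi the Poisson kernel is 1 / (pi (1 + x^2)), a ready-made integrable majorant,
   since 1 + x^2 <= (1 + |x|)^2. *)
have ip : mu.-integrable setT (EFin \o (@poisson R (2 * pi))).
  apply/integrableP; split.
    by apply/measurable_EFinP; exact: continuous_measurable_fun (continuous_poisson e0).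
  rewrite (_ : (\int[mu]_x _)%E = (\int[mu]_x (poisson (2 * pi) x)%:E)%E).
    by rewrite integral_poisson ?ltry.
  by apply: eq_integral => x _; rewrite /= ger0_norm// ltW// poisson_gt0.
have ip' := rintgZ (C * pi) ip.
apply: (@le_cintg _ (measurableTypeR R) _ _ _ _ (schwartz_cmeas sf) _ ip').
move=> x; have := fC x; have x0 : 0 <= `|x : R^o| by [].
have -> : poisson (2 * pi) x = pi^-1 * (1 + x ^+ 2)^-1.
  have xx : 1 + x ^+ 2 != 0 by rewrite gt_eqF// ltr_pwDl// sqr_ge0.
  rewrite /poisson; move: (pi : R) p0 => p p0; field.
  by rewrite xx !gt_eqF//= ltr_pwDl ?sqr_ge0// exprn_gt0// mulr_gt0.
move=> h.
have -> : C * pi * (pi^-1 * (1 + x ^+ 2)^-1) = C / (1 + x ^+ 2) by rewrite mulrA mulfK// gt_eqF.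
have xx : 0 < 1 + x ^+ 2 by rewrite ltr_pwDl// sqr_ge0.
rewrite ler_pdivlMr// mulrC; apply: le_trans h; rewrite ler_wpM2r ?nc_ge0//.
have -> : x ^+ 2 = `|x| ^+ 2 by rewrite -normrX ger0_norm// sqr_ge0.
have -> : (1 + `|x : R^o|) ^+ 2 = 1 + `|x| ^+ 2 + 2 * `|x| by rewrite -[`|x : R^o|]/(`|x|); ring.
by rewrite lerDl mulr_ge0.
Qed.

End schwartz_functions.

Section spreading.
Local Open Scope complex_scope.
Local Open Scope ring_scope.
Variables (R : realType) (a b : R) (k l : R -> R[i]).
Hypotheses (kk : kernel_on a k) (kl : kernel_on b l).
Implicit Types (F : (R^o * R^o)%type -> R[i]) (f g : R -> R[i]).

(* Integration against the spreading function [k t * l nu] of [mconv k (IFT l)]. *)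
Definition spread F : R[i] :=
  Cint mu (fun nu : R => l nu * Cint mu (fun t : R => k t * F (t, nu))).

Let ck := kernel_cintg kk.
Let cl := kernel_cintg kl.
Let mk := kernel_meas kk.
Let ml := kernel_meas kl.

Lemma spread_bound F : schwartz F ->
  [/\ forall nu, cintg mu (fun t : R => k t * F (t, nu)),
      cintg mu (fun nu : R => l nu * Cint mu (fun t : R => k t * F (t, nu)))
    & forall A, (forall z, nc (F z) <= A) ->
      nc (spread F) <= Rintegral mu setT (fun t => nc (k t)) *
        Rintegral mu setT (fun nu => nc (l nu)) * A].
Proof.
move=> sF; have [C FC] := schwartz_bounded sF.
pose G (z : R * R) : R[i] := k z.2 * F (z.2, z.1).
have mG : cmeas (G : measurableTypeR R * measurableTypeR R -> R[i]).
  apply: cmeasM; first exact: (cmeas_comp measurable_snd mk).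
  have ms : measurable_fun setT
      (fun z : measurableTypeR R * measurableTypeR R => (z.2, z.1)).
    exact: measurable_fun_pair.
  exact: (cmeas_comp ms (schwartz_cmeas_plane sF)).
have i1 := cintg_nc ck; have i2 := cintg_nc cl.
have ct nu : cintg mu (fun t : R => k t * F (t, nu)).
  apply: (@le_cintg _ (measurableTypeR R) _ _ _ (fun t => C * nc (k t))).
  - apply: cmeasM => //.
    have ms : measurable_fun setT (fun t : measurableTypeR R => (t, (nu : measurableTypeR R))).
      exact: measurable_fun_pair.
    exact: (cmeas_comp ms (schwartz_cmeas_plane sF)).
  - by move=> t; rewrite Normc.normcM mulrC ler_wpM2r ?nc_ge0.
  - exact: rintgZ.
have bound A nu : (forall z, nc (F z) <= A) ->
    nc (l nu * Cint mu (fun t : R => k t * F (t, nu))) <=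
    Rintegral mu setT (fun t => nc (k t)) * A * nc (l nu).
  move=> FA; rewrite Normc.normcM mulrC ler_wpM2r ?nc_ge0//.
  apply: le_trans (le_nc_Cint (ct nu)) _; rewrite mulrC.
  rewrite -RintegralZl//; apply: le_Rintegral; [exact: measurableT| |exact: rintgZ|].
    exact: (cintg_nc (ct nu)).
  by move=> t _; rewrite Normc.normcM mulrC ler_wpM2r ?nc_ge0.
have cn : cintg mu (fun nu : R => l nu * Cint mu (fun t : R => k t * F (t, nu))).
  apply: (@le_cintg _ (measurableTypeR R) _ _ _
    (fun nu => Rintegral mu setT (fun t => nc (k t)) * C * nc (l nu))).
  - by apply: cmeasM => //; exact: (cmeas_Cint_param mG).
  - by move=> nu; exact: bound.
  - exact: rintgZ.
split => // A FA; apply: le_trans (le_nc_Cint cn) _.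
rewrite mulrAC -RintegralZl//; apply: le_Rintegral; [exact: measurableT| |exact: rintgZ|].
  exact: (cintg_nc cn).
by move=> nu _; exact: bound.
Qed.

Lemma spread_tempered : tempered_distribution spread.
Proof.
split.
- move=> c F G sF sG; have [F1 F2 _] := spread_bound sF; have [G1 G2 _] := spread_bound sG.
  rewrite /spread -CintZ// -CintD//; last exact: cintgZ.
  apply: eq_Cint => nu; rewrite mulrCA -mulrDr; congr (_ * _).
  rewrite -CintZ// -CintD//; last exact: cintgZ.
  by apply: eq_Cint => t; rewrite mulrDr mulrCA.
(* Order 0: with no derivatives and no weight the seminorm is the supremum norm, and the constant is
   the product of the L^1 norms of [k] and [l]. *)
- exists 0%N, (Rintegral mu setT (fun t => nc (k t)) *
    Rintegral mu setT (fun nu => nc (l nu))) => F A sF FA.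
  have [_ _] := spread_bound sF; apply => z.
  have -> : F z = citer_derive [::] F z by rewrite /citer_derive /=; case: (F z).
  by have := FA [::] isT (fun v => False_ind _ \o (elimF idP (in_nil v))) z; rewrite expr0 mul1r.
Qed.

Lemma spread_supp :
  distr_supp spread `<=` `[- a, a]%classic `*` `[- b, b]%classic.
Proof.
move=> z; apply: contra_notP => zab.
exists (~` (`[- a, a]%classic `*` `[- b, b]%classic)); split => //.
- apply: closed_openC.
  by apply: closedI; apply: closed_comp; [move=> ? _; exact: cvg_fst|exact: interval_closed
    |move=> ? _; exact: cvg_snd|exact: interval_closed].
- move=> F [_ _ sub].
  have F0 t nu : `|t| < a -> `|nu| < b -> F (t, nu) = 0.
    move=> ta nb; apply/eqP/negPn/negP => nz.
    have /sub : closure [set z | F z != 0] (t, nu) by exact: subset_closure.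
    by apply; split => /=; rewrite in_itv /= -ler_norml ltW.
  rewrite /spread -[RHS](_ : Cint mu (fun _ : R => 0) = _); last first.
    by apply: ReIm_inj; rewrite /= /Rintegral integral0.
  apply: eq_Cint => nu; have [nb|nb] := ltP `|nu| b; last by rewrite (kernel_supp kl)// mul0r.
  rewrite -[RHS](mulr0 (l nu)); congr (_ * _).
  rewrite -[RHS](_ : Cint mu (fun _ : R => 0) = _); last first.
    by apply: ReIm_inj; rewrite /= /Rintegral integral0.
  apply: eq_Cint => t; have [ta|ta] := ltP `|t| a; last by rewrite (kernel_supp kk)// mul0r.
  by rewrite F0// mulr0.
Qed.

(** A triple integral in x, nu and t, treated as two interchanges of two variables: x with nu in
    [Q], where [psi] has already absorbed t, and then, for fixed nu, x with t in [L]. The bound on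
    [f] and the integrability of [k], [l] and [g] provide the domination. *)
Lemma spread_mconv (f g : R^o -> R[i]) : schwartz f -> schwartz g ->
  inner (mconv k (IFT l) f) g = spread (tf_shift_coef f g).
Proof.
move=> sf sg; have [C fC] := schwartz_bounded sf.
have C0 : 0 <= C by apply: le_trans (fC 0); exact: nc_ge0.
have cg := cintgJ (schwartz_cintg sg); have mf := schwartz_cmeas sf.
have i1 := rintgZ C (cintg_nc ck); have ig := cintg_nc cg; have i2 := cintg_nc cl.
pose K (z : R * R) : R[i] := k z.1 * (f (z.2 - z.1) * (g z.2)^*).
have mK : cmeas (K : measurableTypeR R * measurableTypeR R -> R[i]).
  apply: cmeasM; first exact: (cmeas_comp measurable_fst mk).
  apply: cmeasM; last exact: (cmeas_comp measurable_snd (cintg_meas cg)).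
  have ms : measurable_fun setT (fun z : measurableTypeR R * measurableTypeR R => z.2 - z.1).
    exact: measurable_funB.
  exact: (cmeas_comp ms mf).
have KC t x : nc (K (t, x)) <= C * nc (k t) * nc ((g x)^*).
  rewrite !Normc.normcM mulrA ler_wpM2r ?nc_ge0// mulrC ler_wpM2r ?nc_ge0//.
pose psi (x : R) := Cint mu (fun t : R => K (t, x)).
have cpsi : cintg mu psi := cdom_cintg2 i1 ig mK KC.
have psiE x : psi x = conv k f x * (g x)^*.
  rewrite mulrC -CintZ; last first.
    apply: (@le_cintg _ (measurableTypeR R) _ _ _ _ _ _ i1).
      apply: cmeasM => //; exact: cmeas_reflect.
    by move=> t; rewrite Normc.normcM mulrC ler_wpM2r ?nc_ge0.
  by apply: eq_Cint => t; rewrite /K /=; ring.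
pose Q (z : R * R) : R[i] := psi z.1 * (l z.2 * cis (2 * pi * z.1 * z.2)).
have mQ : cmeas (Q : measurableTypeR R * measurableTypeR R -> R[i]).
  apply: cmeasM; first exact: (cmeas_comp measurable_fst (cintg_meas cpsi)).
  apply: cmeasM; first exact: (cmeas_comp measurable_snd ml).
  by apply: cmeas_cis; apply: measurable_funM => //; exact: measurable_funM.
have Qb x nu : nc (Q (x, nu)) <= nc (psi x) * nc (l nu).
  by rewrite !Normc.normcM nc_cis mulr1.
transitivity (Cint mu (fun x : R => Cint mu (fun nu : R => Q (x, nu)))).
  apply: eq_Cint => x; rewrite /mconv -mulrA -psiE mulrC /IFT -CintZ//.
  apply: cintg_phase => //; exact: measurable_funM.
rewrite (cdom_fubini (cintg_nc cpsi) i2 mQ Qb).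
apply: eq_Cint => nu.
pose L (z : R * R) : R[i] := K z * cis (2 * pi * z.2 * nu).
have mL : cmeas (L : measurableTypeR R * measurableTypeR R -> R[i]).
  apply: cmeasM => //; apply: cmeas_cis; apply: measurable_funM => //.
  exact: measurable_funM.
have Lb t x : nc (L (t, x)) <= C * nc (k t) * nc ((g x)^*).
  by rewrite Normc.normcM nc_cis mulr1; exact: KC.
transitivity (l nu * Cint mu (fun x : R => Cint mu (fun t : R => L (t, x)))).
  rewrite -CintZ; last exact: (cdom_cintg2 i1 ig mL Lb).
  apply: eq_Cint => x; rewrite /Q /= mulrCA; congr (_ * _).
  rewrite mulrC -CintZ; last exact: (cdom_section2 i1 mK KC x).
  by apply: eq_Cint => t; rewrite mulrC.
congr (_ * _); rewrite -(cdom_fubini i1 ig mL Lb).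
apply: eq_Cint => t; rewrite /tf_shift_coef -CintZ.
  by apply: eq_Cint => x; rewrite /L /K /=; ring.
pose g' x := (g x)^*.
apply: (@le_cintg _ (measurableTypeR R) _ _ _ (fun x => C * nc (g' x))).
- apply: cmeasM; last exact: (cintg_meas cg).
  apply: cmeasM; first by apply: cmeas_cis; apply: measurable_funM => //; exact: measurable_funM.
  have ms : measurable_fun setT (fun x : measurableTypeR R => x - t) by exact: measurable_funB.
  exact: (cmeas_comp ms mf).
- by move=> x; rewrite !Normc.normcM nc_cis mul1r ler_wpM2r ?nc_ge0.
- exact: rintgZ.
Qed.

Lemma mconv_OPW : inL2 (IFT l) ->
  OPW (`[- a, a]%classic `*` `[- b, b]%classic) (mconv k (IFT l)).
Proof.
move=> l2; split; first exact: mconv_bounded kk l2.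
exists spread; split; last exact: spread_supp.
by split; [exact: spread_tempered|exact: spread_mconv].
Qed.

End spreading.

(** * Approximation *)

Section approximation.
Local Open Scope complex_scope.
Local Open Scope ring_scope.
Variables (R : realType) (alpha beta : R).
Hypotheses (alpha0 : 0 < alpha) (beta0 : 0 < beta).
Implicit Types (y yhat : R -> R[i]) (B M e : R).
Local Notation l2 f := (Num.sqrt (nrm2 f)).

Let rect : set (R^o * R^o)%type :=
  `[- alpha, alpha]%classic `*` `[- beta, beta]%classic.

Let approximable e y B :=
  exists H : (R -> R[i]) -> (R -> R[i]),
    [/\ hilbert_schmidt H, OPW rect H
      & (L2norm (fun x => H (phi B) x - y x)%R < e%:E)%E].

Lemma multiplier_IFT (d b : R) : 0 < d <= b -> exists2 l, kernel_on b l &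
  multiplier d = IFT l.
Proof.
move=> /andP[d0 db]; exists (fun nu => ((2 * d)^-1)%:C * (win d nu)%:C).
  apply: kernelZ; split.
  - by apply: cmeas_real; exact: measurable_win.
  - by move=> t tb; rewrite win_out// (le_trans db).
  - by exists 1 => t; rewrite ncR ger0_norm ?win_ge0 ?win_le1.
apply/funext => x; rewrite /multiplier phi_IFT// /IFT -CintZ; last exact: cintg_win_phase.
by apply: eq_Cint => nu; rewrite mulrA.
Qed.

(** The order of the choices matters. The multiplier does not tend to 1 uniformly, so [d] is picked
    only after [k], for the fixed function [IFT h], which is the convolution of [k] with [phi B]. *)
Lemma approximable_win e y yhat B : 0 < e -> inL2 y -> is_fourier y yhat -> 0 < B ->
  l2 (fun xi => (win B xi)%:C * yhat xi - yhat xi) < e / 4 -> approximable e y B.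
Proof.
move=> e0 y2 yF B0 tail; have [yh2 _] := yF.
have e40 : 0 < e / 4 by rewrite divr_gt0.
have e42 : 0 < (e / 4) ^+ 2 by rewrite exprn_gt0.
have winL2 h : inL2 h -> inL2 (fun xi => (win B xi)%:C * h xi).
  move=> h2; apply: le_inL2 (h2) _ => [|xi].
    apply: cmeasM; last exact: inL2_meas.
    by apply: cmeas_real; exact: measurable_win.
  by rewrite Normc.normcM ncR ger0_norm ?win_ge0// ler_piMl ?nc_ge0 ?win_le1.
have win0 h (xi : R) : B <= `|xi| -> (win B xi)%:C * h xi = 0 :> R[i].
  by move=> Bxi; rewrite win_out// mul0r.
have f2 := winL2 _ yh2.
have [k kk kf] := FT_kernel_dense B0 alpha0 e42 f2 (win0 yhat).
pose h xi := (win B xi)%:C * FT k xi.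
have [F2 _] := FT_inL2_le (kernel_cintg kk) (kernel_inL2 kk).
have h2 : inL2 h by exact: winL2.
have h0 : forall xi : R, B <= `|xi| -> h xi = 0 by exact: win0.
have I2 : inL2 (IFT h) := (IFT_inL2_le (inL2_supp_cintg h2 h0) h2).1.
have [d dlt mapp] := multiplier_approx1 beta0 e42 I2.
have [l kl ml] := multiplier_IFT dlt.
have m2 : inL2 (IFT l) by rewrite -ml; apply: multiplier_inL2; case/andP: dlt.
have sqrt_lt r : r < (e / 4) ^+ 2 -> Num.sqrt r < e / 4.
  by move=> re; rewrite -(ger0_norm (ltW e40)) -sqrtr_sqr ltr_sqrt.
exists (mconv k (IFT l)); split.
- exact: (mconv_hilbert_schmidt kk m2).
- exact: (mconv_OPW kk kl m2).
have p2 : inL2 (mconv k (IFT l) (phi B)).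
  exact: (mconv_inL2 kk m2 (phi_inL2 B0)).
rewrite (L2norm_nrm2 (inL2B p2 y2)) lte_fin.
apply: le_lt_trans (l2B p2 I2 y2) _.
(* Three quarters pay for the multiplier, the kernel and the tail; the last one makes the inequality
   strict. *)
have -> : e = e / 4 + (e / 4 + e / 4) + e / 4 by field.
apply: (@le_lt_trans _ _ (e / 4 + (e / 4 + e / 4))); last by rewrite ltrDl.
apply: lerD.
  apply: ltW; apply: sqrt_lt; move: mapp.
  by rewrite /mconv (conv_phi kk B0) -ml.
apply: le_trans (l2_IFT_sub h2 h0 y2 yF) _.
apply: le_trans (l2B h2 f2 yh2) _.
by apply: lerD; [apply: ltW; exact: sqrt_lt|exact: ltW].
Qed.

Lemma tail_nrm2 yhat B : inL2 yhat ->
  (\int[mu]_(xi in ~` `[(- B)%R, B]%classic) ((nc (yhat xi)) ^+ 2)%:E =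
   (nrm2 (fun xi => (win B xi)%:C * yhat xi - yhat xi))%:E)%E.
Proof.
move=> h2; have mh := inL2_meas h2.
have mw : cmeas (fun xi => (win B xi)%:C * yhat xi - yhat xi).
  by apply: cmeasB => //; apply: cmeasM => //; apply: cmeas_real; exact: measurable_win.
rewrite -nrm2E; last first.
  apply: le_inL2 mw h2 _ => xi; rewrite /win; case: ifP => _.
    by rewrite mul1r subrr Normc.normc0 nc_ge0.
  by rewrite mul0r sub0r ncN.
have mI : measurable (~` `[- B, B]%classic : set (measurableTypeR R)).
  by apply: measurableC; exact: measurable_itv.
rewrite integral_mkcond; apply: ge0_ae_eq_integral => //.
- apply/(measurable_restrictT _ mI); apply: measurable_funTS.
  by apply/measurable_EFinP; exact: measurable_nc2.
- by apply/measurable_EFinP; exact: measurable_nc2.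
- by move=> xi _; rewrite patchE; case: ifP => // _; rewrite lee_fin sqr_ge0.
- by move=> xi _; rewrite lee_fin sqr_ge0.
(* The integral excludes a closed interval whereas [win] is open, so the integrands may differ at
   the two end points. *)
exists [set B; - B]; split.
- by apply: measurableU; exact: measurable_set1.
- by apply: countable_lebesgue_measure0; apply: finite_set_countable; exact: finite_set2.
move=> xi /=; apply: contra_notP => /not_orP[xB xNB] _.
rewrite patchE in_setC mem_setE in_itv /= -ler_norml /win lt_neqAle.
have -> : (`|xi| == B) = false.
  apply/negbTE; apply/eqP => E; have [x0|x0] := lerP 0 xi.
    by apply: xB; rewrite -E ger0_norm.
  by apply: xNB; rewrite -E ltr0_norm// opprK.
case: (`|xi| <= B) => /=; first by rewrite mul1r subrr Normc.normc0 expr0n.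
by rewrite mul0r sub0r ncN.
Qed.

Lemma approximable_tail e y yhat B : 0 < e -> inL2 y -> is_fourier y yhat -> 0 < B ->
  (\int[mu]_(xi in ~` `[(- B)%R, B]%classic) ((nc (yhat xi)) ^+ 2)%:E <
    ((e / 4) ^+ 2)%:E)%E -> approximable e y B.
Proof.
move=> e0 y2 yF B0; rewrite (tail_nrm2 _ yF.1) lte_fin => tail.
apply: approximable_win yF _ _ => //.
have e40 : 0 < e / 4 by rewrite divr_gt0.
by rewrite -(ger0_norm (ltW e40)) -sqrtr_sqr ltr_sqrt// exprn_gt0.
Qed.

Lemma approximable_exists e y : 0 < e -> inL2 y ->
  exists2 B : R, 0 < B & approximable e y B.
Proof.
move=> e0 y2; have e20 : 0 < e / 2 by rewrite divr_gt0.
have [n /(_ n (leqnn n)) yn] := trunc_dist e20 y2.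
have yF := is_fourier_trunc n y2; have [F2 _] := yF.
(* Half of [e] goes to truncating [y]; the tail allowed by [approximable_win] at precision e / 2 is
   a quarter of that. *)
have e80 : 0 < e / 2 / 4 by rewrite divr_gt0.
have [N /(_ N (leqnn N)) FN] := trunc_dist e80 F2.
have T2 := inL2_trunc n y2.
(* The open window of radius [N.+1] contains the closed interval kept by [trunc N], so its tail is
   no larger. *)
exists N.+1%:R => //.
have [|H [HS HO HT]] := approximable_win e20 T2 yF (ltr0Sn R N).
  apply: le_lt_trans FN; rewrite ler_sqrt ?nrm2_ge0//; apply: le_nrm2.
  - apply: inL2B => //; apply: le_inL2 (F2) _ => [|xi].
      apply: cmeasM; last exact: inL2_meas.
      by apply: cmeas_real; exact: measurable_win.
    by rewrite Normc.normcM ncR ger0_norm ?win_ge0// ler_piMl ?nc_ge0 ?win_le1.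
  - by apply: inL2B => //; exact: inL2_trunc.
  move=> xi; have [xN|Nx] := ltP `|xi| N.+1%:R.
    by rewrite win_in// mul1r subrr Normc.normc0 nc_ge0.
  by rewrite win_out// mul0r sub0r trunc_supp// subr0 ncN.
exists H; split => //; have [Hb _] := HS.
have H2 := Hb.(bop_L2) (phi_inL2 (ltr0Sn R N)).
move: HT; rewrite (L2norm_nrm2 (inL2B H2 T2)) (L2norm_nrm2 (inL2B H2 y2)) !lte_fin => HT.
apply: le_lt_trans (l2B H2 T2 y2) _.
have -> : e = e / 2 + e / 2 by field.
apply: ltrD => //.
rewrite -nrm2N; rewrite (_ : (fun x => _) = (fun x => y x - trunc n y x))//.
by apply/funext => x; rewrite opprB.
Qed.

(** A Lindelöf argument: a point off the support lies in a rational ball on which [yhat] vanishes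
    almost everywhere. There are countably many such balls, enumerated by [unpickle], so their
    exceptional null sets can be united. *)
Lemma ess_supp_itv yhat M : ess_supp yhat `<=` `[- M, M]%classic ->
  {ae mu, forall x, (~` `[- M, M]%classic) x -> yhat x = 0}.
Proof.
move=> supp.
pose D (q : rat * rat) : set R := ball (@ratr R q.1) (ratr q.2).
pose P n (x : R) := if unpickle n is Some q then
  {ae mu, forall z : R, D q z -> yhat z = 0} -> D q x -> yhat x = 0 else True.
have aeP n : {ae mu, forall x, P n x}.
  rewrite /P; case: (unpickle n) => [q|]; last exact: aeW.
  have [h|h] := pselect {ae mu, forall z : R, D q z -> yhat z = 0}; last exact: aeW.
  by case: h => A [mA A0 sA]; exists A; split => // x /= nx; apply: sA => /= ?; apply: nx.
have /ae_foralln [A [mA A0 sA]] := aeP.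
exists A; split => // x /= nx; apply: sA => /= Px; apply: nx => xM.
apply: contrapT => yx; apply: xM; apply: supp => -[U [oU Ux aeU]]; apply: yx.
have [c [r [xD DU]]] : exists c r, let B : set R := ball (@ratr R c) (ratr r) in
    x \in B /\ B `<=` U by apply: open_subball_rat => //; rewrite inE.
have := Px (pickle (c, r)); rewrite /P pickleK; apply.
  by case: aeU => A' [mA' A0' sA']; exists A'; split => // z /= nz; apply: sA' => /= h;
    apply: nz => /DU; exact: h.
by rewrite inE in xD.
Qed.

Lemma approximable_bandlimited e y yhat M : 0 < e -> inL2 y -> is_fourier y yhat ->
  0 < M -> ess_supp yhat `<=` `[- M, M]%classic -> approximable e y M.
Proof.
move=> e0 y2 yF M0 /ess_supp_itv [A [mA A0 sA]]; apply: (approximable_tail e0 y2 yF M0).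
rewrite (ae_eq_integral (cst 0%E))//.
- by rewrite integral0 lte_fin exprn_gt0// divr_gt0.
- by apply: measurableC; exact: measurable_itv.
- apply: measurable_funTS; apply/measurable_EFinP; apply: measurable_nc2.
  exact: inL2_meas yF.1.
exists A; split => // x nx; apply: sA => /= h; apply: nx => /h /= ->.
by rewrite Normc.normc0 expr0n.
Qed.

End approximation.

Theorem theorem2 (R : realType) (alpha beta : R)
    (halpha : 0 < alpha) (hbeta : 0 < beta) (eps : R) (heps : 0 < eps) :
  let rect : set (R^o * R^o)%type :=
    `[- alpha, alpha]%classic `*` `[- beta, beta]%classic in
  let approximable (y : R -> R[i]) (B : R) :=
    exists H : (R -> R[i]) -> (R -> R[i]),
      [/\ hilbert_schmidt H, OPW rect H
        & (L2norm (fun x => H (phi B) x - y x)%R < eps%:E)%E] in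
  [/\ forall y : R -> R[i], inL2 y -> ~ aeeq y (cst 0) ->
        exists2 B : R, 0 < B & approximable y B,
      exists2 c : R, 0 < c < 1 &
        forall y yhat : R -> R[i],
          inL2 y -> ~ aeeq y (cst 0) -> is_fourier y yhat ->
          forall B : R, 0 < B ->
            (\int[@lebesgue_measure R]_(xi in ~` `[(- B)%R, B]%classic)
               ((Normc.normc (yhat xi)) ^+ 2)%:E < (c * eps)%:E)%E ->
            approximable y B
    & forall (y yhat : R -> R[i]) (M : R),
        inL2 y -> ~ aeeq y (cst 0) -> is_fourier y yhat -> 0 < M ->
        ess_supp yhat `<=` `[- M, M]%classic ->
        approximable y M ].
Proof.
move=> rect approximable; split.
- by move=> y y2 _; exact: approximable_exists.
- have e16 : 0 < eps / 16 by rewrite divr_gt0.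
  (* The hypothesis bounds the squared tail, for which (eps / 4)^2 = (eps / 16) eps is allowed; 1/2
     keeps the constant below 1. It depends on [eps] but neither on [y] nor on [B]. *)
  exists (Num.min 2^-1 (eps / 16)).
    rewrite lt_min e16 invr_gt0 ltr0n /= (@le_lt_trans _ _ 2^-1) ?ge_min ?lexx//.
    by rewrite invf_lt1// ltr1n.
  move=> y yhat y2 _ yF B B0 tail; apply: (approximable_tail halpha hbeta heps y2 yF B0).
  apply: lt_le_trans tail _; rewrite lee_fin.
  have -> : (eps / 4) ^+ 2 = eps / 16 * eps by field.
  by rewrite ler_pM2r// ge_min lexx orbT.
- by move=> y yhat M y2 _ yF M0; exact: approximable_bandlimited.
Qed.
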